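(* Let $n\ge 3$ be an integer. (i) Let $\alpha>0$. The isotropic critical point $h_0=\frac{1}{|\mathbb{S}^{n-1}|}$ of $\mathcal{A}$ is stable if and only if $\alpha\le \frac{n(n+2)}{2}$. (ii) For every integer $k$ with $2\le k\le [\frac n2]$, every $R\in O(n)$ and every $\eta\in\mathbb{R}\setminus\{0\}$, the critical point $h^{(k)}_{\eta,R}$ of $\mathcal{A}$ with $\alpha=\sigma_k(\eta)$ is not stable. (iii) For every $R\in O(n)$ and every $\eta\in\mathbb{R}\setminus\{0\}$, the critical point $h^{(1)}_{\eta,R}$ of $\mathcal{A}$ with $\alpha=\sigma_1(\eta)$ is stable when $\eta>\eta_1^*$ and unstable (i.e. not stable) when $\eta<\eta_1^*$, where $\eta_1^*:=\mathrm{argmin}\,\sigma_1$.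
   Context: For $\alpha>0$ and positive $f$ on the unit sphere $\mathbb{S}^{n-1}\subset\mathbb{R}^n$ with $\int_{\mathbb{S}^{n-1}}f(m)\,dm=1$, let $$\mathcal{A}[f]=\int_{\mathbb{S}^{n-1}}f(m)\log f(m)\,dm+\frac{\alpha}{2}\int_{\mathbb{S}^{n-1}\times\mathbb{S}^{n-1}}\big(1-(m\cdot m')^2\big)f(m)f(m')\,dm\,dm'.$$ A critical point of $\mathcal{A}$ is a solution $f$ of $\ln f(m)-\alpha\int_{\mathbb{S}^{n-1}}(m\cdot m')^2f(m')\,dm'=\mathrm{const}$ on $\mathbb{S}^{n-1}$. For $1\le k\le n-1$ and $\eta\in\mathbb{R}$, let $d\mu_k^\theta=\sin^{k-1}\theta\cos^{n-k-1}\theta\,d\theta$ on $[0,\frac\pi2]$ and $$\sigma_k(\eta):=\frac{(n-k)k\int_0^{\pi/2}e^{\eta\sin^2\theta}\,d\mu_k^\theta}{2\int_0^{\pi/2}e^{\eta\sin^2\theta}\sin^2\theta\cos^2\theta\,d\mu_k^\theta}.$$ For $R\in O(n)$ let $$h^{(k)}_{\eta,R}(m):=\frac{e^{\eta|P_kRm|^2}}{\int_{\mathbb{S}^{n-1}}e^{\eta|P_kRm'|^2}\,dm'},\qquad P_k(m_1,\dots,m_n)=(m_1,\dots,m_k,0,\dots,0).$$ This is a critical point of $\mathcal{A}$ when $\alpha=\sigma_k(\eta)$. The function $\sigma_1$ has a unique minimizer over $\mathbb{R}$, denoted $\eta_1^*$. $[x]$ denotes the integer part of $x$. Stability: let $V=\{\phi\in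 L^2(\mathbb{S}^{n-1}):\int_{\mathbb{S}^{n-1}}\phi\,dm=0\}$. A critical point $f_0$ of $\mathcal{A}$ is stable if the second variation of $\mathcal{A}$ at $f_0$ is nonnegative definite, i.e. for every $\phi\in V$, $$\Big\langle \frac{\delta^2\mathcal{A}}{\delta f^2}\Big|_{f=f_0}\phi,\phi\Big\rangle_{L^2(\mathbb{S}^{n-1})}=\int_{\mathbb{S}^{n-1}}\frac{\phi^2}{f_0}\,dm-\alpha\int_{\mathbb{S}^{n-1}\times\mathbb{S}^{n-1}}(m\cdot m')^2\phi(m)\phi(m')\,dm\,dm'\ \ge 0 .$$ *)

(* Defs.v *)
From HB Require Import structures.
From mathcomp Require Import all_boot all_order all_algebra.
From mathcomp Require Import all_classical all_reals all_analysis.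
From mathcomp Require Import measurable_realfun.
Set Implicit Arguments. Unset Strict Implicit. Unset Printing Implicit Defensive.
Import Order.TTheory GRing.Theory Num.Theory.
Import numFieldNormedType.Exports.
Local Open Scope classical_set_scope.
Local Open Scope ring_scope.

Section measure_cons.
Context d (T : measurableType d) (R : realType) (n : nat).
Variable m1 : {sigma_finite_measure set T -> \bar R}.
Variable m2 : {sigma_finite_measure set (n.-tuple T) -> \bar R}.

Definition cons_pair (p : T * n.-tuple T) : n.+1.-tuple T :=
  [tuple of p.1 :: p.2].

Lemma measurable_cons_pair : measurable_fun setT cons_pair.
Proof. exact: measurable_cons. Qed.

Definition measure_cons : set (n.+1.-tuple T) -> \bar R :=
  pushforward (m1 \x m2)%E cons_pair.

Let m0 : measure_cons set0 = 0%E.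
Proof. by rewrite /measure_cons /pushforward preimage_set0 measure0. Qed.

Let m_ge0 A : (0 <= measure_cons A)%E.
Proof. exact: (measure_ge0 (m1 \x m2)%E). Qed.

Let m_sadd : semi_sigma_additive measure_cons.
Proof.
move=> F mF tF mU; rewrite /measure_cons /pushforward preimage_bigcup.
have mpre A : measurable A -> measurable (cons_pair @^-1` A).
  by move=> mA; rewrite -[X in measurable X]setTI; exact: measurable_cons_pair.
apply: measure_semi_sigma_additive.
- by move=> i; exact: mpre.
- apply/trivIsetP => /= i j _ _ ij; rewrite -preimage_setI.
  by move/trivIsetP : tF => /(_ _ _ _ _ ij) ->//; rewrite preimage_set0.
- by rewrite -preimage_bigcup; exact: mpre.
Qed.

HB.instance Definition _ := isMeasure.Build _ _ _ measure_cons m0 m_ge0 m_sadd.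

Let m_sigma_finite : sigma_finite setT measure_cons.
Proof.
have /sigma_finiteP[F [TF ndF Foo]] := sigma_finiteT m1.
have /sigma_finiteP[G [TG ndG Goo]] := sigma_finiteT m2.
pose u (t : n.+1.-tuple T) : T * n.-tuple T := (thead t, [tuple of behead t]).
have mu : measurable_fun setT u.
  apply: measurable_fun_pair; first exact: measurable_tnth.
  exact: measurable_behead.
have uK p : u (cons_pair p) = p.
  by case: p => x t; congr pair; exact/val_inj.
exists (fun k => u @^-1` (F k `*` G k)).
  rewrite -preimage_bigcup (_ : \bigcup_i _ = setT) ?preimage_setT//.
  apply/seteqP; split => // -[x y] _.
  have [i _ Fx] : (\bigcup_i F i) x by rewrite -TF.
  have [j _ Gy] : (\bigcup_i G i) y by rewrite -TG.
  exists (maxn i j) => //; split => /=.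
    by move: x Fx; exact/subsetPset/ndF/leq_maxl.
  by move: y Gy; exact/subsetPset/ndG/leq_maxr.
move=> k; have [mF Fk] := Foo k; have [mG Gk] := Goo k; split.
  by rewrite -[X in measurable X]setTI; apply: mu => //; exact: measurableX.
rewrite /measure_cons /pushforward (_ : _ @^-1` _ = F k `*` G k).
  by rewrite product_measure1E// lte_mul_pinfty// ge0_fin_numE.
by apply/seteqP; split => p; rewrite /preimage/mkset uK.
Qed.

HB.instance Definition _ :=
  @Measure_isSigmaFinite.Build _ _ _ measure_cons m_sigma_finite.

End measure_cons.

(* R^n is represented by tuples because the library gives tuples, but not
   matrices, the product sigma-algebra; [measurableTypeR R] is the copy of [R]
   on which [lebesgue_measure] is declared. *)
Notation euclid R n := (n.-tuple (measurableTypeR R)).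

Fixpoint lebesgue_euclid (R : realType) (n : nat) :
    {sigma_finite_measure set (euclid R n) -> \bar R} :=
  match n with
  | 0 => \d_ ([tuple] : euclid R 0)
  | n'.+1 => measure_cons (@lebesgue_measure R) (lebesgue_euclid R n')
  end.

Definition cube (R : realType) n : set (euclid R n) :=
  [set x | forall i, `|tnth x i : R| <= 1].

Lemma measurable_cube (R : realType) n : measurable (@cube R n).
Proof.
rewrite (_ : @cube R n = \bigcap_(i in [set: 'I_n])
    (setT `&` (fun x : euclid R n => tnth x i) @^-1` `[-1, 1])).
  apply: fin_bigcap_measurable => // i _.
  by apply: measurable_tnth => //; exact: measurable_itv.
apply/seteqP; split => x /= x1 i; first by move=> _; rewrite setTI /= in_itv/= -ler_norml.
by have := x1 i I; rewrite setTI /= in_itv/= -ler_norml.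
Qed.

Lemma lebesgue_cube_lty (R : realType) n :
  (lebesgue_euclid R n (@cube R n) < +oo)%E.
Proof.
elim: n => [|n IH] /=; first by rewrite diracE ltry.
rewrite /measure_cons /pushforward.
rewrite (_ : _ @^-1` _ = `[-1, 1]%classic `*` @cube R n); last first.
  apply/seteqP; split => -[x y] /=.
    move=> H; split; first by have := H ord0; rewrite in_itv/= -ler_norml.
    by move=> i; have := H (lift ord0 i); rewrite tnthS.
  move=> [/= +] H i; rewrite in_itv/= -ler_norml => x1.
  by case: (unliftP ord0 i) => [j|] ->; rewrite ?tnthS//=; exact: H.
rewrite product_measure1E//; last exact: measurable_cube.
have fin11 : @lebesgue_measure R `[-1, 1]%classic \is a fin_num.
  by rewrite lebesgue_measure_itv/= lte_fin gtrN// -EFinD.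
by apply: lte_mul_pinfty => //; exact: fin11.
Qed.

Section sphere.
Context (R : realType) (n : nat).
Implicit Types x y : euclid R n.

Definition coor x (i : 'I_n) : R := tnth x i.

Definition dotp x y : R := \sum_(i < n) coor x i * coor y i.

Definition enorm x : R := Num.sqrt (dotp x x).

Definition sphere : set (euclid R n) := [set x | enorm x = 1].

Definition normalize x : euclid R n := [tuple coor x i / enorm x | i < n].

Definition punctured_ball : set (euclid R n) := [set x | 0 < enorm x <= 1].

(* The surface measure of the unit sphere, as a measure on R^n: the area of
   the part of the sphere lying in A is n times the volume of the cone over it
   inside the unit ball. *)
Definition surface_measure (A : set (euclid R n)) : \bar R :=
  (n%:R%:E * lebesgue_euclid R n (normalize @^-1` A `&` punctured_ball))%E.

Let measurable_coor i : measurable_fun setT (coor ^~ i).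
Proof. exact: measurable_tnth. Qed.

Lemma measurable_enorm : measurable_fun setT enorm.
Proof.
apply: (@measurableT_comp _ _ _ _ _ _ (@Num.sqrt R)); last first.
  by apply: measurable_sum => i; exact: measurable_funM.
by apply: continuous_measurable_fun; exact: sqrt_continuous.
Qed.

Lemma measurable_normalize : measurable_fun setT normalize.
Proof.
apply/measurable_fun_tnthP => i; rewrite (_ : _ \o _ =
    (fun x => coor x i * enorm x `^ (-1) : R)); last first.
  by apply/funext => x /=; rewrite tnth_mktuple powR_inv1 ?sqrtr_ge0.
apply: measurable_funM => //.
apply: (@measurableT_comp _ _ _ _ _ _ (@powR R ^~ (-1))) => //.
exact: measurable_enorm.
Qed.

Let measurable_ball : measurable punctured_ball.
Proof.
rewrite (_ : punctured_ball = setT `&` enorm @^-1` `]0, 1]); last first.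
  by rewrite setTI; apply/seteqP; split => x /=; rewrite in_itv.
exact: measurable_enorm.
Qed.

Let mpre A : measurable A -> measurable (normalize @^-1` A `&` punctured_ball).
Proof.
move=> mA; apply: measurableI => //.
by rewrite -[X in measurable X]setTI; exact: measurable_normalize.
Qed.

Let m0 : surface_measure set0 = 0%E.
Proof. by rewrite /surface_measure preimage_set0 set0I measure0 mule0. Qed.

Let m_ge0 A : (0 <= surface_measure A)%E.
Proof. by rewrite mule_ge0// lee_fin. Qed.

Let m_sadd : semi_sigma_additive surface_measure.
Proof.
move=> F mF tF mU; rewrite [X in X @ _ --> _](_ : _ = (fun k =>
    n%:R%:E * \sum_(0 <= i < k)
      lebesgue_euclid R n (normalize @^-1` F i `&` punctured_ball))%E); last first.
  by apply/funext => k; rewrite ge0_sume_distrr.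
apply: cvgeZl => //; rewrite preimage_bigcup setI_bigcupl.
apply: measure_semi_sigma_additive => [i||].
- exact: mpre.
- apply/trivIsetP => i j _ _ ij; rewrite setIACA -preimage_setI.
  by move/trivIsetP : tF => /(_ _ _ _ _ ij) ->//; rewrite preimage_set0 set0I.
- by rewrite -setI_bigcupl -preimage_bigcup; exact: mpre.
Qed.

HB.instance Definition _ :=
  isMeasure.Build _ _ _ surface_measure m0 m_ge0 m_sadd.

Let m_fin : fin_num_fun surface_measure.
Proof.
move=> A mA; rewrite ge0_fin_numE//; apply: lte_mul_pinfty => //.
apply: le_lt_trans (lebesgue_cube_lty R n).
apply: le_measure; rewrite ?inE; [exact: mpre|exact: measurable_cube|].
move=> x [_ /andP[_ x1]] i.
have {}x1 : dotp x x <= 1.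
  by move: x1; rewrite -[X in _ <= X -> _]sqrtr1 ler_sqrt.
rewrite -(@ler_pXn2r _ 2)// ?nnegrE// expr1n; apply: le_trans x1.
rewrite real_normK ?num_real// expr2 /dotp (bigD1 i)//= lerDl sumr_ge0// => j _.
by rewrite -expr2 sqr_ge0.
Qed.

HB.instance Definition _ :=
  @Measure_isFinite.Build _ _ _ surface_measure m_fin.

End sphere.

Section onsager.
Context (R : realType) (n : nat).
Implicit Types (m x : euclid R n) (f phi : euclid R n -> R).
Local Notation S := (@sphere R n).
Local Notation sigma := (@surface_measure R n).

Definition mxact (Q : 'M[R]_n) x : euclid R n :=
  [tuple \sum_(j < n) Q i j * coor x j | i < n].

Definition orthogonal_mx (Q : 'M[R]_n) : Prop := Q *m Q^T = 1%:M.

Definition proj_first (k : nat) x : euclid R n :=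
  [tuple if (i < k)%N then coor x i else 0 | i < n].

(* Integration over [0, pi/2] against sin^(k-1) cos^(n-k-1); the natural
   subtractions are exact for 1 <= k < n. *)
Definition theta_int (k : nat) (g : R -> R) : R :=
  \int[@lebesgue_measure R]_(t in `[0, pi / 2])
    (g t * (sin t ^+ (k - 1) * cos t ^+ (n - k - 1))).

Definition sigma_k (k : nat) (eta : R) : R :=
  (n - k)%:R * k%:R * theta_int k (fun t => expR (eta * sin t ^+ 2)) /
  (2 * theta_int k (fun t => expR (eta * sin t ^+ 2) * sin t ^+ 2 * cos t ^+ 2)).

Definition h_iso (m : euclid R n) : R := (fine (sigma S))^-1.

Definition h_k (k : nat) (eta : R) (Q : 'M[R]_n) m : R :=
  expR (eta * enorm (proj_first k (mxact Q m)) ^+ 2) /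
  \int[sigma]_(m' in S) expR (eta * enorm (proj_first k (mxact Q m')) ^+ 2).

(* L^2 functions on the sphere are Borel functions on R^n that are square
   integrable for the surface measure, which does not charge the complement of
   the sphere. *)
Definition mean_zero_L2 phi : Prop :=
  phi \in Lfun sigma 2%:E /\ \int[sigma]_(m in S) phi m = 0.

(* The second variation at f, in the direction phi, of
     int f log f + alpha / 2 * int int (1 - (m . m')^2) f(m) f(m');
   the constant 1 of the kernel contributes nothing since phi has mean zero. *)
Definition second_variation (alpha : R) f phi : R :=
  \int[sigma]_(m in S) (phi m ^+ 2 / f m) -
  alpha * \int[(sigma \x sigma)%E]_(p in S `*` S)
            (dotp p.1 p.2 ^+ 2 * phi p.1 * phi p.2).

Definition stable (alpha : R) f : Prop :=
  forall phi, mean_zero_L2 phi -> 0 <= second_variation alpha f phi.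

End onsager.

(* Main.v *)
Require Import Defs.
From HB Require Import structures.
From mathcomp Require Import all_boot all_order all_algebra.
From mathcomp Require Import all_classical all_reals all_analysis.
From mathcomp Require Import measurable_realfun.
From mathcomp Require Import ring lra.
Set Implicit Arguments. Unset Strict Implicit. Unset Printing Implicit Defensive.
Import Order.TTheory GRing.Theory Num.Theory.
Import numFieldNormedType.Exports.
Local Open Scope classical_set_scope.
Local Open Scope ring_scope.

(** The kernel (m . m')^2 is the inner product of the matrices m (x) m and
    m' (x) m'.  Hence the second variation at f in the direction phi is
    int phi^2 / f - alpha |B|^2, where B is the matrix of second moments of
    phi; it is symmetric, and traceless because phi has mean zero.  Duality
    turns stability into a statement about f alone: f is stable iff
    alpha Var_f (m . M m) <= |M|^2 for every symmetric traceless M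
    ([stable_quad]).  What is left is to know the fourth moments of the density
    exp (eta s), with s the square norm of the first k coordinates.

    Surface measure is invariant under linear isometries ([surface_isometry]).
    This removes the rotation R, and it makes the fourth moments on a block of
    coordinates over which the density is symmetric isotropic: they are
    determined by one number, the constant [kurt] ([block_fourth]).  Quadratic
    forms living on different pieces are orthogonal.

    The number sigma_k is defined by integrals in theta.  Those are the
    integrals of functions of s over the sphere, up to one constant, because
    sin^2 theta and s have the same moments ([bingham_theta]): the two sequences
    satisfy the same recursion, which comes from differentiating an integral
    along a curve of reflections ([sphere_moment_rec]) and from an exact
    derivative in theta ([theta_moment_rec]).  Let b_p be the integral of
    s^p exp (eta s).  Then sigma_k = k (n - k) b_0 / (2 (b_1 - b_2)), and
    [bingham_moment_rec] is integration by parts for these numbers.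

    (i) For eta = 0 the whole space is one block, and the variance of m . M m is
    2 |M|^2 / (n (n + 2)).

    (ii) The test matrix E_ij + E_ji inside the first k coordinates gives an
    inequality that integration by parts turns into eta <= 0
    ([stable_head_le0]); inside the other n - k coordinates it gives eta >= 0
    ([stable_tail_ge0]).  Both blocks are available when 2 <= k <= n / 2.

    (iii) For k = 1 a form splits into an axial part, a part mixing the axis with
    the other directions, and a transverse part.  The mixed part gives equality,
    since it moves along the family of rotated critical points; the transverse
    part is harmless for eta >= 0.  By [bingham_variance] the axial part asks for
    eta Cov (s, s (1 - s)) <= 0.  A minimizer of sigma_1 maximizes the mean of
    s (1 - s).  Comparing the exponential with its secant through the two roots
    of s (1 - s) - c shows that this mean strictly decreases in any direction in
    which the covariance does not increase it, however far one goes
    ([theta_ratio_secant]).  So the covariance is positive before eta_1 and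
    negative after it; as it is positive at 0, eta_1 >= 0. *)

(** * Translations of Euclidean space preserve Lebesgue measure *)

Section euclid_ops.
Context (R : realType) (n : nat).
Implicit Types x y : euclid R n.

Definition tadd x y : euclid R n := [tuple coor x i + coor y i | i < n].
Definition topp x : euclid R n := [tuple - coor x i | i < n].

Lemma coor_tadd x y i : coor (tadd x y) i = coor x i + coor y i.
Proof. by rewrite /coor tnth_mktuple. Qed.

Lemma coor_topp x i : coor (topp x) i = - coor x i.
Proof. by rewrite /coor tnth_mktuple. Qed.

Lemma euclidP x y : (forall i, coor x i = coor y i) -> x = y.
Proof. exact: eq_from_tnth. Qed.

Lemma measurable_coor i : measurable_fun setT (fun x => coor x i).
Proof. exact: measurable_tnth. Qed.

Lemma enorm_topp x : enorm (topp x) = enorm x.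
Proof.
by congr Num.sqrt; apply: eq_bigr => i _; rewrite coor_topp mulrNN.
Qed.

End euclid_ops.

Section measurable_euclid.
Context d (T : measurableType d) (R : realType) (n : nat).

Lemma measurable_euclidP (f : T -> euclid R n) :
  (forall i, measurable_fun setT (fun t => coor (f t) i)) ->
  measurable_fun setT f.
Proof. by move=> mf; apply/measurable_fun_tnthP => i; exact: mf. Qed.

Lemma measurable_coor_comp (f : T -> euclid R n) i :
  measurable_fun setT f -> measurable_fun setT (fun t => coor (f t) i).
Proof. by move=> mf; exact: (measurableT_comp (measurable_coor i) mf). Qed.

Lemma measurable_tadd (f g : T -> euclid R n) :
  measurable_fun setT f -> measurable_fun setT g ->
  measurable_fun setT (fun t => tadd (f t) (g t)).
Proof.
move=> mf mg; apply: measurable_euclidP => i.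
under eq_fun do rewrite coor_tadd.
by apply: measurable_funD; exact: measurable_coor_comp.
Qed.

Lemma measurable_topp (f : T -> euclid R n) :
  measurable_fun setT f -> measurable_fun setT (fun t => topp (f t)).
Proof.
move=> mf; apply: measurable_euclidP => i.
under eq_fun do rewrite coor_topp.
by apply: measurableT_comp => //; exact: measurable_coor_comp.
Qed.

End measurable_euclid.

Section translation.
Context (R : realType).
Local Notation T := (measurableTypeR R).

Lemma measurable_translate (a : R) :
  measurable_fun setT (fun x : T => (x + a : T)).
Proof. exact: measurable_funD. Qed.

Lemma lebesgue_measure_translate (a : R) (A : set T) : measurable A ->
  lebesgue_measure ((fun x : T => (x + a : T)) @^-1` A) = lebesgue_measure A.
Proof.
move=> mA; apply/esym.
have mt := measurable_translate a.
apply: (@lebesgue_measure_unique R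
   (pushforward (@lebesgue_measure R) (fun x : T => (x + a : T)))) => //.
move=> _ [[u v]] _ <-; rewrite /pushforward /=.
transitivity (@lebesgue_measure R `]u - a, v - a]%classic); last first.
  congr (lebesgue_measure _).
  by apply/seteqP; split=> x /=; rewrite !in_itv/= ltrBlDr lerBrDr.
rewrite !lebesgue_measure_itv/= !lte_fin ltrD2r -!EFinD.
by congr (if _ then _%:E else _); ring.
Qed.

Lemma lebesgue_integral_translate (a : R) (f : T -> \bar R) :
  measurable_fun setT f -> (forall x, 0 <= f x)%E ->
  (\int[lebesgue_measure]_x f (x + a)%R = \int[lebesgue_measure]_x f x)%E.
Proof.
move=> mf f0.
have mt := measurable_translate a.
pose t := fun x : T => (x + a : T).
transitivity (\int[pushforward (@lebesgue_measure R) t]_x f x)%E.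
  by rewrite ge0_integral_pushforward.
by apply: eq_measure_integral => A mA _; exact: lebesgue_measure_translate.
Qed.

Lemma lebesgue_euclidS n (A : set (euclid R n.+1)) :
  (lebesgue_euclid R n.+1 A = \int[@lebesgue_measure R]_a
    lebesgue_euclid R n (xsection (@cons_pair _ T n @^-1` A) a))%E.
Proof. by []. Qed.

Lemma measurable_cons_preimage n (A : set (euclid R n.+1)) :
  measurable A -> measurable (@cons_pair _ T n @^-1` A).
Proof.
by move=> mA; rewrite -[X in measurable X]setTI; exact: measurable_cons_pair.
Qed.

(** Induction on the dimension: the section at a of a translated set is a
    translate of the section at a shifted point, so Tonelli reduces the claim to
    the line. *)
Lemma lebesgue_euclid_translate n (y : euclid R n) (A : set (euclid R n)) :
  measurable A ->
  lebesgue_euclid R n ((fun x => tadd x y) @^-1` A) = lebesgue_euclid R n A.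
Proof.
elim: n y A => [|n IH] y A mA.
  by apply: congr1; apply/seteqP; split=> x; rewrite /preimage/= [tadd _ _]tuple0 [x]tuple0.
have mD := measurable_cons_preimage mA.
pose y' : euclid R n := [tuple of behead y].
rewrite !lebesgue_euclidS.
rewrite -[RHS](@lebesgue_integral_translate (coor y ord0)); last 2 first.
- exact: measurable_fun_xsection.
- by move=> x; exact: measure_ge0.
apply: eq_integral => a _ /=.
rewrite -(IH y' (xsection _ (a + coor y ord0))); last exact: measurable_xsection.
congr (lebesgue_euclid R n _).
have E (x : euclid R n) : tadd (cons_pair (a, x)) y =
    cons_pair ((a + coor y ord0 : T), tadd x y').
  apply: euclidP => i; rewrite coor_tadd.
  case: (unliftP ord0 i) => [j|] ->; rewrite /coor /cons_pair ?tnthS //=.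
  by rewrite tnth_mktuple /coor !(tnth_nth 0)/= nth_behead.
by apply/seteqP; split=> x; rewrite /xsection /= !inE /= E.
Qed.

End translation.

(** * Linear isometries preserve volume and surface area *)

Section isometry.
Context (R : realType) (n : nat).
Implicit Types (x y : euclid R n) (L : euclid R n -> euclid R n).
Local Notation T := (measurableTypeR R).
Local Notation lam := (lebesgue_euclid R n).

Definition tscale (a : R) x : euclid R n := [tuple a * coor x i | i < n].

Lemma coor_tscale a x i : coor (tscale a x) i = a * coor x i.
Proof. by rewrite /coor tnth_mktuple. Qed.

(** Linearity is stated on tuples, so that orthogonal matrices and explicit
    reflections can be treated alike; the inverse enters through surjectivity. *)
Record linear_isometry L : Prop := LinearIsometry {
  measurable_isometry : measurable_fun setT L;
  isometry_surj : forall y, exists x, L x = y;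
  isometryD : forall x y, L (tadd x y) = tadd (L x) (L y);
  isometryZ : forall a x, L (tscale a x) = tscale a (L x);
  isometry_enorm : forall x, enorm (L x) = enorm x }.

Lemma lebesgue_euclid_integral_translate (f : euclid R n -> \bar R) y :
  measurable_fun setT f -> (forall x, 0 <= f x)%E ->
  (\int[lam]_x f (tadd x y) = \int[lam]_x f x)%E.
Proof.
move=> mf f0.
have mt : measurable_fun setT (fun x => tadd x y).
  by apply: measurable_tadd.
transitivity (\int[pushforward lam (fun x => tadd x y)]_x f x)%E.
  by rewrite ge0_integral_pushforward.
by apply: eq_measure_integral => A mA _; exact: lebesgue_euclid_translate.
Qed.

Lemma measurable_punctured_ball : measurable (@punctured_ball R n).
Proof.
rewrite (_ : @punctured_ball R n = setT `&` @enorm R n @^-1` `]0, 1]); last first.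
  by rewrite setTI; apply/seteqP; split => x /=; rewrite in_itv.
by apply: (@measurable_enorm R n) => //; exact: measurable_itv.
Qed.

(** Uniqueness of translation-invariant measures in one computation.  Integrate
    1_A (L x) 1_B (y) over x and y, with B the unit ball.  Shifting x by a
    preimage of y gives 1_A (L x + y) 1_B (y); shifting y by - L x gives
    1_A (y) 1_B (y - L x); shifting x back by the same preimage leaves
    1_A (y) 1_B (- L x) = 1_A (y) 1_B (x). *)
Lemma lebesgue_isometry_ball L (A : set (euclid R n)) : linear_isometry L ->
  measurable A ->
  (lam (L @^-1` A) * lam (@punctured_ball R n) = lam A * lam (@punctured_ball R n))%E.
Proof.
move=> [mL sL LD LZ LN] mA.
set B := @punctured_ball R n.
have mB : measurable B := measurable_punctured_ball.
have mLA : measurable (L @^-1` A) by rewrite -[X in measurable X]setTI; exact: mL.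
pose a := (\1_A : euclid R n -> R); pose b := (\1_B : euclid R n -> R).
have ma : measurable_fun setT a by exact: measurable_indic.
have mb : measurable_fun setT b by exact: measurable_indic.
have a0 x : 0 <= a x by rewrite /a indicE.
have b0 x : 0 <= b x by rewrite /b indicE.
have prodE (C : set (euclid R n)) : measurable C ->
  (lam C * lam B = \int[lam]_y \int[lam]_x (\1_C x * b y)%:E)%E.
  move=> mC; transitivity (\int[lam]_y (lam C * (b y)%:E))%E.
    rewrite ge0_integralZl//; first by rewrite integral_indic// setIT.
      by apply/measurable_EFinP.
    by move=> y _; rewrite lee_fin.
  apply: eq_integral => y _; under eq_integral do rewrite EFinM.
  rewrite ge0_integralZr//=; first by rewrite integral_indic// setIT.
    by apply/measurable_EFinP; exact: measurable_indic.
  by rewrite lee_fin.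
have swap (f : euclid R n * euclid R n -> R) : measurable_fun setT f ->
    (forall z, 0 <= f z) ->
  (\int[lam]_y \int[lam]_x (f (x, y))%:E = \int[lam]_x \int[lam]_y (f (x, y))%:E)%E.
  move=> mf f0; apply/esym.
  apply: (@fubini_tonelli _ _ _ _ _ lam lam (EFin \o f)) => //.
  by apply/measurable_EFinP.
have m1 : measurable_fun setT (fun z : euclid R n * euclid R n => L z.1).
  exact: (measurableT_comp mL).
have m2 : measurable_fun setT (fun z : euclid R n * euclid R n => z.2) by exact: measurable_snd.
rewrite !prodE//.
have maL (f : euclid R n * euclid R n -> euclid R n) : measurable_fun setT f ->
  measurable_fun setT (a \o f) by move=> mf; exact: (measurableT_comp ma mf).
have mbL (f : euclid R n * euclid R n -> euclid R n) : measurable_fun setT f ->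
  measurable_fun setT (b \o f) by move=> mf; exact: (measurableT_comp mb mf).
transitivity (\int[lam]_y \int[lam]_x (a (tadd (L x) y) * b y)%:E)%E.
  apply: eq_integral => y _.
  have [z Lz] := sL y.
  rewrite -[LHS](@lebesgue_euclid_integral_translate _ z) /=.
  - by apply: eq_integral => x _; rewrite -Lz -LD.
  - apply/measurable_EFinP; apply: measurable_funM => //.
  - by move=> x; rewrite lee_fin mulr_ge0.
rewrite (swap (fun z => a (tadd (L z.1) z.2) * b z.2)); last 2 first.
- by apply: measurable_funM; [apply: maL; exact: measurable_tadd|exact: mbL].
- by move=> z; rewrite mulr_ge0.
transitivity (\int[lam]_x \int[lam]_y (a y * b (tadd y (topp (L x))))%:E)%E.
  apply: eq_integral => x _ /=.
  rewrite -[RHS](@lebesgue_euclid_integral_translate _ (L x)) /=.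
  - apply: eq_integral => y _; congr (a _ * b _)%:E.
      by apply: euclidP => i; rewrite !coor_tadd addrC.
    by apply: euclidP => i; rewrite !(coor_tadd, coor_topp) addrK.
  - apply/measurable_EFinP; apply: measurable_funM => //.
    by apply: (measurableT_comp mb); exact: measurable_tadd.
  - by move=> y; rewrite lee_fin mulr_ge0.
rewrite -(swap (fun z => a z.2 * b (tadd z.2 (topp (L z.1))))); last 2 first.
- apply: measurable_funM; first exact: maL.
  by apply: mbL; apply: measurable_tadd => //; exact: measurable_topp.
- by move=> z; rewrite mulr_ge0.
rewrite [RHS]
  (_ : _ = \int[lam]_y \int[lam]_x (\1_A y * b x)%:E)%E; last first.
  rewrite (swap (fun z => a z.1 * b z.2)); last 2 first.
  - by apply: measurable_funM; [exact: maL|exact: mbL].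
  - by move=> z; rewrite mulr_ge0.
  by [].
apply: eq_integral => y _ /=.
have [z Lz] := sL y.
rewrite -[LHS](@lebesgue_euclid_integral_translate _ z) /=.
- apply: eq_integral => x _; congr (_ * _)%:E.
  have -> : tadd y (topp (L (tadd x z))) = topp (L x).
    apply: euclidP => i.
    by rewrite LD Lz !(coor_tadd, coor_topp) opprD addrC subrK.
  by rewrite /b !indicE; congr ((_ : bool)%:R); apply/idP/idP;
    rewrite !inE /B /punctured_ball /mkset enorm_topp LN.
- apply/measurable_EFinP; apply: measurable_funM => //.
  by apply: (measurableT_comp mb); apply: measurable_tadd => //; exact: measurable_topp.
- by move=> x; rewrite lee_fin mulr_ge0.
Qed.

End isometry.

Section ball_volume.
Context (R : realType).

(** Boxes are measured here only to see that the ball is not negligible, so that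
    its volume can be cancelled. *)
Lemma lebesgue_euclid_box n (e : R) : 0 < e ->
  measurable [set x : euclid R n | forall i, 0 < coor x i <= e] /\
  lebesgue_euclid R n [set x | forall i, 0 < coor x i <= e] = (e ^+ n)%:E.
Proof.
move=> e0; elim: n => [|n [mb IH]].
  have -> : [set x : euclid R 0 | forall i, 0 < coor x i <= e] = setT.
    by apply/seteqP; split => // x _ [].
  by split=> //=; rewrite diracT expr0.
set box := [set x : euclid R n | _] in mb IH.
split.
  rewrite [X in measurable X](_ : _ = \bigcap_(i in [set: 'I_n.+1])
      (setT `&` (fun x : euclid R n.+1 => tnth x i) @^-1` `]0, e])).
    apply: fin_bigcap_measurable => // i _.
    by apply: measurable_tnth => //; exact: measurable_itv.
  apply/seteqP; split => x /= x1 i; first by move=> _; rewrite setTI /= in_itv/=; exact: x1.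
  by have := x1 i I; rewrite setTI /= in_itv.
rewrite /= /measure_cons /pushforward.
rewrite [X in product_measure1 _ _ X](_ : _ = `]0, e]%classic `*` box); last first.
  apply/seteqP; split => -[x y] /=.
    move=> H; split; first by have := H ord0; rewrite in_itv.
    by move=> i; have := H (lift ord0 i); rewrite /coor tnthS.
  move=> [/=]; rewrite in_itv/= => x0 H i.
  by case: (unliftP ord0 i) => [j|] ->; rewrite /coor ?tnthS//=; exact: H.
rewrite product_measure1E//.
have m1 : @lebesgue_measure R `]0, e]%classic = e%:E.
  by rewrite lebesgue_measure_itv/= lte_fin e0 sube0.
rewrite exprS EFinM; congr (_ * _)%E; [exact: m1|exact: IH].
Qed.

Lemma enorm_ge0 n (x : euclid R n) : 0 <= enorm x.
Proof. exact: sqrtr_ge0. Qed.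

Lemma dotp_ge0 n (x : euclid R n) : 0 <= dotp x x.
Proof. by apply: sumr_ge0 => i _; rewrite -expr2 sqr_ge0. Qed.

Lemma sqr_enorm n (x : euclid R n) : enorm x ^+ 2 = dotp x x.
Proof. by rewrite /enorm sqr_sqrtr// dotp_ge0. Qed.

Lemma lebesgue_punctured_ball_gt0 n : (0 < n)%N ->
  (0 < lebesgue_euclid R n (@punctured_ball R n))%E.
Proof.
move=> n0; have e0 : 0 < n%:R^-1 :> R by rewrite invr_gt0 ltr0n.
have [mbox box] := lebesgue_euclid_box n e0.
apply: (@lt_le_trans _ _ ((n%:R^-1 ^+ n)%:E : \bar R)).
  by rewrite lte_fin exprn_gt0.
rewrite -box; apply: le_measure; rewrite ?inE//.
  exact: measurable_punctured_ball.
move=> x xbox; apply/andP; split.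
  rewrite sqrtr_gt0 /dotp (bigD1 (Ordinal n0))//=; apply: ltr_pwDl.
    by have /andP[x0 _] := xbox (Ordinal n0); exact: mulr_gt0.
  by apply: sumr_ge0 => i _; rewrite -expr2 sqr_ge0.
rewrite -[leRHS]sqrtr1 ler_wsqrtr// /dotp.
apply: (@le_trans _ _ (\sum_(i < n) n%:R^-1 :> R)); last first.
  by rewrite sumr_const card_ord -[leLHS]mulr_natr mulVf// pnatr_eq0 -lt0n.
apply: ler_sum => i _; have /andP[x0 x1] := xbox i.
apply: (@le_trans _ _ (coor x i)) => //; rewrite ler_piMl ?(ltW x0)//.
by rewrite (le_trans x1)// invf_le1 ?ltr0n// ler1n.
Qed.

Lemma lebesgue_punctured_ball_lty n :
  (lebesgue_euclid R n (@punctured_ball R n) < +oo)%E.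
Proof.
apply: le_lt_trans (lebesgue_cube_lty R n).
apply: le_measure; rewrite ?inE; [exact: measurable_punctured_ball|exact: measurable_cube|].
move=> x /andP[_ x1] i.
rewrite -(@ler_pXn2r _ 2)// ?nnegrE// expr1n real_normK ?num_real//.
apply: (@le_trans _ _ (enorm x ^+ 2)); last by rewrite exprn_ile1// enorm_ge0.
by rewrite sqr_enorm expr2 /dotp (bigD1 i)//= lerDl sumr_ge0// => j _;
  rewrite -expr2 sqr_ge0.
Qed.

End ball_volume.

Section surface_isometry.
Context (R : realType) (n : nat).
Implicit Types (x y : euclid R n) (L : euclid R n -> euclid R n).
Local Notation sigma := (@surface_measure R n).
Local Notation S := (@sphere R n).

Lemma lebesgue_isometry L (A : set (euclid R n)) : (0 < n)%N ->
  linear_isometry L -> measurable A ->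
  lebesgue_euclid R n (L @^-1` A) = lebesgue_euclid R n A.
Proof.
move=> n0 iL mA; have := lebesgue_isometry_ball iL mA.
have B0 := lebesgue_punctured_ball_gt0 R n0.
have Boo := lebesgue_punctured_ball_lty R n.
have [b bE] : exists b, lebesgue_euclid R n (@punctured_ball R n) = b%:E.
  by exists (fine (lebesgue_euclid R n (@punctured_ball R n))); rewrite fineK// ge0_fin_numE// ltW.
rewrite bE; move: B0; rewrite bE lte_fin => b0.
by move/(congr1 (fun z => z * (b^-1)%:E)%E); rewrite -!muleA -!EFinM divff ?gt_eqF// !mule1.
Qed.

Lemma coor_normalize x i : coor (normalize x) i = coor x i / enorm x.
Proof. by rewrite /coor tnth_mktuple. Qed.

Lemma normalizeE x : normalize x = tscale (enorm x)^-1 x.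
Proof. by apply: euclidP => i; rewrite coor_normalize coor_tscale mulrC. Qed.

Lemma enorm_normalize x : 0 < enorm x -> enorm (normalize x) = 1.
Proof.
move=> x0; apply/eqP; rewrite -(@eqrXn2 _ 2)// ?enorm_ge0// expr1n sqr_enorm /dotp.
under eq_bigr do rewrite coor_normalize mulrACA.
by rewrite -big_distrl/= -/(dotp x x) -sqr_enorm expr2 -invfM divff// mulf_neq0// gt_eqF.
Qed.

Lemma measurable_sphere : measurable S.
Proof.
rewrite (_ : S = setT `&` @enorm R n @^-1` `[1, 1]).
  by apply: (@measurable_enorm R n) => //; exact: measurable_itv.
by rewrite setTI set_itv1.
Qed.

Lemma surface_isometry L (A : set (euclid R n)) : (0 < n)%N ->
  linear_isometry L -> measurable A -> sigma (L @^-1` A) = sigma A.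
Proof.
move=> n0 iL mA; rewrite /surface_measure; congr (_ * _)%E.
have mN : measurable (@normalize R n @^-1` A).
  by rewrite -[X in measurable X]setTI; exact: measurable_normalize.
rewrite -[RHS](lebesgue_isometry n0 iL); last first.
  by apply: measurableI; [exact: mN|exact: measurable_punctured_ball].
congr (lebesgue_euclid R n _).
by apply/seteqP; split=> x /=; rewrite /punctured_ball/= !normalizeE
  (isometryZ iL) (isometry_enorm iL).
Qed.

Lemma sphere_isometry L : linear_isometry L -> L @^-1` S = S.
Proof.
by move=> iL; apply/seteqP; split=> x; rewrite /sphere/= (isometry_enorm iL).
Qed.

Lemma surface_sphere_gt0 : (0 < n)%N -> (0 < sigma S)%E.
Proof.
move=> n0; rewrite /surface_measure mule_gt0 ?lte_fin ?ltr0n//.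
rewrite (_ : _ `&` _ = @punctured_ball R n); first exact: lebesgue_punctured_ball_gt0.
apply/seteqP; split=> [x []//|x xB]; split=> //=.
by apply: enorm_normalize; move: xB => /andP[].
Qed.

End surface_isometry.
#[global] Hint Extern 0 (measurable (@sphere _ _)) =>
  solve [apply: measurable_sphere] : core.

(** * Integration over the sphere *)

Lemma integrable_EFin_sum d (T : measurableType d) (R : realType)
    (mu : {measure set T -> \bar R}) (D : set T) (I : Type) (r : seq I)
    (P : pred I) (F : I -> T -> R) : measurable D ->
  (forall i, P i -> mu.-integrable D (EFin \o F i)) ->
  mu.-integrable D (EFin \o (fun x => \sum_(i <- r | P i) F i x)).
Proof.
move=> mD iF; rewrite (_ : _ \o _ =
    (fun x => \sum_(i <- r | P i) (EFin \o F i) x)%E).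
  exact: integrable_sum.
by apply/funext => x /=; rewrite sumEFin.
Qed.

Lemma Rintegral_sum d (T : measurableType d) (R : realType)
    (mu : {measure set T -> \bar R}) (D : set T) (I : Type) (r : seq I)
    (P : pred I) (F : I -> T -> R) : measurable D ->
  (forall i, P i -> mu.-integrable D (EFin \o F i)) ->
  \int[mu]_(x in D) (\sum_(i <- r | P i) F i x) =
  \sum_(i <- r | P i) \int[mu]_(x in D) F i x.
Proof.
move=> mD iF; elim: r => [|i r IH].
  rewrite big_nil; under eq_Rintegral do rewrite big_nil.
  by rewrite Rintegral_cst// mul0r.
rewrite big_cons; under eq_Rintegral do rewrite big_cons.
case Pi: (P i) => //; rewrite RintegralD ?IH//; first exact: iF.
exact: integrable_EFin_sum.
Qed.

Section sphere_integral.
Context (R : realType) (n : nat).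
Implicit Types (x y : euclid R n) (F G f g phi : euclid R n -> R).
Local Notation sigma := (@surface_measure R n).
Local Notation S := (@sphere R n).

Definition sint F : R := \int[sigma]_(m in S) F m.

(** Square integrable directions are merely integrable against bounded factors,
    whence two predicates: this one for directions, [sphere_bounded] for
    densities, coordinates and polynomials. *)
Definition sphere_integrable F := sigma.-integrable S (EFin \o F).

Record sphere_bounded F : Prop := SphereBounded {
  sphere_bounded_measurable : measurable_fun setT F;
  sphere_boundedP : exists C, forall x, S x -> `|F x| <= C }.

Lemma coor_sphere x i : S x -> `|coor x i| <= 1.
Proof.
rewrite /sphere/= => x1.
rewrite -(@ler_pXn2r _ 2)// ?nnegrE// expr1n real_normK ?num_real//.
rewrite -(expr1n R 2) -x1 sqr_enorm expr2 /dotp (bigD1 i)//= lerDl.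
by apply: sumr_ge0 => j _; rewrite -expr2 sqr_ge0.
Qed.

Lemma sphere_bounded_coor i : sphere_bounded (fun x => coor x i).
Proof.
by split; [exact: measurable_coor|exists 1 => x; exact: coor_sphere].
Qed.

Lemma sphere_bounded_cst (a : R) : sphere_bounded (fun=> a).
Proof. by split=> //; exists `|a|. Qed.

Lemma sphere_boundedD F G : sphere_bounded F -> sphere_bounded G ->
  sphere_bounded (fun x => F x + G x).
Proof.
move=> [mF [C FC]] [mG [D GD]]; split; first exact: measurable_funD.
by exists (C + D) => x Sx; rewrite (le_trans (ler_normD _ _))// lerD ?FC ?GD.
Qed.

Lemma sphere_boundedM F G : sphere_bounded F -> sphere_bounded G ->
  sphere_bounded (fun x => F x * G x).
Proof.
move=> [mF [C FC]] [mG [D GD]]; split; first exact: measurable_funM.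
by exists (C * D) => x Sx; rewrite normrM ler_pM ?FC ?GD.
Qed.

Lemma sphere_boundedZ (a : R) F : sphere_bounded F ->
  sphere_bounded (fun x => a * F x).
Proof. by apply: sphere_boundedM; exact: sphere_bounded_cst. Qed.

Lemma sphere_boundedB F G : sphere_bounded F -> sphere_bounded G ->
  sphere_bounded (fun x => F x - G x).
Proof.
move=> bF bG; under eq_fun do rewrite -mulN1r.
by apply: sphere_boundedD => //; exact: sphere_boundedZ.
Qed.

Lemma sphere_boundedX F k : sphere_bounded F ->
  sphere_bounded (fun x => F x ^+ k).
Proof.
move=> bF; elim: k => [|k IH]; first exact: sphere_bounded_cst.
by under eq_fun do rewrite exprS; exact: sphere_boundedM.
Qed.

Lemma sphere_bounded_sum (I : Type) (r : seq I) (P : pred I)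
    (F : I -> euclid R n -> R) :
  (forall i, P i -> sphere_bounded (F i)) ->
  sphere_bounded (fun x => \sum_(i <- r | P i) F i x).
Proof.
move=> bF; elim: r => [|i r IH].
  by under eq_fun do rewrite big_nil; exact: sphere_bounded_cst.
under eq_fun do rewrite big_cons.
by case Pi: (P i) => //; apply: sphere_boundedD => //; exact: bF.
Qed.

Lemma sphere_bounded_prod (I : Type) (r : seq I) (P : pred I)
    (F : I -> euclid R n -> R) :
  (forall i, P i -> sphere_bounded (F i)) ->
  sphere_bounded (fun x => \prod_(i <- r | P i) F i x).
Proof.
move=> bF; elim: r => [|i r IH].
  by under eq_fun do rewrite big_nil; exact: sphere_bounded_cst.
under eq_fun do rewrite big_cons.
by case Pi: (P i) => //; apply: sphere_boundedM => //; exact: bF.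
Qed.

Lemma sphere_bounded_expR F : sphere_bounded F ->
  sphere_bounded (fun x => expR (F x)).
Proof.
move=> [mF [C FC]]; split; first exact: measurableT_comp.
exists (expR C) => x Sx; rewrite ger0_norm ?expR_ge0// ler_expR.
by rewrite (le_trans (ler_norm _))// FC.
Qed.

Lemma sphere_measure_lty : (sigma S < +oo)%E.
Proof. by rewrite ltey_eq fin_num_measure. Qed.

Lemma bounded_onP F : (exists C, forall x, S x -> `|F x| <= C) ->
  [bounded F x | x in S].
Proof.
move=> [C FC]; exists C; split; first exact: num_real.
by move=> e Ce x Sx; exact: (le_trans (FC x Sx) (ltW Ce)).
Qed.

Lemma sphere_bounded_integrable F : sphere_bounded F -> sphere_integrable F.
Proof.
move=> [mF bF]; apply: measurable_bounded_integrable => //.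
- exact: sphere_measure_lty.
- exact: measurable_funTS.
- exact: bounded_onP.
Qed.

Lemma sphere_integrableM F G : sphere_integrable F -> sphere_bounded G ->
  sphere_integrable (fun x => F x * G x).
Proof.
move=> iF [mG bG]; rewrite /sphere_integrable.
rewrite (_ : _ \o _ = (EFin \o F) \* (EFin \o G))%E; last first.
  by apply/funext => x /=; rewrite EFinM.
apply: integrableMl => //; first exact: measurable_funTS.
exact: bounded_onP.
Qed.

Lemma sphere_integrableD F G : sphere_integrable F -> sphere_integrable G ->
  sphere_integrable (fun x => F x + G x).
Proof.
move=> iF iG; rewrite /sphere_integrable.
rewrite (_ : _ \o _ = (EFin \o F) \+ (EFin \o G))%E; last first.
  by apply/funext => x /=; rewrite EFinD.
exact: integrableD.
Qed.

Lemma sphere_integrableZ (a : R) F : sphere_integrable F ->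
  sphere_integrable (fun x => a * F x).
Proof.
move=> iF; under eq_fun do rewrite mulrC.
by apply: sphere_integrableM => //; exact: sphere_bounded_cst.
Qed.

Lemma sphere_integrable_sum (I : Type) (r : seq I) (P : pred I)
    (F : I -> euclid R n -> R) :
  (forall i, P i -> sphere_integrable (F i)) ->
  sphere_integrable (fun x => \sum_(i <- r | P i) F i x).
Proof. exact: integrable_EFin_sum. Qed.

Lemma eq_sint F G : (forall x, S x -> F x = G x) -> sint F = sint G.
Proof. by move=> FG; apply: eq_Rintegral => x /[!inE]; exact: FG. Qed.

Lemma sintD F G : sphere_integrable F -> sphere_integrable G ->
  sint (fun x => F x + G x) = sint F + sint G.
Proof. exact: RintegralD. Qed.

Lemma sintZ (a : R) F : sphere_integrable F ->
  sint (fun x => a * F x) = a * sint F.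
Proof. by move=> iF; rewrite /sint RintegralZl. Qed.

Lemma sintB F G : sphere_integrable F -> sphere_integrable G ->
  sint (fun x => F x - G x) = sint F - sint G.
Proof. exact: RintegralB. Qed.

Lemma sint_sum (I : Type) (r : seq I) (P : pred I)
    (F : I -> euclid R n -> R) :
  (forall i, P i -> sphere_integrable (F i)) ->
  sint (fun x => \sum_(i <- r | P i) F i x) = \sum_(i <- r | P i) sint (F i).
Proof. exact: Rintegral_sum. Qed.

Lemma sint_ge0 F : (forall x, S x -> 0 <= F x) -> 0 <= sint F.
Proof. exact: Rintegral_ge0. Qed.

Lemma le_sint F G : sphere_integrable F -> sphere_integrable G ->
  (forall x, S x -> F x <= G x) -> sint F <= sint G.
Proof. exact: le_Rintegral. Qed.

Lemma sint_cst (a : R) : sint (fun=> a) = a * sint (fun=> 1).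
Proof. by rewrite /sint !Rintegral_cst// mul1r. Qed.

Lemma sint1_gt0 : (0 < n)%N -> 0 < sint (fun=> 1).
Proof.
move=> n0; rewrite /sint Rintegral_cst// mul1r fine_gt0// surface_sphere_gt0//=.
exact: sphere_measure_lty.
Qed.

Lemma sint_gt0 F (c : R) : (0 < n)%N -> sphere_integrable F -> 0 < c ->
  (forall x, S x -> c <= F x) -> 0 < sint F.
Proof.
move=> n0 iF c0 cF; apply: (@lt_le_trans _ _ (sint (fun=> c))).
  by rewrite sint_cst mulr_gt0// sint1_gt0.
by apply: le_sint => //; apply/sphere_bounded_integrable/sphere_bounded_cst.
Qed.

Lemma sint_isometry (L : euclid R n -> euclid R n) F : (0 < n)%N ->
  linear_isometry L -> sphere_bounded F -> sint (fun x => F (L x)) = sint F.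
Proof.
move=> n0 iL [mF [C FC]]; rewrite /sint /Rintegral; congr fine.
have mL := measurable_isometry iL.
have bFL : sphere_bounded (F \o L).
  split; first exact: measurableT_comp.
  by exists C => x Sx; apply: FC; rewrite /sphere/= (isometry_enorm iL).
transitivity (\int[pushforward sigma L]_(x in S) (F x)%:E)%E.
  have mF' : measurable_fun setT (EFin \o F) by apply/measurable_EFinP.
  rewrite (integral_pushforward mL mF')// sphere_isometry//.
  exact: (sphere_bounded_integrable bFL).
by apply: eq_measure_integral => A mA _; exact: surface_isometry.
Qed.

(** The case of Fubini that decouples the two points of the interaction.  The
    integrands are cut off outside the sphere to apply it on the whole space. *)
Lemma sint_product f g : sphere_integrable f -> sphere_integrable g ->
  (sigma \x sigma)%E.-integrable (S `*` S) (fun p => (f p.1 * g p.2)%:E) /\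
  \int[(sigma \x sigma)%E]_(p in S `*` S) (f p.1 * g p.2) = sint f * sint g.
Proof.
move=> iF iG.
pose a := f \_ S; pose b := g \_ S.
have ia : sigma.-integrable setT (EFin \o a).
  by rewrite /a -restrict_EFin; apply/(integrable_mkcond _ (@measurable_sphere R n)).
have ib : sigma.-integrable setT (EFin \o b).
  by rewrite /b -restrict_EFin; apply/(integrable_mkcond _ (@measurable_sphere R n)).
have ma : measurable_fun setT a.
  by apply/measurable_EFinP; exact: (measurable_int _ ia).
have mb : measurable_fun setT b.
  by apply/measurable_EFinP; exact: (measurable_int _ ib).
have abE (p : euclid R n * euclid R n) :
    ((fun p => (f p.1 * g p.2)%:E) \_ (S `*` S)) p = (a p.1 * b p.2)%:E.
  rewrite /a /b /patch in_setX.
  by case: (p.1 \in S); case: (p.2 \in S); rewrite //= ?mul0r ?mulr0.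
have iab : (sigma \x sigma)%E.-integrable setT (fun p => (a p.1 * b p.2)%:E).
  apply/integrable12ltyP.
    apply/measurable_EFinP; apply: measurable_funM.
      exact: (measurableT_comp ma).
    exact: (measurableT_comp mb).
  have mna : measurable_fun setT (fun x => `|a x|%:E).
    by apply/measurable_EFinP; exact: measurableT_comp.
  have mnb : measurable_fun setT (fun x => `|b x|%:E).
    by apply/measurable_EFinP; exact: measurableT_comp.
  rewrite (_ : (\int[sigma]_x _)%E =
      (\int[sigma]_x (`|a x|%:E * \int[sigma]_y `|b y|%:E))%E); last first.
    apply: eq_integral => x _; rewrite -ge0_integralZl//.
    by apply: eq_integral => y _; rewrite /= normrM EFinM.
  rewrite ge0_integralZr//; last exact: integral_ge0.
  have /integrableP[_ Ia] := ia; have /integrableP[_ Ib] := ib.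
  rewrite lte_mul_pinfty//; first exact: integral_ge0.
  by rewrite ge0_fin_numE//; exact: integral_ge0.
have mSS : measurable (S `*` S) by exact: measurableX.
split.
  apply/(integrable_mkcond _ mSS).
  by rewrite (_ : _ \_ _ = fun p => (a p.1 * b p.2)%:E)//; exact/funext.
rewrite {1}/Rintegral integral_mkcond.
under eq_integral do rewrite abE.
rewrite -(integral12_prod_meas1 iab)/fubini_F/=.
under eq_integral => x _.
  under eq_integral do rewrite EFinM.
  rewrite (integralZl _ ib)//; over.
rewrite /=.
have -> : (\int[sigma]_x (EFin \o b) x = (sint g)%:E)%E.
  rewrite /sint Rintegral_mkcond /Rintegral fineK//.
  exact: integrable_fin_num ib.
rewrite (integralZr _ ia)//.
have -> : (\int[sigma]_x (EFin \o a) x = (sint f)%:E)%E.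
  rewrite /sint Rintegral_mkcond /Rintegral fineK//.
  exact: integrable_fin_num ia.
by [].
Qed.

End sphere_integral.

(** * Stability as a family of variance inequalities *)

Section criterion.
Context (R : realType) (n : nat).
Implicit Types (x y : euclid R n) (F G f g phi : euclid R n -> R) (M : 'M[R]_n).
Local Notation sigma := (@surface_measure R n).
Local Notation S := (@sphere R n).

Definition quad M x : R := \sum_(i < n) \sum_(j < n) M i j * (coor x i * coor x j).

Definition frob M : R := \sum_(i < n) \sum_(j < n) M i j ^+ 2.

Lemma frob_ge0 M : 0 <= frob M.
Proof. by apply: sumr_ge0 => i _; apply: sumr_ge0 => j _; exact: sqr_ge0. Qed.

Lemma sphere_bounded_coor2 i j : sphere_bounded (fun x => coor x i * coor x j).
Proof. by apply: sphere_boundedM; exact: sphere_bounded_coor. Qed.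

Lemma sphere_bounded_quad M : sphere_bounded (quad M).
Proof.
apply: sphere_bounded_sum => i _; apply: sphere_bounded_sum => j _.
exact/sphere_boundedZ/sphere_bounded_coor2.
Qed.

Lemma sint_quad f M : sphere_integrable f ->
  sint (fun x => f x * quad M x) =
  \sum_i \sum_j M i j * sint (fun x => f x * (coor x i * coor x j)).
Proof.
move=> fi.
have fij i j : sphere_integrable (fun x => f x * (coor x i * coor x j)).
  by apply: sphere_integrableM => //; exact: sphere_bounded_coor2.
have E x : f x * quad M x =
    \sum_i \sum_j M i j * (f x * (coor x i * coor x j)).
  rewrite mulr_sumr; apply: eq_bigr => i _; rewrite mulr_sumr.
  by apply: eq_bigr => j _; rewrite mulrCA.
under eq_sint do rewrite E.
rewrite sint_sum; last first.
  move=> i _; apply: sphere_integrable_sum => j _.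
  exact: sphere_integrableZ.
apply: eq_bigr => i _; rewrite sint_sum; last first.
  by move=> j _; exact: sphere_integrableZ.
by apply: eq_bigr => j _; rewrite sintZ.
Qed.

(** (m . m')^2 is the sum over i, j of (m_i m_j) (m'_i m'_j), so the double
    integral is a sum of squares of second moments of phi. *)
Lemma second_variationE alpha f phi : sphere_integrable phi ->
  second_variation alpha f phi = sint (fun x => phi x ^+ 2 / f x) -
  alpha * \sum_i \sum_j (sint (fun x => phi x * (coor x i * coor x j))) ^+ 2.
Proof.
move=> iphi; congr (_ - alpha * _).
pose F i j x := phi x * (coor x i * coor x j).
have iF i j : sphere_integrable (F i j).
  by apply: sphere_integrableM => //; exact: sphere_bounded_coor2.
have E (p : euclid R n * euclid R n) :
    dotp p.1 p.2 ^+ 2 * phi p.1 * phi p.2 =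
    \sum_i \sum_j (F i j p.1 * F i j p.2).
  rewrite expr2 /dotp !mulr_suml; apply: eq_bigr => i _.
  rewrite mulr_sumr !mulr_suml; apply: eq_bigr => j _.
  by rewrite /F; ring.
under eq_Rintegral do rewrite E.
have mSS : measurable (S `*` S) by exact: measurableX.
rewrite Rintegral_sum//; last first.
  move=> i _; apply: integrable_EFin_sum => // j _.
  exact: (sint_product (iF i j) (iF i j)).1.
apply: eq_bigr => i _; rewrite Rintegral_sum//; last first.
  by move=> j _; exact: (sint_product (iF i j) (iF i j)).1.
by apply: eq_bigr => j _; rewrite (sint_product (iF i j) (iF i j)).2 expr2.
Qed.

Lemma Lfun2_sphere phi : phi \in Lfun sigma 2%:E ->
  sphere_integrable phi /\ sphere_integrable (fun x => phi x ^+ 2).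
Proof.
move=> phi2; have phi1 : phi \in Lfun sigma 1.
  by apply: Lfun_subset12 phi2; exact: fin_num_measure.
split; apply: (@integrableS _ _ _ sigma setT) => //.
  exact/Lfun1_integrable.
exact: Lfun2_integrable_sqr.
Qed.

(** A bounded function on the sphere may grow elsewhere, hence the cut-off. *)
Lemma sphere_bounded_Lfun2 phi : sphere_bounded phi ->
  (phi \_ S) \in Lfun sigma 2%:E.
Proof.
move=> [mphi [C Cphi]].
have m : measurable_fun setT (phi \_ S).
  apply/(measurable_restrictT _ _).1 => //.
  exact: measurable_funTS.
rewrite inE; apply/andP; split; first by rewrite inE.
rewrite inE /= /finite_norm unlock poweR_lty//.
apply/integrable_lty => //.
have -> : (fun x => (`|(EFin \o phi \_ S) x| `^ 2)%E) =
   EFin \o (fun x => ((phi \_ S) x) ^+ 2).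
  apply/funext => x /=; rewrite powR_mulrn ?normr_ge0//.
  by rewrite real_normK ?num_real.
apply: measurable_bounded_integrable => //.
- by rewrite ltey_eq fin_num_measure.
- exact: measurable_funX.
exists (`|C| ^+ 2); split; first exact: num_real.
move=> e Ce x _; apply: le_trans (ltW Ce); rewrite normrX ler_pXn2r ?nnegrE//.
rewrite patchE; case: ifPn => xS; last by rewrite normr0.
by rewrite (le_trans _ (ler_norm _))// Cphi//; exact: set_mem.
Qed.

Lemma sphere_intrC f g : sphere_bounded f -> sphere_bounded g ->
  sphere_integrable (fun x => f x * g x).
Proof. by move=> bf bg; apply/sphere_bounded_integrable/sphere_boundedM. Qed.

(** If f is stable, test it on phi = f (x . M x - c): with B the second moments
    of phi and V the variance, stability gives alpha |B|^2 <= V, and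
    0 <= |alpha B - M|^2 with (B, M) = V yields alpha V <= |M|^2.  Conversely,
    take M = B for a given phi and expand
    0 <= int (phi - alpha f (x . B x - c))^2 / f. *)
Lemma stable_quad alpha f g : (0 < n)%N -> 0 < alpha ->
  sphere_bounded f -> sphere_bounded g ->
  (forall x, S x -> 0 < f x) -> (forall x, S x -> f x * g x = 1) ->
  stable alpha f <->
  (forall M (c : R), M^T = M -> \tr M = 0 ->
     sint (fun x => f x * (quad M x - c)) = 0 ->
     alpha * sint (fun x => f x * (quad M x - c) ^+ 2) <= frob M).
Proof.
move=> n0 a0 bf bg f0 fg.
have bq M c : sphere_bounded (fun x => quad M x - c).
  apply: sphere_boundedB (sphere_bounded_cst _ _).
  exact: sphere_bounded_quad.
have fV x : S x -> (f x)^-1 = g x.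
  by move=> Sx; apply: (mulfI (lt0r_neq0 (f0 x Sx))); rewrite fg// divff ?lt0r_neq0 ?f0.
split=> [st M c _ _ Mc|crit phi [phi2 phi0]].
  pose psi x := f x * (quad M x - c).
  have bpsi : sphere_bounded psi by exact: sphere_boundedM.
  have psiS x : S x -> (psi \_ S) x = psi x by move=> Sx; rewrite patchT ?inE.
  have psi2 := sphere_bounded_Lfun2 bpsi.
  have /st : mean_zero_L2 (psi \_ S).
    by split=> //; rewrite -[LHS]/(sint _) (eq_sint psiS).
  rewrite second_variationE; last exact: (Lfun2_sphere psi2).1.
  set V := sint _ in st *; set V' := (X in _ -> alpha * X <= _).
  have -> : V = V'.
    apply: eq_sint => x Sx; rewrite psiS// /psi; field.
    by rewrite lt0r_neq0// f0.
  set B := fun i j => sint (fun x => psi x * (coor x i * coor x j)).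
  rewrite (eq_bigr (fun i => \sum_j B i j ^+ 2)); last first.
    move=> i _; apply: eq_bigr => j _; congr (_ ^+ 2).
    by apply: eq_sint => x Sx; rewrite psiS.
  move=> st0.
  have BM : \sum_i \sum_j M i j * B i j = V'.
    rewrite -sint_quad; last exact: sphere_bounded_integrable.
    rewrite -[LHS]subr0 -(mulr0 c) -Mc -sintZ; last first.
      exact: sphere_bounded_integrable.
    rewrite -sintB; last 2 first.
    - apply: sphere_bounded_integrable; apply: sphere_boundedM => //.
      exact: sphere_bounded_quad.
    - by apply: sphere_bounded_integrable; exact: sphere_boundedZ.
    by apply: eq_sint => x _; rewrite /psi; ring.
  have : 0 <= \sum_i \sum_j (alpha * B i j - M i j) ^+ 2.
    by apply: sumr_ge0 => i _; apply: sumr_ge0 => j _; exact: sqr_ge0.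
  rewrite (_ : \sum_i _ = alpha ^+ 2 * (\sum_i \sum_j B i j ^+ 2) -
      2 * alpha * (\sum_i \sum_j M i j * B i j) + frob M); last first.
    rewrite !mulr_sumr -sumrB -big_split; apply: eq_bigr => i _ /=.
    rewrite !mulr_sumr -sumrB -big_split; apply: eq_bigr => j _ /=.
    by ring.
  rewrite BM; move: (\sum_i _) st0 => s st0 sq0.
  have : 0 <= alpha * (V' - alpha * s) by rewrite mulr_ge0// ltW.
  by lra.
have [iphi iphi2] := Lfun2_sphere phi2.
rewrite second_variationE//.
pose B := (\matrix_(i, j) sint (fun x => phi x * (coor x i * coor x j)) : 'M[R]_n).
have -> : \sum_i \sum_j (sint (fun x => phi x * (coor x i * coor x j))) ^+ 2 = frob B.
  by apply: eq_bigr => i _; apply: eq_bigr => j _; rewrite mxE.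
have BT : B^T = B.
  by apply/matrixP => i j; rewrite !mxE; apply: eq_sint => x _; rewrite [coor x j * _]mulrC.
have Btr : \tr B = 0.
  rewrite /mxtrace; under eq_bigr do rewrite mxE.
  rewrite -sint_sum; last first.
    by move=> i _; apply: sphere_integrableM => //; exact: sphere_bounded_coor2.
  rewrite -[RHS]phi0; apply: eq_sint => x Sx.
  by rewrite -mulr_sumr -/(dotp x x) -sqr_enorm Sx expr1n mulr1.
pose c := sint (fun x => f x * quad B x) / sint f.
have if_ := sphere_bounded_integrable bf.
have sf0 : 0 < sint f.
  have [C Cg] := sphere_boundedP bg.
  have C0 : 0 < Num.max C 1 by rewrite lt_max ltr01 orbT.
  apply: (@sint_gt0 _ _ _ (Num.max C 1)^-1) => //; first by rewrite invr_gt0.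
  move=> x Sx; rewrite -[f x]invrK fV// lef_pV2 ?posrE//.
    by rewrite (le_trans (ler_norm _))// (le_trans (Cg x Sx))// le_max lexx.
  by rewrite -fV// invr_gt0 f0.
have ifq : sphere_integrable (fun x => f x * quad B x).
  exact/sphere_intrC/sphere_bounded_quad.
have Bc : sint (fun x => f x * (quad B x - c)) = 0.
  transitivity (sint (fun x => f x * quad B x - c * f x)).
    by apply: eq_sint => x _; ring.
  rewrite sintB//; last exact: sphere_integrableZ.
  by rewrite sintZ// /c mulfVK ?subrr ?lt0r_neq0.
have := crit B c BT Btr Bc.
set V := sint _ => aV.
have ig : sphere_integrable (fun x => phi x ^+ 2 / f x).
  have := sphere_integrableM iphi2 bg; apply: eq_integrable => // x.
  by rewrite inE => Sx /=; rewrite fV.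
have iq : sphere_integrable (fun x => phi x * (quad B x - c)).
  exact: sphere_integrableM.
have iV : sphere_integrable (fun x => f x * (quad B x - c) ^+ 2).
  by apply: sphere_intrC => //; exact: sphere_boundedX.
have phiB : sint (fun x => phi x * (quad B x - c)) = frob B.
  transitivity (sint (fun x => phi x * quad B x - c * phi x)).
    by apply: eq_sint => x _; ring.
  rewrite sintB ?sintZ//; last 2 first.
  - by apply: sphere_integrableM => //; exact: sphere_bounded_quad.
  - exact: sphere_integrableZ.
  rewrite [sint phi]phi0 mulr0 subr0 sint_quad//.
  by apply: eq_bigr => i _; apply: eq_bigr => j _; rewrite mxE expr2.
have : 0 <= sint (fun x => (phi x - alpha * (f x * (quad B x - c))) ^+ 2 / f x).
  by apply: sint_ge0 => x Sx; rewrite mulr_ge0 ?sqr_ge0// invr_ge0 ltW ?f0.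
rewrite (@eq_sint _ _ _ (fun x => (phi x ^+ 2 / f x - 2 * alpha * (phi x * (quad B x - c)))
    + alpha ^+ 2 * (f x * (quad B x - c) ^+ 2))); last first.
  by move=> x Sx; field; rewrite lt0r_neq0// f0.
rewrite sintD; last 2 first.
- rewrite (_ : (fun _ => _) = (fun x => phi x ^+ 2 / f x +
    (- (2 * alpha)) * (phi x * (quad B x - c)))); last first.
    by apply/funext => x; rewrite mulNr.
  by apply: sphere_integrableD => //; exact: sphere_integrableZ.
- exact: sphere_integrableZ.
rewrite sintB//; last exact: sphere_integrableZ.
rewrite !sintZ// phiB -/V => sq0.
have : alpha * (alpha * V) <= alpha * frob B by rewrite ler_wpM2l// ltW.
by lra.
Qed.

End criterion.

(** * Reflections of a coordinate plane *)

Section reflection.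
Context (R : realType) (n : nat).
Implicit Types (x y : euclid R n) (i j : 'I_n) (c s : R) (B : {set 'I_n}).

(** The reflection of the plane of the i-th and j-th axes with matrix
    [c, s; s, - c], the identity on the other axes.  One family contains the
    sign changes (c = 1), the transpositions (s = 1) and the curve
    (cos t, sin t), and each of its members is its own inverse. *)
Definition refl i j c s x : euclid R n :=
  [tuple if l == i then c * coor x i + s * coor x j
         else if l == j then s * coor x i - c * coor x j else coor x l | l < n].

Lemma coor_refl i j c s x l : coor (refl i j c s x) l =
  if l == i then c * coor x i + s * coor x j
  else if l == j then s * coor x i - c * coor x j else coor x l.
Proof. by rewrite {1}/coor tnth_mktuple. Qed.

Lemma coor_refl1 i j c s x : coor (refl i j c s x) i = c * coor x i + s * coor x j.
Proof. by rewrite coor_refl eqxx. Qed.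

Lemma coor_refl2 i j c s x : i != j ->
  coor (refl i j c s x) j = s * coor x i - c * coor x j.
Proof. by move=> ij; rewrite coor_refl eq_sym (negPf ij) eqxx. Qed.

Lemma coor_reflN i j c s x l : l != i -> l != j ->
  coor (refl i j c s x) l = coor x l.
Proof. by move=> li lj; rewrite coor_refl (negPf li) (negPf lj). Qed.

Definition sqn B x : R := \sum_(i in B) coor x i ^+ 2.

Lemma sqn_refl B i j c s x : i != j -> c ^+ 2 + s ^+ 2 = 1 ->
  (i \in B) = (j \in B) -> sqn B (refl i j c s x) = sqn B x.
Proof.
move=> ij cs BB; rewrite /sqn; have [iB|iB] := boolP (i \in B).
  have jB : j \in B by rewrite -BB.
  have E y : \sum_(l in B) coor y l ^+ 2 = coor y i ^+ 2 + coor y j ^+ 2 +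
      \sum_(l in B | (l != i) && (l != j)) coor y l ^+ 2.
    rewrite (bigD1 i)//= (bigD1 j)/=; last by rewrite jB eq_sym.
    rewrite addrA; congr (_ + _).
    by apply: eq_bigl => l; rewrite andbA.
  rewrite !E coor_refl1 coor_refl2//; congr (_ + _).
    transitivity ((c ^+ 2 + s ^+ 2) * (coor x i ^+ 2 + coor x j ^+ 2)); first by ring.
    by rewrite cs mul1r.
  by apply: eq_bigr => l /and3P[_ li lj]; rewrite coor_reflN.
have jB : j \notin B by rewrite -BB.
apply: eq_bigr => l lB; rewrite coor_reflN//.
  by apply: contraNneq iB => <-.
by apply: contraNneq jB => <-.
Qed.

Lemma dotp_sqn x : dotp x x = sqn [set: 'I_n] x.
Proof. by rewrite /sqn; apply: eq_big => i; rewrite ?inE// expr2. Qed.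

Lemma sqnC B x : sqn B x + sqn (~: B) x = dotp x x.
Proof.
rewrite dotp_sqn /sqn [RHS](bigID (mem B))/=; congr (_ + _).
  by apply: eq_bigl => i; rewrite !inE.
by apply: eq_bigl => i; rewrite !inE.
Qed.

Lemma sqn_ge0 B x : 0 <= sqn B x.
Proof. by apply: sumr_ge0 => i _; exact: sqr_ge0. Qed.

Lemma sqn_sphereC B x : sphere x -> sqn (~: B) x = 1 - sqn B x.
Proof.
move=> Sx; have x1 : enorm x = 1 by [].
have := sqnC B x; rewrite -sqr_enorm x1 expr1n => <-.
by rewrite addrAC subrr add0r.
Qed.

Lemma sphere_bounded_sqn B : sphere_bounded (sqn B).
Proof.
by apply: sphere_bounded_sum => i _; apply: sphere_boundedX; exact: sphere_bounded_coor.
Qed.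

Lemma refl_isometry i j c s : i != j -> c ^+ 2 + s ^+ 2 = 1 ->
  linear_isometry (refl i j c s).
Proof.
move=> ij cs; split.
- apply: measurable_euclidP => l; under eq_fun do rewrite coor_refl.
  case: (l == i); first by apply: measurable_funD;
    apply: measurable_funM => //; exact: measurable_coor.
  case: (l == j); last exact: measurable_coor.
  by apply: measurable_funB; apply: measurable_funM => //; exact: measurable_coor.
- move=> y; exists (refl i j c s y); apply: euclidP => l.
  have [->|li] := eqVneq l i.
    rewrite coor_refl1 coor_refl1 coor_refl2//.
    by rewrite -[RHS]mul1r -cs; ring.
  have [->|lj] := eqVneq l j.
    by rewrite coor_refl2// coor_refl1 coor_refl2// -[RHS]mul1r -cs; ring.
  by rewrite !coor_reflN.
- move=> x y; apply: euclidP => l; rewrite coor_tadd !coor_refl !coor_tadd.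
  by case: (l == i); [ring|case: (l == j); [ring|]].
- move=> a x; apply: euclidP => l; rewrite coor_tscale !coor_refl !coor_tscale.
  by case: (l == i); [ring|case: (l == j); [ring|]].
- by move=> x; rewrite /enorm !dotp_sqn sqn_refl// !inE.
Qed.

End reflection.

(** Matching on the head symbol keeps unification from unfolding a power into a
    product. *)
Ltac sphere_bnd := first [ assumption |
  lazymatch goal with
  | |- sphere_bounded (fun _ => ?a) => exact: sphere_bounded_cst
  | |- sphere_bounded (fun x => coor x ?i) => exact: sphere_bounded_coor
  | |- sphere_bounded (fun x => @GRing.exp _ (@?f x) ?p) =>
      apply: sphere_boundedX; sphere_bnd
  | |- sphere_bounded (fun x => @?f x - @?g x) =>
      apply: sphere_boundedB; sphere_bnd
  | |- sphere_bounded (fun x => @?f x + @?g x) =>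
      apply: sphere_boundedD; sphere_bnd
  | |- sphere_bounded (fun x => @GRing.mul _ (@?f x) (@?g x)) =>
      apply: sphere_boundedM; sphere_bnd
  | |- sphere_bounded (fun x => expR (@?f x)) =>
      apply: sphere_bounded_expR; sphere_bnd
  | |- sphere_bounded (fun x => bigop.body _ _ _) =>
      apply: sphere_bounded_sum => *; sphere_bnd
  | |- _ => first [exact: sphere_bounded_sqn
                  | (apply: sphere_bounded_sum => *; sphere_bnd) | idtac]
  end ].

(** * Moments on a block of coordinates *)

Section weighted_integral.
Context (R : realType) (n : nat).
Implicit Types (W F G : euclid R n -> R).

Definition wint W F : R := sint (fun x => W x * F x).

Lemma eq_wint W F G : (forall x, @sphere R n x -> F x = G x) ->
  wint W F = wint W G.
Proof. by move=> FG; apply: eq_sint => x Sx; rewrite FG. Qed.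

Let bb W F : sphere_bounded W -> sphere_bounded F ->
  sphere_integrable (fun x => W x * F x).
Proof. by move=> bW bF; apply: sphere_bounded_integrable; sphere_bnd. Qed.

Lemma wintD W F G : sphere_bounded W -> sphere_bounded F -> sphere_bounded G ->
  wint W (fun x => F x + G x) = wint W F + wint W G.
Proof.
move=> bW bF bG; rewrite -sintD; [|exact: bb..].
by apply: eq_sint => x _; rewrite mulrDr.
Qed.

Lemma wintZ W a F : sphere_bounded W -> sphere_bounded F ->
  wint W (fun x => a * F x) = a * wint W F.
Proof.
move=> bW bF; rewrite -sintZ; last exact: bb.
by apply: eq_sint => x _; rewrite mulrCA.
Qed.

Lemma wintB W F G : sphere_bounded W -> sphere_bounded F -> sphere_bounded G ->
  wint W (fun x => F x - G x) = wint W F - wint W G.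
Proof.
move=> bW bF bG; rewrite -sintB; [|exact: bb..].
by apply: eq_sint => x _; rewrite mulrBr.
Qed.

Lemma wint_sum W (J : Type) (r : seq J) (P : pred J) (F : J -> euclid R n -> R) :
  sphere_bounded W -> (forall k, P k -> sphere_bounded (F k)) ->
  wint W (fun x => \sum_(k <- r | P k) F k x) = \sum_(k <- r | P k) wint W (F k).
Proof.
move=> bW bF; rewrite -sint_sum; last by move=> k Pk; apply: bb => //; exact: bF.
by apply: eq_sint => x _; rewrite mulr_sumr.
Qed.

End weighted_integral.

Section block_moments.
Context (R : realType) (n : nat) (n0 : (0 < n)%N).
Context (B : {set 'I_n}) (B1 : (1 < #|B|)%N).
Context (W : euclid R n -> R) (bW : sphere_bounded W).
Hypothesis Winv : forall i j (c s : R) x, i \in B -> j \in B -> i != j ->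
  c ^+ 2 + s ^+ 2 = 1 -> W (refl i j c s x) = W x.
Local Notation I := (wint W).

Lemma block_refl i j c s F : i \in B -> j \in B -> i != j ->
  c ^+ 2 + s ^+ 2 = 1 -> sphere_bounded F ->
  I (fun x => F (refl i j c s x)) = I F.
Proof.
move=> iB jB ij cs bF.
rewrite -[RHS](sint_isometry n0 (refl_isometry ij cs)); last by sphere_bnd.
by apply: eq_sint => x _; rewrite Winv.
Qed.

(** Changing the sign of the j-th coordinate flips the sign of the monomial. *)
Lemma block_odd (r : seq 'I_n) j : j \in B -> odd (count_mem j r) ->
  I (fun x => \prod_(a <- r) coor x a) = 0.
Proof.
move=> jB jr; have [i iB ij] : exists2 i, i \in B & i != j.
  have /card_gt0P[i] : (0 < #|B :\ j|)%N.
    by move: B1; rewrite (cardsD1 j) jB add1n ltnS.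
  by rewrite !inE => /andP[ij iB]; exists i.
have bP : sphere_bounded (fun x : euclid R n => \prod_(a <- r) coor x a).
  by apply: sphere_bounded_prod => a _; exact: sphere_bounded_coor.
have cs : 1 ^+ 2 + 0 ^+ 2 = 1 :> R by rewrite expr1n expr0n addr0.
suff E (x : euclid R n) : \prod_(a <- r) coor (refl i j 1 0 x) a =
    (-1) ^+ count_mem j r * \prod_(a <- r) coor x a.
  have := block_refl iB jB ij cs bP.
  rewrite (_ : I _ = - I (fun x => \prod_(a <- r) coor x a)); first lra.
  rewrite -mulN1r -wintZ//.
  by apply: eq_wint => x _; rewrite E -signr_odd jr expr1.
elim: r {jr bP} => [|a r IH]; first by rewrite !big_nil mulr1.
rewrite !big_cons IH /= exprD.
have [->|aj] := eqVneq a j; first by rewrite coor_refl2//; ring.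
rewrite expr0 mul1r mulrCA; congr (_ * _); congr (_ * _).
have [->|ai] := eqVneq a i; first by rewrite coor_refl1; ring.
by rewrite coor_reflN.
Qed.

Lemma block_odd1 i : i \in B -> I (fun x => coor x i) = 0.
Proof.
move=> iB; rewrite -(@block_odd [:: i] i)//= ?eqxx//.
by apply: eq_wint => x _; rewrite big_seq1.
Qed.

Lemma block_odd2 i j : i \in B -> i != j -> I (fun x => coor x i * coor x j) = 0.
Proof.
move=> iB ij; rewrite -(@block_odd [:: i; j] i)//= ?eqxx//; last first.
  by rewrite eq_sym (negPf ij).
by apply: eq_wint => x _; rewrite !big_cons big_nil mulr1.
Qed.

Lemma block_odd3 i j k : i \in B -> j \in B -> k \in B ->
  I (fun x => coor x i * (coor x j * coor x k)) = 0.
Proof.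
move=> iB jB kB.
have [l lB lodd] : exists2 l, l \in B & odd (count_mem l [:: i; j; k]).
  have [<-|jk] := eqVneq j k.
    by exists i => //=; rewrite eqxx; case: (_ == _).
  have [ij|ij] := eqVneq i j.
    by exists k => //=; rewrite eqxx ij (negPf jk).
  have [ik|ik] := eqVneq i k.
    by exists j => //=; rewrite eqxx (negPf ij) eq_sym (negPf jk).
  exists i => //=; rewrite eqxx eq_sym (negPf ij).
  by rewrite eq_sym (negPf ik).
rewrite -(block_odd lB lodd).
by apply: eq_wint => x _; rewrite !big_cons big_nil mulr1.
Qed.

Lemma block_sq_eq i j : i \in B -> j \in B ->
  I (fun x => coor x i ^+ 2) = I (fun x => coor x j ^+ 2).
Proof.
have [-> //|ij] := eqVneq i j => iB jB.
have cs : 0 ^+ 2 + 1 ^+ 2 = 1 :> R by rewrite expr1n expr0n add0r.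
rewrite -(block_refl iB jB ij cs); last by sphere_bnd.
by apply: eq_wint => x _; rewrite coor_refl1; ring.
Qed.

Lemma block_sq i : i \in B ->
  I (fun x => coor x i ^+ 2) = I (sqn B) / #|B|%:R.
Proof.
move=> iB; rewrite /sqn wint_sum//; last by move=> *; sphere_bnd.
rewrite (eq_bigr (fun=> I (fun x => coor x i ^+ 2))); last first.
  by move=> j jB; exact: block_sq_eq.
rewrite sumr_const -[_ *+ _]mulr_natr mulfK// pnatr_eq0 -lt0n.
exact: leq_trans B1.
Qed.

Lemma block_quart_eq i j : i \in B -> j \in B ->
  I (fun x => coor x i ^+ 4) = I (fun x => coor x j ^+ 4).
Proof.
have [-> //|ij] := eqVneq i j => iB jB.
have cs : 0 ^+ 2 + 1 ^+ 2 = 1 :> R by rewrite expr1n expr0n add0r.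
rewrite -(block_refl iB jB ij cs); last by sphere_bnd.
by apply: eq_wint => x _; rewrite coor_refl1; ring.
Qed.

(** The reflection with the rational entries 3/5 and 4/5 compares the two kinds
    of fourth moments without square roots. *)
Lemma block_quart i j : i \in B -> j \in B -> i != j ->
  I (fun x => coor x i ^+ 4) = 3 * I (fun x => coor x i ^+ 2 * coor x j ^+ 2).
Proof.
move=> iB jB ij.
have cs : (3 / 5) ^+ 2 + (4 / 5) ^+ 2 = 1 :> R by field.
have b4 : sphere_bounded (fun x : euclid R n => coor x i ^+ 4) by sphere_bnd.
have := block_refl iB jB ij cs b4.
have odd31 k l : k \in B -> k != l ->
    I (fun x => coor x k * coor x l ^+ 3) = 0.
  move=> kB kl; rewrite -(@block_odd [:: k; l; l; l] k)//=; last first.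
    by rewrite eqxx eq_sym (negPf kl).
  by apply: eq_wint => x _; rewrite !big_cons big_nil; ring.
rewrite (_ : I _ = I (fun x => 81 / 625 * coor x i ^+ 4 + (256 / 625 * coor x j ^+ 4
   + (432 / 625 * (coor x j * coor x i ^+ 3) + (768 / 625 * (coor x i * coor x j ^+ 3)
   + 864 / 625 * (coor x i ^+ 2 * coor x j ^+ 2)))))); last first.
  by apply: eq_wint => x _; rewrite coor_refl1; field.
do 4 (rewrite wintD; [|by sphere_bnd..]).
do 5 (rewrite wintZ; [|by sphere_bnd..]).
rewrite odd31 1?eq_sym// odd31// (block_quart_eq jB iB).
by lra.
Qed.

(** One third of the fourth moment of any coordinate of the block, see [kurtE];
    this form of it depends on the square norm alone. *)
Definition kurt := I (fun x => sqn B x ^+ 2) / (#|B| * (#|B| + 2))%:R.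

(** Expand the square of the sum of the x_i^2: b diagonal terms q and b (b - 1)
    off-diagonal terms q / 3 add up to b (b + 2) q / 3. *)
Lemma kurtE i : i \in B -> I (fun x => coor x i ^+ 4) = 3 * kurt.
Proof.
move=> iB; rewrite /kurt.
have E (x : euclid R n) : sqn B x ^+ 2 =
    \sum_(i in B) \sum_(j in B) coor x i ^+ 2 * coor x j ^+ 2.
  rewrite expr2 /sqn mulr_suml; apply: eq_bigr => k _.
  by rewrite mulr_sumr.
rewrite (eq_wint W (fun x _ => E x)).
rewrite wint_sum//; last by move=> k _; sphere_bnd.
rewrite (eq_bigr (fun=> (#|B| + 2)%:R / 3 * I (fun x => coor x i ^+ 4))); last first.
  move=> k kB; rewrite wint_sum//; last by move=> l _; sphere_bnd.
  rewrite (bigD1 k)//= (_ : I _ = I (fun x => coor x i ^+ 4)); last first.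
    rewrite (block_quart_eq iB kB); apply: eq_wint => x _; ring.
  rewrite (eq_bigr (fun=> I (fun x => coor x i ^+ 4) / 3)); last first.
    move=> l /andP[lB lk]; rewrite (block_quart_eq iB kB).
    by rewrite (@block_quart k l)// 1?eq_sym//; field.
  rewrite (eq_bigl (mem (B :\ k))); last by move=> l; rewrite !inE andbC.
  rewrite sumr_const -[_ *+ _]mulr_natr.
  have -> : #|B| = #|B :\ k|.+1 by rewrite (cardsD1 k) kB.
  by rewrite -addn1 !natrD; field.
rewrite sumr_const -[_ *+ _]mulr_natr natrM natrD.
have b0 : #|B|%:R != 0 :> R by rewrite pnatr_eq0 -lt0n (leq_trans _ B1).
have b2 : #|B|%:R + 2 != 0 :> R by rewrite -natrD pnatr_eq0 addn2.
by field; rewrite b0 b2.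
Qed.

(** The fourth moments form an isotropic tensor: unless the indices pair up, some
    index occurs an odd number of times. *)
Lemma block_fourth i j k l : i \in B -> j \in B -> k \in B -> l \in B ->
  I (fun x => (coor x i * coor x j) * (coor x k * coor x l)) =
  kurt * (((i == j) && (k == l))%:R + ((i == k) && (j == l))%:R
          + ((i == l) && (j == k))%:R).
Proof.
move=> iB jB kB lB.
have bodd a : a \in B -> odd (count_mem a [:: i; j; k; l]) ->
    I (fun x => (coor x i * coor x j) * (coor x k * coor x l)) = 0.
  move=> aB ao; rewrite -(block_odd aB ao); apply: eq_wint => x _.
  by rewrite !big_cons big_nil; ring.
have sq2 a b : a \in B -> b \in B -> a != b ->
    I (fun x => coor x a ^+ 2 * coor x b ^+ 2) = kurt.
  move=> aB bB ab; have := block_quart aB bB ab; rewrite kurtE//; lra.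
have [ij|ij] := eqVneq i j.
  subst j; have [kl|kl] := eqVneq k l; last first.
    rewrite (@bodd k)//=; last first.
      by rewrite eqxx [l == k]eq_sym (negPf kl); case: (i == k).
    have [ik|ik] := eqVneq i k; first by subst k; rewrite (negPf kl) /= ?andbF /=; ring.
    by rewrite /= andbF /=; ring.
  subst l; have [ik|ik] := eqVneq i k.
    subst k; rewrite (_ : I _ = I (fun x => coor x i ^+ 4)); first by rewrite kurtE//=; ring.
    by apply: eq_wint => x _; ring.
  rewrite (_ : I _ = I (fun x => coor x i ^+ 2 * coor x k ^+ 2)); first by rewrite sq2//= ?andbF /=; ring.
  by apply: eq_wint => x _; ring.
have [ik|ik] := eqVneq i k.
  subst k; have [jl|jl] := eqVneq j l.
    subst l; rewrite (_ : I _ = I (fun x => coor x i ^+ 2 * coor x j ^+ 2)).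
      by rewrite sq2//= (negPf ij) ?andbF /=; ring.
    by apply: eq_wint => x _; ring.
  rewrite (@bodd j)//=; last by rewrite eqxx (negPf ij) [l == j]eq_sym (negPf jl).
  by rewrite [j == i]eq_sym (negPf ij) andbF /=; ring.
have [il|il] := eqVneq i l.
  subst l; have [jk|jk] := eqVneq j k.
    subst k; rewrite (_ : I _ = I (fun x => coor x i ^+ 2 * coor x j ^+ 2)).
      by rewrite sq2//= ?andbF /=; ring.
    by apply: eq_wint => x _; ring.
  rewrite (@bodd j)//=; first by rewrite ?andbF /=; ring.
  by rewrite eqxx (negPf ij) [k == j]eq_sym (negPf jk).
rewrite (@bodd i)//=; first by rewrite ?andbF /=; ring.
by rewrite eqxx [j == i]eq_sym (negPf ij) [k == i]eq_sym (negPf ik) [l == i]eq_sym (negPf il).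
Qed.

End block_moments.

Section mxact_isometry.
Context (R : realType) (n : nat).
Implicit Types (x y : euclid R n) (Q : 'M[R]_n).

Lemma coor_mxact Q x i : coor (mxact Q x) i = \sum_j Q i j * coor x j.
Proof. by rewrite /coor tnth_mktuple. Qed.

Lemma mxactM Q Q' x : mxact Q (mxact Q' x) = mxact (Q *m Q') x.
Proof.
apply: euclidP => i; rewrite !coor_mxact.
under eq_bigr do rewrite coor_mxact mulr_sumr.
rewrite exchange_big; apply: eq_bigr => j _; rewrite mxE mulr_suml.
by apply: eq_bigr => k _; rewrite mulrA.
Qed.

Lemma mxact1 x : mxact 1%:M x = x.
Proof.
apply: euclidP => i; rewrite coor_mxact (bigD1 i)//= mxE eqxx mul1r big1 ?addr0//.
by move=> j ji; rewrite mxE eq_sym (negPf ji) mul0r.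
Qed.

Lemma dotp_mxact Q x y : dotp (mxact Q x) y = dotp x (mxact Q^T y).
Proof.
rewrite /dotp; under eq_bigr do rewrite coor_mxact mulr_suml.
rewrite exchange_big; apply: eq_bigr => j _; rewrite coor_mxact mulr_sumr.
by apply: eq_bigr => i _; rewrite mxE; ring.
Qed.

Lemma mxact_isometry Q : orthogonal_mx Q -> linear_isometry (mxact Q).
Proof.
move=> QQ; split.
- apply: measurable_euclidP => i; under eq_fun do rewrite coor_mxact.
  apply: measurable_sum => j.
  by apply: measurable_funM => //; exact: measurable_coor.
- by move=> y; exists (mxact Q^T y); rewrite mxactM QQ mxact1.
- move=> x y; apply: euclidP => i; rewrite coor_tadd !coor_mxact -big_split.
  by apply: eq_bigr => j _; rewrite coor_tadd mulrDr.
- move=> a x; apply: euclidP => i; rewrite coor_tscale !coor_mxact mulr_sumr.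
  by apply: eq_bigr => j _; rewrite coor_tscale mulrCA.
- by move=> x; rewrite /enorm dotp_mxact mxactM (mulmx1C QQ) mxact1.
Qed.

End mxact_isometry.

Section quadratic_moments.
Context (R : realType) (n : nat) (n0 : (0 < n)%N).
Context (B : {set 'I_n}) (B1 : (1 < #|B|)%N).
Context (W : euclid R n -> R) (bW : sphere_bounded W).
Hypothesis Winv : forall i j (c s : R) x, i \in B -> j \in B -> i != j ->
  c ^+ 2 + s ^+ 2 = 1 -> W (refl i j c s x) = W x.
Local Notation I := (wint W).

Definition quadB (N : 'M[R]_n) (x : euclid R n) : R :=
  \sum_(i in B) \sum_(j in B) N i j * (coor x i * coor x j).

Lemma sphere_bounded_quadB N : sphere_bounded (quadB N).
Proof. by rewrite /quadB; sphere_bnd. Qed.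

Lemma wint_quadB (G : euclid R n -> R) N : sphere_bounded G ->
  I (fun x => G x * quadB N x) =
  \sum_(i in B) \sum_(j in B) N i j * I (fun x => G x * (coor x i * coor x j)).
Proof.
move=> bG.
have E (x : euclid R n) : G x * quadB N x =
    \sum_(i in B) \sum_(j in B) N i j * (G x * (coor x i * coor x j)).
  rewrite mulr_sumr; apply: eq_bigr => i _; rewrite mulr_sumr.
  by apply: eq_bigr => j _; rewrite mulrCA.
rewrite (eq_wint W (fun x _ => E x)) wint_sum//; last by move=> i _; sphere_bnd.
apply: eq_bigr => i _; rewrite wint_sum//; last by move=> j _; sphere_bnd.
by apply: eq_bigr => j _; rewrite wintZ//; sphere_bnd.
Qed.

Lemma sum_delta (P : pred 'I_n) (F : 'I_n -> R) i : P i ->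
  \sum_(j | P j) (i == j)%:R * F j = F i.
Proof.
move=> Pi; rewrite (bigD1 i)//= eqxx mul1r big1 ?addr0// => j /andP[_ ji].
by rewrite eq_sym (negPf ji) mul0r.
Qed.

(** Contract the isotropic tensor of [block_fourth] with N twice; the term with
    the trace drops out and symmetry makes the other two equal. *)
Lemma block_quad_sq (N : 'M[R]_n) : N^T = N -> \sum_(i in B) N i i = 0 ->
  I (fun x => quadB N x ^+ 2) =
  2 * kurt B W * \sum_(i in B) \sum_(j in B) N i j ^+ 2.
Proof.
move=> NT Ntr.
have Nsym i j : N i j = N j i by rewrite -{1}NT mxE.
have inner i j : i \in B -> j \in B ->
    I (fun x => coor x i * coor x j * quadB N x) = 2 * kurt B W * N i j.
  move=> iB jB; rewrite wint_quadB; last by sphere_bnd.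
  transitivity (\sum_(k in B) \sum_(l in B) kurt B W *
     ((i == j)%:R * ((k == l)%:R * N k l) + (i == k)%:R * ((j == l)%:R * N k l)
      + (j == k)%:R * ((i == l)%:R * N k l))).
    apply: eq_bigr => k kB; apply: eq_bigr => l lB.
    rewrite (block_fourth n0 B1 bW Winv)//.
    have bM (a b : bool) : (a && b)%:R = a%:R * b%:R :> R.
      by case: a; case: b; rewrite ?mulr1 ?mulr0.
    by rewrite !bM; ring.
  transitivity (kurt B W * ((i == j)%:R * (\sum_(k in B) N k k) + N i j + N j i)).
    under eq_bigr do rewrite -mulr_sumr; rewrite -mulr_sumr; congr (_ * _).
    transitivity (\sum_(k in B) ((i == j)%:R * N k k + (i == k)%:R * N k j
        + (j == k)%:R * N k i)).
      apply: eq_bigr => k kB; rewrite !big_split/= -!mulr_sumr.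
      by rewrite !(sum_delta (P := mem B)).
    by rewrite !big_split/= -!mulr_sumr !(sum_delta (P := mem B)).
  by rewrite Ntr (Nsym j i); ring.
rewrite (eq_wint W (fun x _ => expr2 _)) wint_quadB; last exact: sphere_bounded_quadB.
rewrite mulr_sumr; apply: eq_bigr => i iB; rewrite mulr_sumr.
apply: eq_bigr => j jB.
rewrite (_ : I _ = I (fun x => coor x i * coor x j * quadB N x)).
  by rewrite inner//; ring.
by apply: eq_wint => x _; rewrite mulrC.
Qed.

Lemma block_quad_mean (N : 'M[R]_n) : \sum_(i in B) N i i = 0 -> I (quadB N) = 0.
Proof.
move=> Ntr.
rewrite (_ : I _ = I (fun x => 1 * quadB N x)); last first.
  by apply: eq_wint => x _; rewrite mul1r.
rewrite wint_quadB; last exact: sphere_bounded_cst.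
transitivity (\sum_(i in B) (N i i * (I (sqn B) / #|B|%:R))).
  apply: eq_bigr => i iB; rewrite (bigD1 i)//= [X in _ + X]big1 ?addr0.
    rewrite -(block_sq n0 B1 bW Winv iB); congr (_ * _).
    by apply: eq_wint => x _; rewrite mul1r expr2.
  move=> j /andP[jB ji].
  rewrite (_ : I _ = I (fun x => coor x i * coor x j)).
    by rewrite (block_odd2 n0 B1 bW Winv)// ?mulr0// eq_sym.
  by apply: eq_wint => x _; rewrite mul1r.
by rewrite -mulr_suml Ntr mul0r.
Qed.

End quadratic_moments.

Section linear_moments.
Context (R : realType) (n : nat) (n0 : (0 < n)%N).
Context (B : {set 'I_n}) (B1 : (1 < #|B|)%N).
Context (W : euclid R n -> R) (bW : sphere_bounded W).
Hypothesis Winv : forall i j (c s : R) x, i \in B -> j \in B -> i != j ->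
  c ^+ 2 + s ^+ 2 = 1 -> W (refl i j c s x) = W x.
Local Notation I := (wint W).

Definition linB (a : 'I_n -> R) (x : euclid R n) : R :=
  \sum_(i in B) a i * coor x i.

Lemma sphere_bounded_linB a : sphere_bounded (linB a).
Proof. by rewrite /linB; sphere_bnd. Qed.

Lemma wint_linB (G : euclid R n -> R) a : sphere_bounded G ->
  I (fun x => linB a x * G x) = \sum_(i in B) a i * I (fun x => coor x i * G x).
Proof.
move=> bG.
rewrite (@eq_wint _ _ _ _ (fun x => \sum_(i in B) a i * (coor x i * G x))); last first.
  by move=> x _; rewrite mulr_suml; apply: eq_bigr => i _; rewrite mulrA.
rewrite wint_sum//; last by move=> i _; sphere_bnd.
by apply: eq_bigr => i _; rewrite wintZ//; sphere_bnd.
Qed.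

Lemma block_lin_mean a : I (linB a) = 0.
Proof.
rewrite (@eq_wint _ _ _ _ (fun x => linB a x * 1)); last by move=> x _; rewrite mulr1.
rewrite wint_linB; last exact: sphere_bounded_cst.
rewrite big1// => i iB; rewrite (@eq_wint _ _ _ _ (fun x => coor x i)); last first.
  by move=> x _; rewrite mulr1.
by rewrite (block_odd1 n0 B1 bW Winv)// mulr0.
Qed.

Lemma block_lin_sq a :
  I (fun x => linB a x ^+ 2) = (\sum_(i in B) a i ^+ 2) * (I (sqn B) / #|B|%:R).
Proof.
rewrite (@eq_wint _ _ _ _ (fun x => linB a x * linB a x)); last by [].
rewrite wint_linB; last exact: sphere_bounded_linB.
rewrite mulr_suml; apply: eq_bigr => i iB.
rewrite (@eq_wint _ _ _ _ (fun x => linB a x * coor x i)); last first.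
  by move=> x _; rewrite mulrC.
rewrite wint_linB; last exact: sphere_bounded_coor.
rewrite (bigD1 i)//= [X in _ + X]big1 ?addr0.
  rewrite -(block_sq n0 B1 bW Winv iB) [a i ^+ 2]expr2 -mulrA; congr (_ * (_ * _)).
by move=> j /andP[jB ji]; rewrite (block_odd2 n0 B1 bW Winv)// mulr0.
Qed.

(** Third moments of a block are odd in some coordinate. *)
Lemma block_lin_quad a N : I (fun x => linB a x * quadB B N x) = 0.
Proof.
rewrite wint_linB; last exact: sphere_bounded_quadB.
rewrite big1// => i iB; rewrite wint_quadB//; last exact: sphere_bounded_coor.
rewrite big1 ?mulr0// => j jB; rewrite big1// => l lB.
by rewrite (block_odd3 n0 B1 bW Winv)// mulr0.
Qed.

End linear_moments.

(** * Moments of a partial square norm on the sphere *)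

Section real_derivatives.
Context (R : realType).
Implicit Types (f g : R -> R) (t df dg : R).

Lemma is_derive_fD f g t df dg : is_derive t 1 f df -> is_derive t 1 g dg ->
  is_derive t 1 (fun u => f u + g u) (df + dg).
Proof. exact: is_deriveD. Qed.

Lemma is_derive_fB f g t df dg : is_derive t 1 f df -> is_derive t 1 g dg ->
  is_derive t 1 (fun u => f u - g u) (df - dg).
Proof. exact: is_deriveB. Qed.

Lemma is_derive_fM f g t df dg : is_derive t 1 f df -> is_derive t 1 g dg ->
  is_derive t 1 (fun u => f u * g u) (f t * dg + g t * df).
Proof. exact: is_deriveM. Qed.

Lemma is_derive_fX f p t df : is_derive t 1 f df ->
  is_derive t 1 (fun u => f u ^+ p) (p%:R * f t ^+ p.-1 * df).
Proof.
move=> d; case: p => [|p]; first by rewrite !mul0r; exact: is_derive_cst.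
elim: p => [|p IH]; first by rewrite expr0 mulr1 mul1r.
under eq_fun do rewrite exprS.
by apply: is_derive_eq (is_derive_fM d IH) _; rewrite /= !mulrSr !exprS; ring.
Qed.

Lemma is_derive_fexp f t df : is_derive t 1 f df ->
  is_derive t 1 (fun u => expR (f u)) (expR (f t) * df).
Proof. by move=> d; apply: is_derive1_comp. Qed.

Lemma is_derive_fc a t : is_derive t 1 (fun=> a : R) 0.
Proof. exact: is_derive_cst. Qed.
End real_derivatives.

Section sphere_beta_moments.
Context (R : realType) (n : nat) (n0 : (0 < n)%N) (B : {set 'I_n}).
Implicit Types (x : euclid R n).
Local Notation S := (@sphere R n).

Definition sphere_moment (p : nat) : R := sint (fun x => sqn B x ^+ p).

Section one_rotation.
Context (i j : 'I_n) (iB : i \in B) (jB : j \notin B) (p : nat).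

Let ij : i != j.
Proof. by apply: contraNneq jB => <-. Qed.

Let F x := coor x i * coor x j * sqn B x ^+ p.

Let D x := (coor x i ^+ 2 - coor x j ^+ 2) * sqn B x ^+ p -
  2 * p%:R * (coor x i ^+ 2 * coor x j ^+ 2 * sqn B x ^+ p.-1).

Let bF : sphere_bounded F.
Proof. by rewrite /F; sphere_bnd. Qed.

Let bD : sphere_bounded D.
Proof. by rewrite /D; sphere_bnd. Qed.

Let rot (t : R) x := refl i j (cos t) (sin t) x.

Let rot_isometry t : linear_isometry (rot t).
Proof. by apply: refl_isometry => //; exact: cos2Dsin2. Qed.

Let sqn_rot t x :
  sqn B (rot t x) = sqn B x - coor x i ^+ 2 + coor (rot t x) i ^+ 2.
Proof.
rewrite /sqn (bigD1 i)//= [in RHS](bigD1 i)//=.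
rewrite [X in _ = X - _ + _]addrC addrK addrC; congr (_ + _).
apply: eq_bigr => l /andP[lB li]; rewrite coor_reflN//.
by apply: contraNneq jB => <-.
Qed.

Let is_derive_rot (t : R) x :
  is_derive t 1 (fun u => F (rot u x)) (D (rot t x)).
Proof.
have d1 : is_derive t 1 (fun u => coor (rot u x) i) (- coor (rot t x) j).
  rewrite /rot; under eq_fun do rewrite coor_refl1.
  rewrite coor_refl2//.
  have := is_derive_fD
    (is_derive_fM (is_derive_cos t) (is_derive_fc (coor x i) t))
    (is_derive_fM (is_derive_sin t) (is_derive_fc (coor x j) t)).
  by move=> d; apply: is_derive_eq d _; ring.
have d2 : is_derive t 1 (fun u => coor (rot u x) j) (coor (rot t x) i).
  rewrite /rot; under eq_fun do rewrite coor_refl2//.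
  rewrite coor_refl1.
  have := is_derive_fB
    (is_derive_fM (is_derive_sin t) (is_derive_fc (coor x i) t))
    (is_derive_fM (is_derive_cos t) (is_derive_fc (coor x j) t)).
  by move=> d; apply: is_derive_eq d _; ring.
have d3 : is_derive t 1 (fun u => sqn B (rot u x))
    (- (2 * (coor (rot t x) i * coor (rot t x) j))).
  under eq_fun do rewrite sqn_rot.
  have := is_derive_fD (is_derive_fc (sqn B x - coor x i ^+ 2) t)
    (is_derive_fX 2 d1).
  by move=> d; apply: is_derive_eq d _; ring.
have := is_derive_fM (is_derive_fM d1 d2) (is_derive_fX p d3).
by move=> d; apply: is_derive_eq d _; rewrite /D; ring.
Qed.

(** The integral of F along the curve of reflections is constant, and D is the
    derivative of F along that curve. *)
Lemma sint_rotation_derivative : sint D = 0.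
Proof.
have rS t x : S x -> S (rot t x).
  by rewrite /sphere/= (isometry_enorm (rot_isometry t)).
have [C DC] := sphere_boundedP bD.
have C0 : 0 <= `|C| by exact: normr_ge0.
have I0 : `]-1, 1[%classic (0 : R) by rewrite /= in_itv/=; apply/andP; split; lra.
have intf (t : R) : `]-1, 1[%classic t ->
    (@surface_measure R n).-integrable S (EFin \o (fun x => F (rot t x))).
  move=> _; apply: (@sphere_bounded_integrable _ _ (F \o rot t)); split.
    exact: (measurableT_comp (sphere_bounded_measurable bF)
       (measurable_isometry (rot_isometry t))).
  by have [C' FC'] := sphere_boundedP bF; exists C' => x Sx; apply: FC'; exact: rS.
have derf (t : R) x : `]-1, 1[%classic t -> S x -> derivable (fun u => F (rot u x)) t 1.
  by move=> _ _; apply: ex_derive; exact: is_derive_rot.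
have dE (t : R) x : partial1of2 (fun u x => F (rot u x)) t x = D (rot t x).
  by rewrite partial1of2E; have d := is_derive_rot t x; rewrite derive_val.
have intG : (@surface_measure R n).-integrable S (EFin \o (fun=> `|C|)).
  exact/sphere_bounded_integrable/sphere_bounded_cst.
have G_ub (t : R) x : `]-1, 1[%classic t -> S x ->
    `|partial1of2 (fun u x => F (rot u x)) t x| <= `|C|.
  move=> _ Sx; rewrite dE (le_trans (DC _ (rS t x Sx)))//; exact: ler_norm.
have := @differentiation_under_integral R _ _ (@surface_measure R n)
  (fun u x => F (rot u x)) S (@measurable_sphere R n) 0 (-1) 1 I0 intf derf
  (fun=> `|C|) (fun=> C0) intG G_ub.
have -> : (fun t : R => \int[@surface_measure R n]_(x in S) F (rot t x)) =
    cst (sint F).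
  by apply/funext => t; exact: (sint_isometry n0 (rot_isometry t) bF).
rewrite derive1_cst => /esym <-; rewrite -(sint_isometry n0 (rot_isometry 0) bD).
by apply: eq_sint => x _; rewrite dE.
Qed.

End one_rotation.

(** Sum the identity [sint_rotation_derivative] over i in B and j outside B, and
    use that the square norms of the two blocks add up to 1. *)
Lemma sphere_moment_rec p :
  (n%:R + 2 * p%:R) * sphere_moment p.+1 = (#|B|%:R + 2 * p%:R) * sphere_moment p.
Proof.
pose D i j x := (coor x i ^+ 2 - coor x j ^+ 2) * sqn B x ^+ p -
  2 * p%:R * (coor x i ^+ 2 * coor x j ^+ 2 * sqn B x ^+ p.-1).
have bs := @sphere_bounded_sqn R n B.
have iD i j : sphere_integrable (D i j).
  by apply: sphere_bounded_integrable; rewrite /D; sphere_bnd.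
have E : sint (fun x => \sum_(i in B) \sum_(j in ~: B) D i j x) = 0.
  rewrite sint_sum; last by move=> i _; exact: sphere_integrable_sum.
  rewrite big1// => i iB; rewrite sint_sum; last by move=> *; exact: iD.
  by rewrite big1// => j; rewrite inE => jB; exact: sint_rotation_derivative.
have nB : n%:R = #|B|%:R + #|~: B|%:R :> R by rewrite -natrD cardsC card_ord.
have DE x : S x -> \sum_(i in B) \sum_(j in ~: B) D i j x =
   (n%:R + 2 * p%:R) * sqn B x ^+ p.+1 - (#|B|%:R + 2 * p%:R) * sqn B x ^+ p.
  move=> Sx.
  transitivity ((#|~: B|%:R * sqn B x - #|B|%:R * sqn (~: B) x) * sqn B x ^+ p
     - 2 * p%:R * (sqn B x * sqn (~: B) x * sqn B x ^+ p.-1)).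
    transitivity (\sum_(i in B) ((#|~: B|%:R * coor x i ^+ 2 - sqn (~: B) x) * sqn B x ^+ p
     - 2 * p%:R * (coor x i ^+ 2 * sqn (~: B) x * sqn B x ^+ p.-1))).
      apply: eq_bigr => i iB; rewrite sumrB -mulr_suml -mulr_sumr -mulr_suml -mulr_sumr.
      by rewrite sumrB sumr_const [#|~: B|%:R * _]mulr_natl.
    rewrite sumrB -mulr_suml -mulr_sumr -mulr_suml -mulr_suml.
    by rewrite sumrB -mulr_sumr sumr_const [#|B|%:R * _]mulr_natl.
  rewrite sqn_sphereC// nB; clear D iD E; case: p => [|q]; first by rewrite expr1; ring.
  by rewrite /= !exprS; ring.
move: E; rewrite (eq_sint DE) sintB; last 2 first.
- by apply: sphere_bounded_integrable; sphere_bnd.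
- by apply: sphere_bounded_integrable; sphere_bnd.
rewrite !sintZ; last 2 first.
- by apply: sphere_bounded_integrable; sphere_bnd.
- by apply: sphere_bounded_integrable; sphere_bnd.
by move/eqP; rewrite subr_eq0 => /eqP.
Qed.

End sphere_beta_moments.

(** * Exponential integrals over the sphere and over [0, pi / 2] *)

Section exponential_moments.
Context d (Y : measurableType d) (R : realType).
Context (mu : {measure set Y -> \bar R}) (D : set Y) (mD : measurable D).
Context (s w : Y -> R) (ms : measurable_fun D s).
Hypothesis s01 : forall y, D y -> 0 <= s y <= 1.
Hypothesis iw : mu.-integrable D (EFin \o w).

Lemma integrable_moment q : mu.-integrable D (EFin \o (fun y => s y ^+ q * w y)).
Proof.
rewrite (_ : _ \o _ = ((EFin \o (fun y => (s y ^+ q)%R)) \* (EFin \o w))%E); last first.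
  by apply/funext => y /=; rewrite EFinM.
apply: integrableMr => //; first exact: measurable_funX.
exists 1; split=> // e e1 y Dy; have /andP[s0 s1] := s01 Dy.
by rewrite /= normrX ger0_norm// (le_trans _ (ltW e1))// exprn_ile1.
Qed.

(** Dominated convergence for the exponential series: its partial sums at eta s
    are bounded by exp |eta|. *)
Lemma exponential_moment_cvg (eta : R) :
  (\sum_(0 <= q < N) eta ^+ q / q`!%:R * \int[mu]_(y in D) (s y ^+ q * w y))
    @[N --> \oo] --> \int[mu]_(y in D) (expR (eta * s y) * w y).
Proof.
pose f N y := series (exp_coeff (eta * s y)) N * w y.
have fE N y : f N y =
    \sum_(0 <= q < N) eta ^+ q / q`!%:R * (s y ^+ q * w y).
  rewrite /f /series /= mulr_suml; apply: eq_bigr => q _.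
  by rewrite /exp_coeff /= exprMn; ring.
have intf N : mu.-integrable D (EFin \o f N).
  rewrite (_ : f N = fun y => \sum_(0 <= q < N) eta ^+ q / q`!%:R * (s y ^+ q * w y)).
    apply: integrable_EFin_sum => // q _.
    rewrite (_ : _ \o _ = (fun y => (eta ^+ q / q`!%:R)%R%:E *
        (EFin \o (fun y => (s y ^+ q * w y)%R)) y)%E).
      by apply: integrableZl => //; exact: integrable_moment.
    by apply/funext => y /=; rewrite EFinM.
  by apply/funext => y; exact: fE.
rewrite (_ : (fun N => \sum_(0 <= q < N) _) = (fun N => \int[mu]_(y in D) f N y)); last first.
  apply/funext => N; under eq_Rintegral do rewrite fE.
  rewrite Rintegral_sum//.
    by apply: eq_bigr => q _; rewrite RintegralZl//; exact: integrable_moment.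
  move=> q _; rewrite (_ : _ \o _ = (fun y => (eta ^+ q / q`!%:R)%R%:E *
        (EFin \o (fun y => (s y ^+ q * w y)%R)) y)%E).
    by apply: integrableZl => //; exact: integrable_moment.
  by apply/funext => y /=; rewrite EFinM.
have mw : measurable_fun D w by apply/measurable_EFinP; exact: measurable_int iw.
have mexp : measurable_fun D (fun y => expR (eta * s y)).
  by apply: measurableT_comp => //; exact: measurable_funM.
have expb y : D y -> expR (`|eta| * s y) <= expR `|eta|.
  by move=> Dy; have /andP[s0 s1] := s01 Dy; rewrite ler_expR ler_piMr.
have [] := @dominated_convergence _ _ _ mu D mD (fun N => EFin \o f N)
    (EFin \o (fun y => expR (eta * s y) * w y))
    (fun y => (expR `|eta|)%:E * `|(EFin \o w) y|)%E.
- by move=> N; exact: measurable_int (intf N).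
- by apply/measurable_EFinP; exact: measurable_funM.
- apply: aeW => y Dy; apply: cvg_EFin; first exact: nearW.
  by apply: cvgM; [exact: is_cvg_series_exp_coeff|exact: cvg_cst].
- by apply: integrableZl => //; exact: integrable_abse.
- apply: aeW => y N Dy; rewrite /= lee_fin normrM ler_wpM2r//.
  apply: le_trans (expb y Dy); have /andP[s0 s1] := s01 Dy.
  rewrite /series /=; apply: le_trans (ler_norm_sum _ _ _) _.
  apply: (@le_trans _ _ (series (exp_coeff (`|eta| * s y)) N)).
    rewrite /series /=; apply: ler_sum => q _.
    by rewrite /exp_coeff /= normrM normrX normrM (ger0_norm s0) normfV normr_nat.
  rewrite /expR; apply: nondecreasing_cvgn_le; last exact: is_cvg_series_exp_coeff.
  apply/nondecreasing_seqP => m; rewrite /series /= big_nat_recr//= lerDl.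
  by rewrite exp_coeff_ge0// mulr_ge0.
move=> if_ _ lim; apply: fine_cvg; rewrite fineK; first exact: lim.
exact: integrable_fin_num if_.
Qed.

End exponential_moments.

Section continuous_integral.
Context (R : realType).
Implicit Types (f g F : R -> R) (a b t : R).
Local Notation mu := (@lebesgue_measure R).

Lemma continuous_fD f g : continuous f -> continuous g ->
  continuous (fun u => f u + g u).
Proof. by move=> cf cg x; apply: cvgD; [exact: cf|exact: cg]. Qed.

Lemma continuous_fB f g : continuous f -> continuous g ->
  continuous (fun u => f u - g u).
Proof. by move=> cf cg x; apply: cvgB; [exact: cf|exact: cg]. Qed.

Lemma continuous_fM f g : continuous f -> continuous g ->
  continuous (fun u => f u * g u).
Proof. by move=> cf cg x; apply: cvgM; [exact: cf|exact: cg]. Qed.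

Lemma continuous_fc (a : R) : continuous (fun _ : R => a).
Proof. by move=> x; exact: cvg_cst. Qed.

Lemma continuous_fX f p : continuous f -> continuous (fun u => f u ^+ p).
Proof.
move=> cf; elim: p => [|p IH]; first exact: continuous_fc.
by under eq_fun do rewrite exprS; exact: continuous_fM.
Qed.

Lemma continuous_fexp f : continuous f -> continuous (fun u => expR (f u)).
Proof.
by move=> cf x; apply: (@continuous_comp _ _ _ f expR); [exact: cf|exact: continuous_expR].
Qed.

Lemma continuous_itv_integrable f a b : continuous f ->
  mu.-integrable `[a, b] (EFin \o f).
Proof.
move=> cf; apply: continuous_compact_integrable; first exact: segment_compact.
exact: continuous_subspaceT.
Qed.

(** The fundamental theorem of calculus for a primitive known on the whole
    line. *)
Lemma Rintegral_derivative f F a b : a < b -> continuous f ->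
  (forall t : R, is_derive t 1 F (f t)) ->
  \int[mu]_(t in `[a, b]) f t = F b - F a.
Proof.
move=> ab cf dF; rewrite /Rintegral (@continuous_FTC2 _ f F)//.
- exact: continuous_subspaceT.
- have cF : continuous F.
    by move=> t; apply/differentiable_continuous/derivable1_diffP; exact: ex_derive.
  split.
  + by move=> t _; exact: ex_derive.
  + by apply: cvg_at_right_filter; exact: cF.
  + by apply: cvg_at_left_filter; exact: cF.
- by move=> t _; rewrite derive1E; have d := dF t; rewrite derive_val.
Qed.

Lemma Rintegral_continuous_gt0 f a b t0 : continuous f ->
  (forall t, a <= t <= b -> 0 <= f t) -> a < t0 < b -> 0 < f t0 ->
  0 < \int[mu]_(t in `[a, b]) f t.
Proof.
move=> cf f0 /andP[at0 t0b] ft0.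
have [e e0 he] : exists2 e, 0 < e & forall u, `|t0 - u| < e -> f t0 / 2 < f u.
  have /cvgrPdist_lt := cf t0.
  move=> /(_ (f t0 / 2)); rewrite divr_gt0// => /(_ isT) /nbhs_ballP[e /= e0 he].
  exists e => // u /he /=; rewrite ltr_norml => /andP[_]; lra.
pose c := Num.min (t0 + e / 2) b.
have t0c : t0 < c by rewrite lt_min t0b andbT ltrDl divr_gt0.
have cb : c <= b by rewrite ge_min lexx orbT.
have ce : c < t0 + e.
  by rewrite gt_min ltrD2l; apply/orP; left; lra.
have iind : mu.-integrable `[a, b] (EFin \o (fun t => f t0 / 2 * \1_`[t0, c] t)).
  rewrite (_ : _ \o _ = (fun t => (f t0 / 2)%R%:E * (EFin \o \1_`[t0, c]) t)%E).
    apply: integrableZl => //; apply: (@integrableS _ _ _ _ setT) => //.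
    exact: integrable_indic_itv.
  by apply/funext => y /=; rewrite EFinM.
apply: (@lt_le_trans _ _ (\int[mu]_(t in `[a, b]) (f t0 / 2 * \1_`[t0, c] t))).
  rewrite RintegralZl//; last first.
    apply: (@integrableS _ _ _ _ setT) => //.
    exact: integrable_indic_itv.
  rewrite mulr_gt0 ?divr_gt0// /Rintegral integral_indic// setIidl.
    by rewrite /= lebesgue_measure_itv/= lte_fin t0c -EFinD/= subr_gt0.
  by apply: subset_itvScc; rewrite bnd_simp// ltW.
apply: le_Rintegral => //; first exact: continuous_itv_integrable.
move=> t; rewrite /= in_itv/= => tab; rewrite indicE.
case: (boolP (t \in _)) => [|_]; last by rewrite mulr0 f0.
rewrite inE /= in_itv/= => /andP[t0t tc]; rewrite mulr1 ltW// he//.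
by rewrite ler0_norm ?subr_le0// opprB; lra.
Qed.

End continuous_integral.

(** As for [sphere_bnd], the goal is decomposed along its head symbol. *)
Ltac continuity := first [ assumption |
  lazymatch goal with
  | |- forall y, continuous_at y (fun _ => ?a) => exact: continuous_fc
  | |- forall y, continuous_at y (fun x => @GRing.exp _ (@?f x) ?p) =>
      apply: continuous_fX; continuity
  | |- forall y, continuous_at y (fun x => @?f x - @?g x) =>
      apply: continuous_fB; continuity
  | |- forall y, continuous_at y (fun x => @?f x + @?g x) =>
      apply: continuous_fD; continuity
  | |- forall y, continuous_at y (fun x => @GRing.mul _ (@?f x) (@?g x)) =>
      apply: continuous_fM; continuity
  | |- forall y, continuous_at y (fun x => expR (@?f x)) =>
      apply: continuous_fexp; continuity
  | |- _ => first [exact: continuous_sin | exact: continuous_cos | idtac]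
  end ].

Section theta_integral.
Context (R : realType) (n k : nat) (k0 : (0 < k)%N) (kn : (k < n)%N).
Implicit Types (f g : R -> R) (t eta : R).
Local Notation T := (@theta_int R n k).
Local Notation mu := (@lebesgue_measure R).

Let weight t : R := sin t ^+ (k - 1) * cos t ^+ (n - k - 1).

Let cweight : continuous weight.
Proof. by rewrite /weight; continuity. Qed.

Let pihalf_gt0 : (0 : R) < pi / 2.
Proof. by rewrite divr_gt0// pi_gt0. Qed.

Let iT f : continuous f ->
  mu.-integrable `[0, pi / 2] (EFin \o (fun t => f t * weight t)).
Proof. by move=> cf; apply: continuous_itv_integrable; exact: continuous_fM. Qed.

Lemma theta_intD f g : continuous f -> continuous g ->
  T (fun t => f t + g t) = T f + T g.
Proof.
move=> cf cg; rewrite /theta_int -RintegralD//; [|exact: iT..].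
by apply: eq_Rintegral => t _; rewrite mulrDl.
Qed.

Lemma theta_intZ a f : continuous f -> T (fun t => a * f t) = a * T f.
Proof.
move=> cf; rewrite /theta_int -RintegralZl//; last exact: iT.
by apply: eq_Rintegral => t _; rewrite [RHS]mulrA.
Qed.

Lemma theta_intB f g : continuous f -> continuous g ->
  T (fun t => f t - g t) = T f - T g.
Proof.
move=> cf cg; rewrite /theta_int -RintegralB//; [|exact: iT..].
by apply: eq_Rintegral => t _; rewrite mulrBl.
Qed.

Lemma eq_theta_int f g : (forall t, f t = g t) -> T f = T g.
Proof. by move=> fg; congr (T _); exact/funext. Qed.

Lemma theta_int_gt0 f t0 : continuous f -> (forall t, 0 <= f t) ->
  0 < t0 < pi / 2 -> 0 < f t0 -> 0 < T f.
Proof.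
move=> cf f0 t0b ft0; apply: (@Rintegral_continuous_gt0 _ _ _ _ t0) => //.
- exact: continuous_fM.
- move=> t /andP[t0' tp]; rewrite mulr_ge0// mulr_ge0// exprn_ge0//.
    by apply: sin_ge0_pi; rewrite t0' (le_trans tp)// ler_pdivrMr// ler_peMr// ?pi_ge0// ler1n.
  by apply: cos_ge0_pihalf; rewrite tp andbT (le_trans _ t0')// oppr_le0 ltW.
- have /andP[t00 t0p] := t0b; rewrite mulr_gt0// mulr_gt0// exprn_gt0//.
    exact: sin_gt0_pihalf.
  by apply: cos_gt0_pihalf; rewrite t0p andbT (lt_trans _ t00)// oppr_lt0.
Qed.

Definition theta_moment eta p := T (fun t => expR (eta * sin t ^+ 2) * (sin t ^+ 2) ^+ p).

(** Integrate the derivative of sin^(k + 2p) cos^(n - k) exp (eta sin^2), which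
    vanishes at both ends because 0 < k < n. *)
Lemma theta_moment_rec eta p :
  (n%:R + 2 * p%:R) * theta_moment eta p.+1 - (k%:R + 2 * p%:R) * theta_moment eta p =
  2 * eta * (theta_moment eta p.+1 - theta_moment eta p.+2).
Proof.
pose E t := expR (eta * sin t ^+ 2).
have cE : continuous E by rewrite /E; continuity.
have cM q : continuous (fun t => E t * (sin t ^+ 2) ^+ q) by continuity.
apply/eqP; rewrite -subr_eq0; apply/eqP.
rewrite /theta_moment -!theta_intZ//; [|by continuity..].
rewrite -!theta_intB//; [|by continuity..].
rewrite -!theta_intZ//; [|by continuity..].
rewrite -!theta_intB//; [|by continuity..].
pose F t := - (sin t ^+ (k + 2 * p) * cos t ^+ (n - k) * E t).
transitivity (F (pi / 2) - F 0); last first.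
  rewrite /F cos_pihalf sin0 !expr0n addn_eq0 subn_eq0.
  by rewrite leqNgt kn (gtn_eqF k0) /= !(mul0r, mulr0) oppr0 subr0.
apply: Rintegral_derivative => //; first by continuity.
move=> t.
have d1 := is_derive_fX (k + 2 * p) (is_derive_sin t).
have d2 := is_derive_fX (n - k) (is_derive_cos t).
have d3 := is_derive_fexp (is_derive_fM (is_derive_fc eta t) (is_derive_fX 2 (is_derive_sin t))).
have d4 := is_derive_fM (is_derive_fM d1 d2) d3.
have d5 := is_derive_fB (is_derive_fc 0 t) d4.
rewrite (_ : F = fun t => 0 - sin t ^+ (k + 2 * p) * cos t ^+ (n - k) * E t); last first.
  by apply/funext => u; rewrite sub0r.
apply: is_derive_eq d5 _; rewrite /E.
have [m nk] : exists m, (n - k = m.+1)%N by exists (n - k).-1; rewrite prednK// subn_gt0.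
have nE : n%:R = k%:R + m.+1%:R :> R by rewrite -nk -natrD subnKC// ltnW.
have [l kl] : exists l, k = l.+1 by exists k.-1; rewrite prednK.
rewrite nE nk kl !subn1 /= addSn /= -!exprM.
set e := expR _.
rewrite (_ : (cos t ^+ m.+1) = cos t * cos t ^+ m); last by rewrite exprS.
have c2 : cos t ^+ 2 = 1 - sin t ^+ 2 := cos2sin2 t.
have -> : sin t ^+ (2 * p.+2) = sin t ^+ (2 * p) * sin t ^+ 2 * sin t ^+ 2.
  by rewrite -!exprD; congr (_ ^+ _); rewrite !mulnS; ring.
have -> : sin t ^+ (2 * p.+1) = sin t ^+ (2 * p) * sin t ^+ 2.
  by rewrite -!exprD; congr (_ ^+ _); rewrite !mulnS; ring.
rewrite (_ : sin t ^+ (l + 2 * p).+1 = sin t * (sin t ^+ l * sin t ^+ (2 * p))); last first.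
  by rewrite exprS exprD.
rewrite (_ : (l + 2 * p).+1%:R = l.+1%:R + 2 * p%:R :> R); last first.
  by rewrite -addSn natrD natrM.
rewrite exprD; set S2p := sin t ^+ (2 * p); set Sl := sin t ^+ l; set Cm := cos t ^+ m.
transitivity (e * S2p * Sl * Cm * ((m.+1%:R - 2 * eta * cos t ^+ 2) * sin t ^+ 2
   - (l.+1%:R + 2 * p%:R) * cos t ^+ 2)); first by ring.
by rewrite c2; ring.
Qed.

Lemma theta_moment_gt0 eta p : 0 < theta_moment eta p.
Proof.
have pi4 : 0 < (pi : R) / 4 < (pi : R) / 2.
  by have p0 := pi_gt0 R; apply/andP; split; lra.
apply: (@theta_int_gt0 _ (pi / 4)) => //; first by continuity.
  by move=> t; rewrite mulr_ge0 ?expR_ge0// exprn_ge0// sqr_ge0.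
by rewrite mulr_gt0 ?expR_gt0// !exprn_gt0// sin_gt0_pihalf.
Qed.

End theta_integral.

(** * The law of a partial square norm *)

Section transfer.
Context (R : realType) (n : nat) (B : {set 'I_n}).
Hypotheses (B0 : (0 < #|B|)%N) (Bn : (#|B| < n)%N).
Local Notation S := (@sphere R n).
Local Notation theta := (@theta_moment R n #|B|).

(** The density of the Bingham distribution, not normalized. *)
Definition bingham (eta : R) (x : euclid R n) : R := expR (eta * sqn B x).

Lemma sphere_bounded_bingham eta : sphere_bounded (bingham eta).
Proof. by rewrite /bingham; sphere_bnd. Qed.

Definition bingham_moment (eta : R) p : R :=
  wint (bingham eta) (fun x => sqn B x ^+ p).

Lemma theta_moment_cvg (eta : R) p :
  (\sum_(0 <= q < N) eta ^+ q / q`!%:R * theta 0 (q + p)) @[N --> \oo]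
    --> theta eta p.
Proof.
pose w t : R := (sin t ^+ 2) ^+ p * (sin t ^+ (#|B| - 1) * cos t ^+ (n - #|B| - 1)).
have cw : continuous w by rewrite /w; continuity.
have csin : continuous (fun t : R => sin t ^+ 2) by continuity.
have ms : measurable_fun (`[0, pi / 2]%classic : set (measurableTypeR R)) (fun t => sin t ^+ 2).
  apply: measurable_funTS; exact: continuous_measurable_fun.
have s01 t : `[0, pi / 2]%classic t -> 0 <= (sin t : R) ^+ 2 <= 1.
  move=> _; rewrite sqr_ge0/= -(cos2Dsin2 t) lerDr; exact: sqr_ge0.
have := @exponential_moment_cvg _ _ R (@lebesgue_measure R) `[0, pi / 2]%classic
  (measurable_itv _) (fun t => sin t ^+ 2) w ms s01
  (continuous_itv_integrable 0 (pi / 2) cw) eta.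
rewrite (_ : \int[_]_(y in _) _ = theta eta p); last first.
  by apply: eq_Rintegral => t _; rewrite /w mulrA.
apply: cvg_trans; apply: near_eq_cvg; apply: nearW => N.
apply: eq_bigr => q _; congr (_ * _); apply: eq_Rintegral => t _.
by rewrite mul0r expR0 mul1r /w exprD mulrA.
Qed.

Lemma bingham_moment_cvg (eta : R) p :
  (\sum_(0 <= q < N) eta ^+ q / q`!%:R * sphere_moment R B (q + p)) @[N --> \oo]
    --> bingham_moment eta p.
Proof.
have bs := @sphere_bounded_sqn R n B.
have s01 x : S x -> 0 <= sqn B x <= 1.
  move=> Sx; rewrite sqn_ge0 -subr_ge0 -sqn_sphereC//; exact: sqn_ge0.
have bw : sphere_bounded (fun x : euclid R n => sqn B x ^+ p) by sphere_bnd.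
have := @exponential_moment_cvg _ _ R (@surface_measure R n) S
  (@measurable_sphere R n) (@sqn R n B) (fun x => sqn B x ^+ p)
  (measurable_funTS (sphere_bounded_measurable bs)) s01
  (sphere_bounded_integrable bw) eta.
apply: cvg_trans; apply: near_eq_cvg; apply: nearW => N.
apply: eq_bigr => q _; congr (_ * _); apply: eq_sint => x _.
by rewrite exprD.
Qed.

(** At eta = 0 the two families of moments satisfy the same recursion, so they
    are proportional; the exponential series carries this over to every eta. *)
Lemma bingham_theta : exists2 C : R, 0 < C &
  forall eta p, bingham_moment eta p = C * theta eta p.
Proof.
have n0 : (0 < n)%N by exact: leq_ltn_trans Bn.
have t0 : 0 < theta 0 0 := theta_moment_gt0 _ _ 0 0.
have m0 : 0 < sphere_moment R B 0.
  rewrite /sphere_moment (@eq_sint _ _ _ (fun=> 1)); last by move=> x _; rewrite expr0.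
  exact: sint1_gt0.
pose C := sphere_moment R B 0 / theta 0 0.
have mC p : sphere_moment R B p = C * theta 0 p.
  elim: p => [|p IH]; first by rewrite /C divfK// lt0r_neq0.
  have np : n%:R + 2 * p%:R != 0 :> R.
    by rewrite lt0r_neq0// ltr_pwDl ?ltr0n// mulr_ge0.
  apply: (mulfI np); rewrite sphere_moment_rec// IH.
  have := theta_moment_rec B0 Bn (0 : R) p; rewrite mulr0 mul0r => /eqP.
  by rewrite subr_eq0 => /eqP E; rewrite mulrCA -E mulrCA.
exists C => [|eta p]; first exact: divr_gt0.
have h1 := @bingham_moment_cvg eta p.
have h2 : (\sum_(0 <= q < N) eta ^+ q / q`!%:R * sphere_moment R B (q + p)) @[N --> \oo]
    --> C * theta eta p.
  rewrite (_ : (fun N => _) = (fun N => C * \sum_(0 <= q < N)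
      eta ^+ q / q`!%:R * theta 0 (q + p))); last first.
    apply/funext => N; rewrite mulr_sumr; apply: eq_bigr => q _.
    by rewrite mC mulrCA.
  by apply: cvgM; [exact: cvg_cst|exact: theta_moment_cvg].
exact: (cvg_unique _ h1 h2).
Qed.

Lemma bingham_moment_rec eta p :
  (n%:R + 2 * p%:R) * bingham_moment eta p.+1 - (#|B|%:R + 2 * p%:R) * bingham_moment eta p =
  2 * eta * (bingham_moment eta p.+1 - bingham_moment eta p.+2).
Proof.
have [C C0 mE] := bingham_theta; rewrite !mE.
have := theta_moment_rec B0 Bn eta p => h.
transitivity (C * ((n%:R + 2 * p%:R) * theta eta p.+1
   - (#|B|%:R + 2 * p%:R) * theta eta p)); first by ring.
by rewrite h; ring.
Qed.

(** The two numbers are the integrals of s^2 (1 - s) exp (eta s) and of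
    s (1 - s)^2 exp (eta s). *)
Lemma bingham_beta_gt0 eta :
  0 < bingham_moment eta 2 - bingham_moment eta 3 /\
  0 < bingham_moment eta 1 - 2 * bingham_moment eta 2 + bingham_moment eta 3.
Proof.
have [C C0 mE] := bingham_theta; rewrite !mE.
have p0 := pi_gt0 R.
have pi4 : 0 < (pi : R) / 4 < (pi : R) / 2 by apply/andP; split; lra.
have c4 : 0 < cos ((pi : R) / 4) ^+ 2.
  by apply/exprn_gt0/cos_gt0_pihalf; apply/andP; split; lra.
have s4 : 0 < sin ((pi : R) / 4) ^+ 2 by exact/exprn_gt0/sin_gt0_pihalf.
pose E t : R := expR (eta * sin t ^+ 2).
pose m p t := E t * (sin t ^+ 2) ^+ p.
have cm p : continuous (m p) by rewrite /m /E; continuity.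
have E1 : 0 < theta eta 2 - theta eta 3.
  rewrite -[X in X - _]/(theta_int _ _ (m 2)) -[X in _ - X]/(theta_int _ _ (m 3)).
  rewrite -theta_intB//.
  rewrite (@eq_theta_int _ _ _ _ (fun t => E t * (sin t ^+ 2) ^+ 2 * cos t ^+ 2)); last first.
    by move=> t; rewrite cos2sin2 /m; ring.
  apply: (@theta_int_gt0 _ _ _ _ (pi / 4)) => //; first by rewrite /E; continuity.
    by move=> t; apply: mulr_ge0; [apply: mulr_ge0; [exact: expR_ge0|exact: sqr_ge0]|exact: sqr_ge0].
  by apply: mulr_gt0 => //; apply: mulr_gt0; [exact: expR_gt0|exact: exprn_gt0].
have E2 : 0 < theta eta 1 - 2 * theta eta 2 + theta eta 3.
  rewrite -[X in X - _ + _]/(theta_int _ _ (m 1%N)) -[X in _ - _ * X + _]/(theta_int _ _ (m 2)).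
  rewrite -[X in _ - _ + X]/(theta_int _ _ (m 3)).
  rewrite -theta_intZ// -theta_intB//; last by continuity.
  rewrite -theta_intD//; last by continuity.
  rewrite (@eq_theta_int _ _ _ _ (fun t => E t * sin t ^+ 2 * (cos t ^+ 2) ^+ 2)); last first.
    by move=> t; rewrite cos2sin2 /m; ring.
  apply: (@theta_int_gt0 _ _ _ _ (pi / 4)) => //; first by rewrite /E; continuity.
    by move=> t; apply: mulr_ge0; [apply: mulr_ge0; [exact: expR_ge0|exact: sqr_ge0]|exact: sqr_ge0].
  by apply: mulr_gt0; [apply: mulr_gt0 => //; exact: expR_gt0|exact: exprn_gt0].
split; first by rewrite -mulrBr mulr_gt0.
rewrite (_ : _ + _ = C * (theta eta 1 - 2 * theta eta 2 + theta eta 3)); last by ring.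
exact: mulr_gt0.
Qed.

Lemma sigma_kE eta :
  [/\ 0 < bingham_moment eta 0, 0 < bingham_moment eta 1 - bingham_moment eta 2 &
  sigma_k n #|B| eta = (n - #|B|)%:R * #|B|%:R * bingham_moment eta 0 /
    (2 * (bingham_moment eta 1 - bingham_moment eta 2))].
Proof.
have [C C0 mE] := bingham_theta; rewrite !mE.
have E1 : theta_int n #|B| (fun t => expR (eta * sin t ^+ 2)) = theta eta 0.
  by apply: eq_theta_int => t; rewrite expr0 mulr1.
have E2 : theta_int n #|B| (fun t => expR (eta * sin t ^+ 2) * sin t ^+ 2 * cos t ^+ 2) =
    theta eta 1 - theta eta 2.
  rewrite /theta_moment -theta_intB; [|by continuity..].
  by apply: eq_theta_int => t; rewrite cos2sin2; ring.
have t0 : 0 < theta eta 0 := theta_moment_gt0 _ _ _ _.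
have t12 : 0 < theta eta 1 - theta eta 2.
  rewrite -E2; have p0 := pi_gt0 R.
  have pi4 : 0 < (pi : R) / 4 < (pi : R) / 2 by apply/andP; split; lra.
  apply: (@theta_int_gt0 _ _ _ _ (pi / 4)) => //; first by continuity.
    by move=> t; rewrite mulr_ge0 ?sqr_ge0// mulr_ge0 ?expR_ge0 ?sqr_ge0.
  apply: mulr_gt0; last first.
    by apply/exprn_gt0/cos_gt0_pihalf; apply/andP; split; lra.
  by apply: mulr_gt0; [exact: expR_gt0|exact/exprn_gt0/sin_gt0_pihalf].
split; [exact: mulr_gt0|by rewrite -mulrBr mulr_gt0|].
rewrite /sigma_k E1 E2; field.
by rewrite -mulrBr mulf_neq0 ?lt0r_neq0.
Qed.

End transfer.

(** * The covariance of s and s (1 - s) changes sign once *)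

Section secant.
Context (R : realType).
Implicit Types (a b c d r s : R).

(** Strict convexity, from the tangent at the middle point. *)
Lemma expR_convex3 d a b c : d != 0 -> a < b < c ->
  (c - a) * expR (d * b) < (c - b) * expR (d * a) + (b - a) * expR (d * c).
Proof.
move=> d0 /andP[ab bc].
have Ea : expR (d * a) = expR (d * b) * expR (d * (a - b)).
  by rewrite -expRD; congr expR; ring.
have Ec : expR (d * c) = expR (d * b) * expR (d * (c - b)).
  by rewrite -expRD; congr expR; ring.
have h1 : 1 + d * (a - b) < expR (d * (a - b)).
  by apply: expR_gt1Dx; rewrite mulf_neq0// subr_eq0 lt_eqF.
have h2 : 1 + d * (c - b) < expR (d * (c - b)).
  by apply: expR_gt1Dx; rewrite mulf_neq0// subr_eq0 gt_eqF.
rewrite Ea Ec !(mulrCA _ (expR (d * b))) -mulrDr [ltLHS]mulrC ltr_pM2l ?expR_gt0//.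
have h3 : 0 < (c - b) * (expR (d * (a - b)) - (1 + d * (a - b))).
  by rewrite mulr_gt0// subr_gt0.
have h4 : 0 < (b - a) * (expR (d * (c - b)) - (1 + d * (c - b))).
  by rewrite mulr_gt0// subr_gt0.
by lra.
Qed.

(** The secant of a strictly convex function lies above it between the two nodes
    and below it outside, and (s - r1) (r2 - s) has the same signs. *)
Lemma secant_gt0 d r1 r2 s : d != 0 -> r1 < r2 -> s != r1 -> s != r2 ->
  0 < (s - r1) * (r2 - s) *
    ((r2 - s) * expR (d * r1) + (s - r1) * expR (d * r2)
      - (r2 - r1) * expR (d * s)).
Proof.
move=> d0 r12 sr1 sr2.
have [s1|s1|/eqP] := ltgtP s r1; last by rewrite (negPf sr1).
  have := @expR_convex3 d s r1 r2 d0; rewrite s1 r12 => /(_ isT) h.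
  by rewrite nmulr_rgt0; [lra|rewrite nmulr_rlt0; lra].
have [s2|s2|/eqP] := ltgtP s r2; last by rewrite (negPf sr2).
  have := @expR_convex3 d r1 s r2 d0; rewrite s1 s2 => /(_ isT) h.
  by rewrite pmulr_rgt0; [lra|rewrite pmulr_rgt0; lra].
have := @expR_convex3 d r1 r2 s d0; rewrite s2 r12 => /(_ isT) h.
by rewrite nmulr_rgt0; [lra|rewrite pmulr_rlt0; lra].
Qed.

End secant.

Section unimodality.
Context (R : realType) (n k : nat) (k0 : (0 < k)%N) (kn : (k < n)%N).
Local Notation T := (@theta_int R n k).
Local Notation theta := (@theta_moment R n k).
Implicit Types (eta d c : R).

Let pi4 : 0 < (pi : R) / 4 < (pi : R) / 2.
Proof. by have p0 := pi_gt0 R; apply/andP; split; lra. Qed.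

Let pi8 : 0 < (pi : R) / 8 < (pi : R) / 2.
Proof. by have p0 := pi_gt0 R; apply/andP; split; lra. Qed.

Let cos2x (t : R) : cos (t + t) = 1 - 2 * sin t ^+ 2.
Proof. by rewrite cosD -!expr2 cos2sin2; ring. Qed.

Let sin2_pi4 : sin ((pi : R) / 4) ^+ 2 = 1 / 2.
Proof.
have := cos2x (pi / 4); rewrite (_ : pi / 4 + pi / 4 = pi / 2); last by field.
by rewrite cos_pihalf; lra.
Qed.

Let sin2_pi8 : sin ((pi : R) / 8) ^+ 2 < 1 / 2.
Proof.
have := cos2x (pi / 8); rewrite (_ : pi / 8 + pi / 8 = pi / 4); last by field.
have : 0 < cos ((pi : R) / 4).
  by apply: cos_gt0_pihalf; have p0 := pi_gt0 R; apply/andP; split; lra.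
by lra.
Qed.

(** The covariance of s and s (1 - s), times the square of the total mass. *)
Definition theta_cov eta : R :=
  theta eta 0 * (theta eta 2 - theta eta 3) - theta eta 1 * (theta eta 1 - theta eta 2).

(** The mean of (s - 1/2)^2 is positive. *)
Lemma theta_ratio_lt eta : (theta eta 1 - theta eta 2) / theta eta 0 < 1 / 4.
Proof.
rewrite ltr_pdivrMr ?theta_moment_gt0//.
pose E t : R := expR (eta * sin t ^+ 2).
have : 0 < T (fun t => E t * (sin t ^+ 2 - 1 / 2) ^+ 2).
  (* any point where s differs from 1 / 2 would do *)
  apply: (@theta_int_gt0 _ _ _ _ (pi / 8)) => //; first by rewrite /E; continuity.
    by move=> t; rewrite mulr_ge0 ?expR_ge0// sqr_ge0.
  by rewrite mulr_gt0 ?expR_gt0// exprn_even_gt0//= subr_eq0 lt_eqF.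
rewrite (@eq_theta_int _ _ _ _ (fun t => E t * (sin t ^+ 2) ^+ 2 - E t * (sin t ^+ 2) ^+ 1
    + 1 / 4 * (E t * (sin t ^+ 2) ^+ 0))); last by move=> t; rewrite /E; field.
rewrite theta_intD; [|by rewrite /E; continuity..].
rewrite theta_intB; [|by rewrite /E; continuity..].
rewrite theta_intZ; [|by rewrite /E; continuity..].
rewrite -/(theta eta 0) -/(theta eta 1) -/(theta eta 2); lra.
Qed.

(** Let c be the mean of s (1 - s) at eta, so that s (1 - s) - c has mean zero and
    two real roots.  By [secant_gt0] its integral against exp ((eta + d) s) is
    smaller than the one obtained when exp (d s) is replaced by its secant
    through the roots, and that is the slope of the secant, which has the sign
    of d, times the covariance. *)
Lemma theta_ratio_secant eta d : d != 0 -> d * theta_cov eta <= 0 ->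
  (theta (eta + d) 1 - theta (eta + d) 2) / theta (eta + d) 0 <
  (theta eta 1 - theta eta 2) / theta eta 0.
Proof.
move=> d0 dcov; set c := (X in _ < X).
rewrite ltr_pdivrMr ?theta_moment_gt0//.
have c4 : c < 1 / 4 := theta_ratio_lt eta.
have t0 : 0 < theta eta 0 := theta_moment_gt0 _ _ _ _.
have cE : theta eta 1 - theta eta 2 - c * theta eta 0 = 0.
  by rewrite /c divfK ?subrr// lt0r_neq0.
have covE : theta_cov eta = theta eta 0 * (theta eta 2 - theta eta 3 - c * theta eta 1).
  rewrite /theta_cov (_ : theta eta 1 - theta eta 2 = c * theta eta 0); first by ring.
  by apply/eqP; rewrite -subr_eq0 cE.
move: dcov; rewrite covE mulrCA pmulr_rle0// => dk.
set kap := theta eta 2 - _ - _ in dk.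
(* r1 and r2 are the roots of s (1 - s) - c. *)
pose D := Num.sqrt (1 - 4 * c).
have D0 : 0 < D by rewrite sqrtr_gt0; lra.
have DD : D ^+ 2 = 1 - 4 * c by rewrite sqr_sqrtr//; lra.
pose r1 := (1 - D) / 2; pose r2 := (1 + D) / 2.
have r12 : r1 < r2 by rewrite /r1 /r2; lra.
have rs : r1 + r2 = 1 by rewrite /r1 /r2; field.
have rp : r1 * r2 = c.
  transitivity ((1 - D ^+ 2) / 4); first by rewrite /r1 /r2; field.
  by rewrite DD; field.
pose A1 := expR (d * r1); pose A2 := expR (d * r2).
pose G s := (s - r1) * (r2 - s) *
    ((r2 - s) * A1 + (s - r1) * A2 - (r2 - r1) * expR (d * s)).
have G0 s : 0 <= G s.
  have [->|s1] := eqVneq s r1; first by rewrite /G subrr !mul0r.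
  have [->|s2] := eqVneq s r2; first by rewrite /G subrr mulr0 !mul0r.
  by apply: ltW; exact: secant_gt0.
pose E e t : R := expR (e * sin t ^+ 2).
pose m e p t := E e t * (sin t ^+ 2) ^+ p.
have cm e p : continuous (m e p) by rewrite /m /E; continuity.
have : 0 < T (fun t => E eta t * G (sin t ^+ 2)).
  (* the roots are symmetric about 1 / 2, the value of s at pi / 4 *)
  apply: (@theta_int_gt0 _ _ _ _ (pi / 4)) => //.
  - by rewrite /E /G; continuity.
  - by move=> t; rewrite mulr_ge0 ?expR_ge0.
  - rewrite mulr_gt0 ?expR_gt0// sin2_pi4; apply: secant_gt0 => //.
      by rewrite /r1; apply/eqP => h; move: D0; lra.
    by rewrite /r2; apply/eqP => h; move: D0; lra.
have qE s : (s - r1) * (r2 - s) = s - s ^+ 2 - c.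
  by rewrite -rp (_ : r2 = 1 - r1); [ring|lra].
rewrite (@eq_theta_int _ _ _ _ (fun t =>
     (r2 * A1 - r1 * A2) * (m eta 1%N t - m eta 2%N t - c * m eta 0%N t)
     + ((A2 - A1) * (m eta 2%N t - m eta 3%N t - c * m eta 1%N t)
     - (r2 - r1) * (m (eta + d) 1%N t - m (eta + d) 2%N t - c * m (eta + d) 0%N t)))); last first.
  move=> t; rewrite /G qE /m /E [(eta + d) * _]mulrDl expRD; ring.
rewrite theta_intD; [|by continuity..].
rewrite theta_intB; [|by continuity..].
rewrite !theta_intZ; [|by continuity..].
rewrite !theta_intB; [|by continuity..].
rewrite !theta_intZ; [|by continuity..].
rewrite -![T (m _ _)]/(theta _ _) cE -/kap mulr0 add0r.
set u := theta (eta + d) 1; set v := theta (eta + d) 2; set w := theta (eta + d) 0.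
have kA : (A2 - A1) * kap <= 0.
  have [dn|dp|/eqP] := ltgtP d 0; last by rewrite (negPf d0).
    have A12 : A2 - A1 <= 0.
      by rewrite subr_le0 ler_expR ler_nM2l// ltW.
    by rewrite mulr_le0_ge0// -(nmulr_rle0 _ dn).
  have A12 : 0 <= A2 - A1 by rewrite subr_ge0 ler_expR ler_pM2l// ltW.
  by rewrite mulr_ge0_le0// -(pmulr_rle0 _ dp).
move=> h; have : (r2 - r1) * (u - v - c * w) < 0 by lra.
rewrite pmulr_rlt0 ?subr_gt0//; lra.
Qed.

End unimodality.

(** * Stability of the densities h *)

Section frobenius.
Context (R : realType) (n : nat).
Implicit Types (M Q : 'M[R]_n) (x : euclid R n).

Lemma quadE M x : quad M x = dotp x (mxact M x).
Proof.
rewrite /quad /dotp; apply: eq_bigr => i _; rewrite coor_mxact mulr_sumr.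
by apply: eq_bigr => j _; rewrite mulrCA.
Qed.

Lemma frobE M : frob M = \tr (M *m M^T).
Proof.
by apply: eq_bigr => i _; rewrite mxE; apply: eq_bigr => j _; rewrite mxE expr2.
Qed.

Lemma quad_conj Q M x : orthogonal_mx Q ->
  quad (Q *m M *m Q^T) (mxact Q x) = quad M x.
Proof.
move=> QQ; rewrite !quadE dotp_mxact !mxactM.
by rewrite -!mulmxA (mulmx1C QQ) mulmx1 !mulmxA (mulmx1C QQ) mul1mx.
Qed.

Lemma frob_conj Q M : orthogonal_mx Q -> frob (Q *m M *m Q^T) = frob M.
Proof.
move=> QQ; rewrite !frobE !trmx_mul trmxK !mulmxA -[_ *m Q^T *m Q]mulmxA.
by rewrite (mulmx1C QQ) mulmx1 mxtrace_mulC !mulmxA (mulmx1C QQ) mul1mx.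
Qed.

Lemma trace_conj Q M : orthogonal_mx Q -> \tr (Q *m M *m Q^T) = \tr M.
Proof. by move=> QQ; rewrite mxtrace_mulC mulmxA (mulmx1C QQ) mul1mx. Qed.

Lemma sym_conj Q M : M^T = M -> (Q *m M *m Q^T)^T = Q *m M *m Q^T.
Proof. by move=> MT; rewrite !trmx_mul trmxK MT mulmxA. Qed.

Lemma orthogonal_tr Q : orthogonal_mx Q -> orthogonal_mx Q^T.
Proof. by move=> QQ; rewrite /orthogonal_mx trmxK (mulmx1C QQ). Qed.

End frobenius.

Section bingham_stability.
Context (R : realType) (n : nat) (n0 : (0 < n)%N).
Implicit Types (k : nat) (eta alpha : R) (Q M : 'M[R]_n) (x : euclid R n).

Definition headset k : {set 'I_n} := [set i : 'I_n | (i < k)%N].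

Lemma card_headset k : (k <= n)%N -> #|headset k| = k.
Proof.
move=> kn.
have inj : injective (widen_ord kn) by move=> a b /(congr1 val)/= ab; exact/val_inj.
rewrite -[RHS](card_ord k) -(card_imset _ inj).
apply: eq_card => i; rewrite inE; apply/idP/imsetP => [ik|[j _ ->]] /=.
  by exists (Ordinal ik) => //; exact/val_inj.
exact: ltn_ord.
Qed.

Lemma enorm_proj_first k x : enorm (proj_first k x) ^+ 2 = sqn (headset k) x.
Proof.
rewrite sqr_enorm /dotp /sqn [RHS]big_mkcond; apply: eq_bigr => i _.
rewrite inE /coor tnth_mktuple; case: ifP => _; last by rewrite mulr0.
by rewrite expr2.
Qed.

Lemma bingham_isometry k eta Q (F : euclid R n -> R) :
  orthogonal_mx Q -> sphere_bounded F ->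
  sint (fun x => bingham (headset k) eta (mxact Q x) * F (mxact Q x)) =
  wint (bingham (headset k) eta) F.
Proof.
move=> QQ bF.
pose G x := bingham (headset k) eta x * F x.
apply: (@sint_isometry _ _ _ G n0 (mxact_isometry QQ)).
apply: sphere_boundedM => //; exact: sphere_bounded_bingham.
Qed.

Lemma h_kE k eta Q : orthogonal_mx Q -> h_k k eta Q =
  fun x => bingham (headset k) eta (mxact Q x) / bingham_moment (headset k) eta 0.
Proof.
move=> QQ; apply/funext => x; rewrite /h_k enorm_proj_first; congr (_ / _).
rewrite /bingham_moment -(@bingham_isometry _ _ Q)//; last by sphere_bnd.
by apply: eq_sint => y _; rewrite enorm_proj_first expr0 mulr1.
Qed.

Lemma bingham_moment0_gt0 k eta : 0 < bingham_moment (headset k) eta 0.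
Proof.
have [C bC] := sphere_boundedP (sphere_bounded_bingham (headset k) (- eta)).
have [y Sy] : exists y, @sphere R n y.
  apply/not_existsP => h; have := surface_sphere_gt0 R n0.
  rewrite (_ : @sphere R n = set0) ?measure0 ?ltxx//.
  by apply/seteqP; split=> // y Sy; exact: (h y).
have C0 : 0 < C by apply: lt_le_trans (bC y Sy); rewrite normr_gt0 gt_eqF// expR_gt0.
apply: (@sint_gt0 _ _ _ C^-1) => //.
- apply: sphere_bounded_integrable; apply: sphere_boundedM.
    exact: sphere_bounded_bingham.
  by sphere_bnd.
- by rewrite invr_gt0.
move=> x Sx; rewrite expr0 mulr1 -[leRHS]invrK lef_pV2 ?posrE// ?invr_gt0 ?expR_gt0//.
rewrite /bingham -expRN -mulNr.
by apply: le_trans (bC x Sx); rewrite ler_norm.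
Qed.

(** Conjugation by Q preserves symmetry, trace and norm, so the criterion does not
    see Q. *)
Lemma stable_bingham k eta Q alpha : 0 < alpha -> orthogonal_mx Q ->
  stable alpha (h_k k eta Q) <->
  (forall M (c : R), M^T = M -> \tr M = 0 ->
    wint (bingham (headset k) eta) (fun x => quad M x - c) = 0 ->
    alpha * wint (bingham (headset k) eta) (fun x => (quad M x - c) ^+ 2) <=
    bingham_moment (headset k) eta 0 * frob M).
Proof.
move=> a0 QQ; rewrite h_kE//.
set Z := bingham_moment _ _ _; have Z0 : 0 < Z := bingham_moment0_gt0 _ _.
set B := headset k.
have iQ := mxact_isometry QQ.
have comp (F : euclid R n -> R) : sphere_bounded F ->
    sphere_bounded (fun x => F (mxact Q x)).
  move=> [mF [C FC]]; split; first exact: (measurableT_comp mF (measurable_isometry iQ)).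
  by exists C => x Sx; apply: FC; rewrite /sphere/= (isometry_enorm iQ).
pose f x := bingham B eta (mxact Q x) / Z.
pose g x := Z * bingham B (- eta) (mxact Q x).
have bf : sphere_bounded f.
  apply: sphere_boundedM (sphere_bounded_cst _ _); apply: comp.
  exact: sphere_bounded_bingham.
have bg : sphere_bounded g.
  by apply/sphere_boundedZ/comp/sphere_bounded_bingham.
have f0 x : sphere x -> 0 < f x by move=> _; rewrite divr_gt0// expR_gt0.
have fg x : sphere x -> f x * g x = 1.
  move=> _; rewrite /f /g /bingham mulNr expRN; field.
  by rewrite gt_eqF ?expR_gt0//= gt_eqF.
have bq M (c : R) : sphere_bounded (fun x => quad M x - c).
  by apply: sphere_boundedB (sphere_bounded_cst _ _); exact: sphere_bounded_quad.
have fint (F : euclid R n -> R) : sphere_bounded F ->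
    sint (fun x => f x * F (mxact Q x)) = wint (bingham B eta) F / Z.
  move=> bF; rewrite -(bingham_isometry k eta QQ bF) mulrC -sintZ; last first.
    apply: sphere_bounded_integrable.
    by apply: sphere_boundedM; apply: comp => //; exact: sphere_bounded_bingham.
  by apply: eq_sint => x _; rewrite /f; ring.
have [crit1 crit2] := stable_quad n0 a0 bf bg f0 fg.
split=> [/crit1 crit M c MT Mtr Mc|crit].
  pose N := Q^T *m M *m Q^T^T.
  have NM : Q *m N *m Q^T = M.
    by rewrite /N trmxK !mulmxA QQ mul1mx -mulmxA QQ mulmx1.
  have qN x : quad N x = quad M (mxact Q x) by rewrite -NM quad_conj.
  have QT := orthogonal_tr QQ.
  have := crit N c; rewrite sym_conj// trace_conj// frob_conj// => /(_ erefl Mtr).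
  rewrite (@eq_sint _ _ _ (fun x => f x * (quad M (mxact Q x) - c))); last first.
    by move=> x _; rewrite qN.
  rewrite (fint (fun y => quad M y - c))// Mc mul0r => /(_ erefl).
  rewrite (@eq_sint _ _ _ (fun x => f x * (quad M (mxact Q x) - c) ^+ 2)); last first.
    by move=> x _; rewrite qN.
  rewrite (fint (fun y => (quad M y - c) ^+ 2)); last exact: sphere_boundedX.
  by rewrite mulrA ler_pdivrMr// [frob M * Z]mulrC.
apply/crit2 => M c MT Mtr Mc.
pose N := Q *m M *m Q^T.
have qN x : quad M x = quad N (mxact Q x) by rewrite quad_conj.
have := crit N c; rewrite sym_conj// trace_conj// frob_conj// => /(_ erefl Mtr).
have -> : wint (bingham B eta) (fun x => quad N x - c) = 0.
  apply: (mulIf (invr_neq0 (lt0r_neq0 Z0))); rewrite mul0r -fint// -Mc.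
  by apply: eq_sint => x _; rewrite qN.
move=> /(_ erefl); rewrite [leRHS]mulrC -ler_pdivrMr// -mulrA -fint; last first.
  exact: sphere_boundedX.
apply: le_trans; rewrite le_eqVlt; apply/orP; left; apply/eqP; congr (_ * _).
by apply: eq_sint => x _; rewrite qN.
Qed.

Lemma bingham_refl k eta i j (c s : R) x :
  i != j -> (i \in headset k) = (j \in headset k) -> c ^+ 2 + s ^+ 2 = 1 ->
  bingham (headset k) eta (refl i j c s x) = bingham (headset k) eta x.
Proof. by move=> ij ijB cs; rewrite /bingham sqn_refl. Qed.

Definition swap_mx i j : 'M[R]_n := delta_mx i j + delta_mx j i.

Lemma swap_mx_sym i j : (swap_mx i j)^T = swap_mx i j.
Proof. by rewrite /swap_mx linearD /= !trmx_delta addrC. Qed.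

Lemma quadB_full M x : quad M x = quadB [set: 'I_n] M x.
Proof.
apply: eq_big => [i|i _]; first by rewrite inE.
by apply: eq_bigl => j; rewrite inE.
Qed.

Lemma quadB_support (C : {set 'I_n}) M :
  (forall i j, (i \notin C) || (j \notin C) -> M i j = 0) ->
  (forall x, quad M x = quadB C M x) /\
  frob M = \sum_(i in C) \sum_(j in C) M i j ^+ 2.
Proof.
move=> M0; split=> [x|].
  rewrite /quadB [RHS]big_mkcond; apply: eq_bigr => i _; case: ifPn => iC.
    rewrite [RHS]big_mkcond; apply: eq_bigr => j _; case: ifPn => // jC.
    by rewrite M0 ?jC ?orbT// mul0r.
  by rewrite big1// => j _; rewrite M0 ?iC// mul0r.
rewrite /frob [RHS]big_mkcond; apply: eq_bigr => i _; case: ifPn => iC.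
  rewrite [RHS]big_mkcond; apply: eq_bigr => j _; case: ifPn => // jC.
  by rewrite M0 ?jC ?orbT// expr0n.
by rewrite big1// => j _; rewrite M0 ?iC// expr0n.
Qed.

(** The test matrix is E_ij + E_ji with both indices in the block. *)
Lemma stable_block k eta Q alpha (C : {set 'I_n}) : 0 < alpha ->
  orthogonal_mx Q -> (1 < #|C|)%N ->
  (forall i j (c s : R) x, i \in C -> j \in C -> i != j -> c ^+ 2 + s ^+ 2 = 1 ->
     bingham (headset k) eta (refl i j c s x) = bingham (headset k) eta x) ->
  stable alpha (h_k k eta Q) ->
  2 * alpha * kurt C (bingham (headset k) eta) <= bingham_moment (headset k) eta 0.
Proof.
move=> a0 QQ C1 Winv /(stable_bingham _ _ a0 QQ) crit.
have bW := sphere_bounded_bingham (headset k) eta.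
have [i [j [iC jC ij]]] : exists i j, [/\ i \in C, j \in C & i != j].
  by have /card_gt1P[i [j [iC jC ij]]] := C1; exists i, j.
pose M := swap_mx i j.
have M0 a b : (a \notin C) || (b \notin C) -> M a b = 0.
  rewrite !mxE => abC.
  have -> : (a == i) && (b == j) = false.
    by apply/negP => /andP[/eqP ai /eqP bj]; move: abC; rewrite ai bj iC jC.
  have -> : (a == j) && (b == i) = false.
    by apply/negP => /andP[/eqP ai /eqP bj]; move: abC; rewrite ai bj iC jC.
  by rewrite addr0.
have Md a : M a a = 0.
  rewrite !mxE; have [->|_] := eqVneq a i; first by rewrite (negPf ij) addr0.
  by rewrite andbF addr0.
have Mtr : \tr M = 0 by rewrite /mxtrace big1.
have MtrC : \sum_(a in C) M a a = 0 by rewrite big1.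
have Mpos : 0 < frob M.
  rewrite /frob (bigD1 i)//= (bigD1 j)//= ltr_pwDl//.
    apply: ltr_pwDl; last by apply: sumr_ge0 => b _; exact: sqr_ge0.
    by rewrite !mxE !eqxx (negPf ij) /= addr0 expr1n.
  by apply: sumr_ge0 => a _; apply: sumr_ge0 => b _; exact: sqr_ge0.
have [E FE] := quadB_support M0.
have := crit M 0 (swap_mx_sym i j) Mtr.
rewrite (@eq_wint _ _ _ _ (quadB C M)); last by move=> x _; rewrite subr0 E.
rewrite (block_quad_mean n0 C1 bW Winv)// => /(_ erefl).
rewrite (@eq_wint _ _ _ _ (fun x => quadB C M x ^+ 2)); last by move=> x _; rewrite subr0 E.
rewrite (block_quad_sq n0 C1 bW Winv (swap_mx_sym i j) MtrC).
by rewrite -FE mulrA ler_pM2r// mulrA [alpha * 2]mulrC.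
Qed.

End bingham_stability.

(** * The isotropic density *)

Section isotropic.
Context (R : realType) (n : nat) (n3 : (3 <= n)%N).

Let n0 : (0 < n)%N := leq_trans (isT : (1 <= 3)%N) n3.

Lemma orthogonal1 : orthogonal_mx (1%:M : 'M[R]_n).
Proof. by rewrite /orthogonal_mx trmx1 mulmx1. Qed.

Lemma h_isoE : @h_iso R n = h_k 1 0 1%:M.
Proof.
apply/funext => x; rewrite /h_iso /h_k mul0r expR0 div1r; congr (_^-1).
rewrite -[LHS]mul1r -Rintegral_cst; last exact: measurable_sphere.
by apply: eq_sint => y _; rewrite mul0r expR0.
Qed.

Lemma bingham0 B x : @bingham R n B 0 x = 1.
Proof. by rewrite /bingham mul0r expR0. Qed.

Lemma kurt_isotropic : kurt [set: 'I_n]%SET (@bingham R n (headset n 1) 0) =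
  bingham_moment (headset n 1) 0 0 / (n * (n + 2))%:R.
Proof.
rewrite /kurt cardsT card_ord; congr (_ / _); apply: eq_wint => x Sx.
by rewrite -dotp_sqn -sqr_enorm (_ : enorm x = 1) ?expr1n// expr0.
Qed.

(** Both directions read off the same identity, since the variance of m . M m is
    the same multiple of |M|^2 for all M. *)
Lemma isotropic_stable (alpha : R) : 0 < alpha ->
  stable alpha (@h_iso R n) <-> alpha <= (n * (n + 2))%:R / 2.
Proof.
move=> a0; rewrite h_isoE.
have Z0 := @bingham_moment0_gt0 R n n0 1 0.
have nn : 0 < (n * (n + 2))%:R :> R by rewrite ltr0n muln_gt0 n0 addn2.
have C1 : (1 < #|[set: 'I_n]%SET|)%N by rewrite cardsT card_ord (leq_trans _ n3).
have bW := sphere_bounded_bingham (headset n 1) (0 : R).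
have Winv i j (c s : R) (x : euclid R n) : i \in [set: 'I_n]%SET -> j \in [set: 'I_n]%SET ->
    i != j -> c ^+ 2 + s ^+ 2 = 1 ->
    bingham (headset n 1) 0 (refl i j c s x) = bingham (headset n 1) 0 x.
  by move=> *; rewrite !bingham0.
split=> [/(stable_block n0 a0 orthogonal1 C1 Winv)|an].
  rewrite kurt_isotropic mulrCA ger_pMr// ler_pdivrMr//.
  by rewrite ler_pdivlMr// mul1r [alpha * 2]mulrC.
apply/(stable_bingham n0 _ _ a0 orthogonal1) => M c MT Mtr Mc.
have MtrC : \sum_(a in [set: 'I_n]%SET) M a a = 0.
  by rewrite -[RHS]Mtr; apply: eq_bigl => a; rewrite inE.
have Mmean := block_quad_mean n0 C1 bW Winv MtrC.
have c0 : c = 0.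
  move: Mc; rewrite wintB//; last 2 first.
  - exact: sphere_bounded_quad.
  - exact: sphere_bounded_cst.
  rewrite (@eq_wint _ _ _ (quad M) (quadB [set: 'I_n]%SET M)); last first.
    by move=> x _; rewrite quadB_full.
  rewrite Mmean (@eq_wint _ _ _ (fun=> c) (fun x => c * sqn (headset n 1) x ^+ 0)); last first.
    by move=> x _; rewrite expr0 mulr1.
  rewrite wintZ//; last by sphere_bnd.
  rewrite sub0r -[wint _ _]/(bingham_moment (headset n 1) 0 0).
  by move/eqP; rewrite oppr_eq0 mulf_eq0 (gt_eqF Z0) orbF => /eqP.
rewrite (@eq_wint _ _ _ _ (fun x => quadB [set: 'I_n]%SET M x ^+ 2)); last first.
  by move=> x _; rewrite c0 subr0 quadB_full.
rewrite (block_quad_sq n0 C1 bW Winv MT MtrC) kurt_isotropic.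
have -> : \sum_(i in [set: 'I_n]%SET) \sum_(j in [set: 'I_n]%SET) M i j ^+ 2 = frob M.
  apply: eq_big => [i|i _]; first by rewrite inE.
  by apply: eq_bigl => j; rewrite inE.
rewrite mulrA ler_wpM2r ?frob_ge0// mulrA mulrCA ger_pMr// ler_pdivrMr// mul1r.
by move: an; rewrite ler_pdivlMr.
Qed.

End isotropic.

(** * Instability along a block *)

Section block_instability.
Context (R : realType) (n k : nat) (k0 : (0 < k)%N) (kn : (k < n)%N).
Implicit Types (eta : R) (Q : 'M[R]_n).
Local Notation B := (headset n k).
Local Notation b := (@bingham_moment R n B).

Let n0 : (0 < n)%N := leq_ltn_trans (leq0n k) kn.
Let cB : #|B| = k := card_headset (ltnW kn).
Let B0 : (0 < #|B|)%N. Proof. by rewrite cB. Qed.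
Let Bn : (#|B| < n)%N. Proof. by rewrite cB. Qed.

Lemma sigma_k_bingham eta : sigma_k n k eta =
  (n%:R - k%:R) * k%:R * b eta 0 / (2 * (b eta 1 - b eta 2)).
Proof. by have [_ _] := sigma_kE B0 Bn eta; rewrite cB natrB// ltnW. Qed.

Lemma bingham_moment12_gt0 eta : 0 < b eta 1 - b eta 2.
Proof. by have [] := sigma_kE B0 Bn eta. Qed.

Lemma sigma_k_gt0 eta : 0 < sigma_k n k eta.
Proof.
rewrite sigma_k_bingham divr_gt0//; last by rewrite mulr_gt0// bingham_moment12_gt0.
by rewrite !mulr_gt0 ?subr_gt0 ?ltr_nat ?ltr0n// bingham_moment0_gt0.
Qed.

Lemma bingham_rec eta p :
  (n%:R + 2 * p%:R) * b eta p.+1 - (k%:R + 2 * p%:R) * b eta p =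
  2 * eta * (b eta p.+1 - b eta p.+2).
Proof. by have := bingham_moment_rec B0 Bn eta p; rewrite cB. Qed.

Lemma bingham_inv_head eta i j (c s : R) x : i \in B -> j \in B -> i != j ->
  c ^+ 2 + s ^+ 2 = 1 -> bingham B eta (refl i j c s x) = bingham B eta x.
Proof. by move=> iB jB ij cs; apply: bingham_refl; rewrite ?iB ?jB. Qed.

Lemma bingham_inv_tail eta i j (c s : R) x : i \in ~: B -> j \in ~: B -> i != j ->
  c ^+ 2 + s ^+ 2 = 1 -> bingham B eta (refl i j c s x) = bingham B eta x.
Proof.
rewrite !finset.in_setC => iB jB ij cs.
by apply: bingham_refl; rewrite // (negPf iB) (negPf jB).
Qed.

(** The inequality of [stable_block] is (n - k) b_2 <= (k + 2) (b_1 - b_2), and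
    integration by parts makes the difference of its sides
    2 eta (b_2 - b_3). *)
Lemma stable_head_le0 eta Q : (1 < k)%N -> orthogonal_mx Q ->
  stable (sigma_k n k eta) (h_k k eta Q) -> eta <= 0.
Proof.
move=> k1 QQ; have C1 : (1 < #|B|)%N by rewrite cB.
move/(stable_block n0 (sigma_k_gt0 eta) QQ C1 (@bingham_inv_head eta)).
rewrite /kurt -/(b eta 2) cB sigma_k_bingham => h.
have [b23 _] := bingham_beta_gt0 B0 Bn eta.
have b12 := bingham_moment12_gt0 eta.
have b00 := @bingham_moment0_gt0 R n n0 k eta.
have kpos : 0 < k%:R :> R by rewrite ltr0n.
have rec1 := bingham_rec eta 1.
have E : 2 * ((n%:R - k%:R) * k%:R * b eta 0 / (2 * (b eta 1 - b eta 2))) *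
    (b eta 2 / (k * (k + 2))%:R) =
    b eta 0 * (((n%:R - k%:R) * b eta 2) / ((b eta 1 - b eta 2) * (k%:R + 2))).
  rewrite natrM natrD; field.
  by rewrite !lt0r_neq0// addr_gt0.
have den : 0 < (b eta 1 - b eta 2) * (k%:R + 2) by rewrite mulr_gt0// addr_gt0.
move: h; rewrite E ger_pMr// ler_pdivrMr// mul1r => h.
rewrite -(pmulr_lle0 _ b23) -(@pmulr_rle0 _ 2)// mulrA -rec1 mulr1.
by lra.
Qed.

Lemma tail_kurtE eta : kurt (~: B) (bingham B eta) =
  (b eta 0 - 2 * b eta 1 + b eta 2) / ((n%:R - k%:R) * (n%:R - k%:R + 2)).
Proof.
rewrite /kurt cardsCs finset.setCK cB card_ord natrM natrD natrB ?(ltnW kn)//.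
congr (_ / _).
rewrite (@eq_wint _ _ _ _ (fun x => sqn B x ^+ 0 - 2 * sqn B x ^+ 1 + sqn B x ^+ 2)); last first.
  by move=> x Sx; rewrite sqn_sphereC//; ring.
have bW := sphere_bounded_bingham B eta.
rewrite wintD//; [|by sphere_bnd..].
rewrite wintB//; [|by sphere_bnd..].
by rewrite wintZ//; sphere_bnd.
Qed.

(** Both integrations by parts, with one and with two powers of s, are spent
    here; the defect is eta times the positive integral of s (1 - s)^2. *)
Lemma sigma_tail_kurtE eta :
  2 * sigma_k n k eta * kurt (~: B) (bingham B eta) =
  b eta 0 * (1 - 2 * eta * (b eta 1 - 2 * b eta 2 + b eta 3) /
                 ((b eta 1 - b eta 2) * (n%:R - k%:R + 2))).
Proof.
rewrite tail_kurtE sigma_k_bingham.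
have b12 := bingham_moment12_gt0 eta.
have nk : 0 < n%:R - k%:R :> R by rewrite subr_gt0 ltr_nat.
have rec0 := bingham_rec eta 0; have rec1 := bingham_rec eta 1.
have E : k%:R * (b eta 0 - 2 * b eta 1 + b eta 2) =
    (b eta 1 - b eta 2) * (n%:R - k%:R + 2) -
    2 * eta * (b eta 1 - 2 * b eta 2 + b eta 3) by lra.
transitivity (b eta 0 * ((k%:R * (b eta 0 - 2 * b eta 1 + b eta 2)) /
    ((b eta 1 - b eta 2) * (n%:R - k%:R + 2)))).
  by field; rewrite !lt0r_neq0// addr_gt0.
by rewrite E; field; rewrite !lt0r_neq0// addr_gt0.
Qed.

Lemma tail_kurt_stable eta : 0 <= eta ->
  2 * sigma_k n k eta * kurt (~: B) (bingham B eta) <= b eta 0.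
Proof.
move=> e0; have [_ b13] := bingham_beta_gt0 B0 Bn eta.
have b12 := bingham_moment12_gt0 eta.
have b00 := @bingham_moment0_gt0 R n n0 k eta.
have nk : 0 < n%:R - k%:R :> R by rewrite subr_gt0 ltr_nat.
rewrite sigma_tail_kurtE ger_pMr// gerBl divr_ge0// mulr_ge0 ?(ltW b12) ?(ltW b13)//.
  by rewrite mulr_ge0.
by rewrite addr_ge0// ltW.
Qed.

Lemma stable_tail_ge0 eta Q : (1 < n - k)%N -> orthogonal_mx Q ->
  stable (sigma_k n k eta) (h_k k eta Q) -> 0 <= eta.
Proof.
move=> nk1 QQ; have C1 : (1 < #|~: B|)%N by rewrite cardsCs finset.setCK cB card_ord.
move/(stable_block n0 (sigma_k_gt0 eta) QQ C1 (@bingham_inv_tail eta)).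
have [_ b13] := bingham_beta_gt0 B0 Bn eta.
have b12 := bingham_moment12_gt0 eta.
have b00 := @bingham_moment0_gt0 R n n0 k eta.
have nk : 0 < n%:R - k%:R :> R by rewrite subr_gt0 ltr_nat.
have den : 0 < (b eta 1 - b eta 2) * (n%:R - k%:R + 2).
  by rewrite mulr_gt0// addr_gt0.
rewrite sigma_tail_kurtE ger_pMr// gerBl => h.
rewrite -(pmulr_lge0 _ b13) -(@pmulr_rge0 _ 2)// mulrA.
by rewrite -(@pmulr_lge0 _ (((b eta 1 - b eta 2) * (n%:R - k%:R + 2))^-1)) ?invr_gt0.
Qed.

End block_instability.

Lemma wint_weight (R : realType) (n : nat) (W G F : euclid R n -> R) :
  wint (fun x => W x * G x) F = wint W (fun x => G x * F x).
Proof. by apply: eq_sint => x _; rewrite mulrA. Qed.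

(** * The minimizer of sigma *)

Section maximal_ratio.
Context (R : realType) (n k : nat) (k0 : (0 < k)%N) (kn : (k < n)%N).
Implicit Types (eta : R).
Local Notation B := (headset n k).
Local Notation b := (@bingham_moment R n B).

Let n0 : (0 < n)%N := leq_ltn_trans (leq0n k) kn.
Let cB : #|B| = k := card_headset (ltnW kn).

Definition bingham_cov eta : R :=
  b eta 0 * (b eta 2 - b eta 3) - b eta 1 * (b eta 1 - b eta 2).

Lemma bingham_ratio_secant eta d : d != 0 -> d * bingham_cov eta <= 0 ->
  (b (eta + d) 1 - b (eta + d) 2) / b (eta + d) 0 <
  (b eta 1 - b eta 2) / b eta 0.
Proof.
have B0 : (0 < #|B|)%N by rewrite cB.
have Bn : (#|B| < n)%N by rewrite cB.
have [C C0 mE] := @bingham_theta R n B B0 Bn; rewrite /bingham_cov !mE => d0 dcov.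
have Cn : C != 0 by rewrite lt0r_neq0.
have tn e : theta_moment n #|B| e 0 != 0 by rewrite lt0r_neq0// theta_moment_gt0.
have rE e : (C * theta_moment n #|B| e 1 - C * theta_moment n #|B| e 2) /
    (C * theta_moment n #|B| e 0) =
    (theta_moment n #|B| e 1 - theta_moment n #|B| e 2) / theta_moment n #|B| e 0.
  by field; rewrite Cn tn.
rewrite !rE; apply: theta_ratio_secant => //.
have C2 : 0 < C ^+ 2 by rewrite exprn_gt0.
rewrite -(pmulr_rle0 _ C2); apply: le_trans dcov; rewrite le_eqVlt; apply/orP; left.
by apply/eqP; rewrite /theta_cov; ring.
Qed.

Lemma minimizer_ratio eta1 eta : sigma_k n k eta1 <= sigma_k n k eta ->
  (b eta 1 - b eta 2) / b eta 0 <= (b eta1 1 - b eta1 2) / b eta1 0.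
Proof.
have b12 e := @bingham_moment12_gt0 R n k k0 kn e.
have b00 e := @bingham_moment0_gt0 R n n0 k e.
have kpos : 0 < k%:R :> R by rewrite ltr0n.
have nk : 0 < n%:R - k%:R :> R by rewrite subr_gt0 ltr_nat.
have sE e : sigma_k n k e = (n%:R - k%:R) * k%:R / 2 * ((b e 1 - b e 2) / b e 0)^-1.
  rewrite sigma_k_bingham//; field.
  by rewrite !lt0r_neq0.
rewrite !sE ler_pM2l ?divr_gt0 ?mulr_gt0// lef_pV2// posrE divr_gt0//.
Qed.

(** If the covariance at eta did not point towards eta_1, [bingham_ratio_secant]
    would make the ratio smaller at eta_1 than at eta. *)
Lemma minimizer_cov eta1 : (forall eta, sigma_k n k eta1 <= sigma_k n k eta) ->
  forall eta, (eta1 < eta -> bingham_cov eta < 0) /\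
              (eta < eta1 -> 0 < bingham_cov eta).
Proof.
move=> min1 eta.
have h : eta1 != eta -> 0 < (eta1 - eta) * bingham_cov eta.
  move=> ne; rewrite ltNge; apply/negP => le0.
  have := minimizer_ratio (min1 eta); apply/negP; rewrite -ltNge.
  have := @bingham_ratio_secant eta (eta1 - eta); rewrite subr_eq0 => /(_ ne le0).
  by rewrite (_ : eta + (eta1 - eta) = eta1)//; ring.
split=> lt1.
  by have := h (negbT (lt_eqF lt1)); rewrite nmulr_rgt0 ?subr_lt0.
by have := h (negbT (gt_eqF lt1)); rewrite pmulr_rgt0 ?subr_gt0.
Qed.

End maximal_ratio.

(** * The axially symmetric densities *)

Section axial.
Context (R : realType) (n : nat) (n3 : (3 <= n)%N).
Implicit Types (eta : R) (Q M : 'M[R]_n) (x : euclid R n).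
Local Notation B := (headset n 1).
Local Notation b := (@bingham_moment R n B).
Local Notation nu := (n%:R - 1 : R).

Let n0 : (0 < n)%N := leq_trans (isT : (1 <= 3)%N) n3.
Let n1 : (1 < n)%N := leq_trans (isT : (2 <= 3)%N) n3.
Let cB : #|B| = 1%N := card_headset n0.
Let i0 : 'I_n := Ordinal n0.

Let BE : B = [set i0]%SET.
Proof.
apply/setP => i; rewrite !inE -val_eqE /=.
by case: (i : nat).
Qed.

Let cC : #|~: B| = n.-1.
Proof. by rewrite cardsCs finset.setCK cB card_ord subn1. Qed.

Let C1 : (1 < #|~: B|)%N.
Proof. by rewrite cC -ltnS prednK. Qed.

Let i0C i : (i \in ~: B) = (i != i0).
Proof. by rewrite BE !inE. Qed.

Let nu0 : 0 < nu.
Proof. by rewrite subr_gt0 ltr1n. Qed.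

Let cCnu : #|~: B|%:R = nu.
Proof. by rewrite cC -[in RHS](prednK n0) -addn1 natrD addrK. Qed.

Let sqnB x : sqn B x = coor x i0 ^+ 2.
Proof. by rewrite BE /sqn big_set1. Qed.

Let Csum (F : 'I_n -> R) : \sum_i F i = F i0 + \sum_(i in ~: B) F i.
Proof.
rewrite (bigD1 i0)//=; congr (_ + _).
by apply: eq_bigl => i; rewrite i0C.
Qed.

(** At eta = 0 the recursion determines the moments, and the covariance is a
    positive multiple of (n - 1) (n - 2). *)
Lemma bingham_cov0_gt0 : 0 < @bingham_cov R n 1 0.
Proof.
have rec p := @bingham_rec R n 1 isT n1 0 p.
have := rec 0%N; have := rec 1%N; have := rec 2.
rewrite !mulr0 !mul0r !addr0 mulr1 => r2 r1 r0.
have b00 := @bingham_moment0_gt0 R n n0 1 0.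
have npos : 0 < n%:R :> R by rewrite ltr0n.
have n2 : 0 < n%:R - 2 :> R by rewrite subr_gt0 ltr_nat.
have b0E : b 0 0 = n%:R * b 0 1 by lra.
have b1pos : 0 < b 0 1 by move: b00; rewrite b0E pmulr_rgt0.
have b2E : b 0 2 = 3 * b 0 1 / (n%:R + 2).
  by apply: (mulIf (lt0r_neq0 (addr_gt0 npos (ltr0n _ 2)))); rewrite divfK ?lt0r_neq0 ?addr_gt0//; lra.
have b3E : b 0 3 = 15 * b 0 1 / ((n%:R + 2) * (n%:R + 4)).
  have E4 : (n%:R + 4) * b 0 3 = 5 * b 0 2 by lra.
  apply: (mulfI (lt0r_neq0 (addr_gt0 npos (ltr0n _ 4)))).
  rewrite [LHS]E4 b2E; field.
  by rewrite !lt0r_neq0// addr_gt0.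
rewrite /bingham_cov b0E b2E b3E.
rewrite (_ : _ - _ = b 0 1 ^+ 2 * (2 * nu * (n%:R - 2)) / ((n%:R + 2) * (n%:R + 4))); last first.
  by field; rewrite !lt0r_neq0// addr_gt0.
apply: divr_gt0; last by rewrite mulr_gt0// addr_gt0.
by rewrite mulr_gt0 ?exprn_gt0// mulr_gt0// mulr_gt0.
Qed.

(** Integration by parts with s and with 1.  The left-hand side is b_0^2 times
    n Var s - 2 E (s (1 - s)), the quantity that decides axial stability. *)
Lemma bingham_variance eta :
  n%:R * (b eta 0 * b eta 2 - b eta 1 ^+ 2) - 2 * b eta 0 * (b eta 1 - b eta 2) =
  2 * eta * bingham_cov n 1 eta.
Proof.
have r0 := @bingham_rec R n 1 isT n1 eta 0.
have r1 := @bingham_rec R n 1 isT n1 eta 1.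
rewrite /bingham_cov.
transitivity (b eta 0 * ((n%:R + 2 * 1%:R) * b eta 2 - (1%:R + 2 * 1%:R) * b eta 1)
   - b eta 1 * ((n%:R + 2 * 0%:R) * b eta 1 - (1%:R + 2 * 0%:R) * b eta 0)); first by ring.
by rewrite r0 r1; ring.
Qed.

Lemma split_quad M x : M^T = M -> quad M x = M i0 i0 * coor x i0 ^+ 2
  + 2 * (coor x i0 * linB (~: B) (M i0) x) + quadB (~: B) M x.
Proof.
move=> MT; have Msym i : M i i0 = M i0 i by rewrite -{1}MT mxE.
rewrite /quad Csum Csum /linB /quadB mulr_sumr.
rewrite [X in _ + _ + X](eq_bigr (fun i => coor x i0 * (M i0 i * coor x i) +
    \sum_(j in ~: B) M i j * (coor x i * coor x j))); last first.
  by move=> i _; rewrite Csum Msym; congr (_ + _); ring.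
rewrite big_split /=.
rewrite [X in _ + X + _](eq_bigr (fun i => coor x i0 * (M i0 i * coor x i))); last first.
  by move=> i _; ring.
by rewrite -mulr_sumr; ring.
Qed.

Lemma split_frob M : M^T = M -> frob M = M i0 i0 ^+ 2
  + 2 * (\sum_(j in ~: B) M i0 j ^+ 2) + \sum_(i in ~: B) \sum_(j in ~: B) M i j ^+ 2.
Proof.
move=> MT; have Msym i : M i i0 = M i0 i by rewrite -{1}MT mxE.
rewrite /frob Csum Csum.
rewrite [X in _ + _ + X](eq_bigr (fun i => M i0 i ^+ 2 +
    \sum_(j in ~: B) M i j ^+ 2)); last by move=> i _; rewrite Csum Msym.
by rewrite big_split /=; ring.
Qed.

Lemma split_trace M : \tr M = M i0 i0 + \sum_(i in ~: B) M i i.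
Proof. exact: Csum. Qed.

Lemma axial_quadratic eta (A D : R) :
  wint (bingham B eta) (fun x => A * sqn B x - D) = A * b eta 1 - D * b eta 0 /\
  wint (bingham B eta) (fun x => (A * sqn B x - D) ^+ 2) =
    A ^+ 2 * b eta 2 - 2 * A * D * b eta 1 + D ^+ 2 * b eta 0.
Proof.
have bW := sphere_bounded_bingham B eta; split.
  rewrite (@eq_wint _ _ _ _ (fun x => A * sqn B x ^+ 1 - D * sqn B x ^+ 0)); last first.
    by move=> x _; ring.
  by rewrite wintB ?wintZ//; sphere_bnd.
rewrite (@eq_wint _ _ _ _ (fun x => A ^+ 2 * sqn B x ^+ 2 - 2 * A * D * sqn B x ^+ 1 +
    D ^+ 2 * sqn B x ^+ 0)); last by move=> x _; ring.
rewrite wintD; [|by sphere_bnd..].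
rewrite wintB; [|by sphere_bnd..].
by rewrite !wintZ//; sphere_bnd.
Qed.

(** The test matrix is diag (1, - 1 / (n - 1), ..., - 1 / (n - 1)), whose form is
    (n s - 1) / (n - 1) on the sphere. *)
Lemma axial_unstable eta Q : orthogonal_mx Q -> 0 < eta ->
  0 < bingham_cov n 1 eta -> ~ stable (sigma_k n 1 eta) (h_k 1 eta Q).
Proof.
move=> QQ e0 cov0; have a0 := @sigma_k_gt0 R n 1 isT n1 eta.
have b00 := @bingham_moment0_gt0 R n n0 1 eta.
have b12 := @bingham_moment12_gt0 R n 1 isT n1 eta.
move/(stable_bingham n0 _ _ a0 QQ) => crit.
pose dv : 'rV[R]_n := \row_i (if i == i0 then 1 else - nu^-1).
pose M := diag_mx dv.
have MT : M^T = M by exact: tr_diag_mx.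
have M00 : M i0 i0 = 1 by rewrite !mxE !eqxx mulr1n.
have MC i j : i \in ~: B -> M i j = (- nu^-1) *+ (i == j).
  by rewrite i0C => ii0; rewrite !mxE (negPf ii0).
have M0j j : j \in ~: B -> M i0 j = 0.
  by rewrite i0C => ji0; rewrite !mxE [i0 == j]eq_sym (negPf ji0) mulr0n.
have nun : nu != 0 by rewrite lt0r_neq0.
have Mtr : \tr M = 0.
  rewrite split_trace M00 (eq_bigr (fun=> - nu^-1)); last first.
    by move=> i iC; rewrite MC// eqxx mulr1n.
  by rewrite sumr_const -[_ *+ #|_|]mulr_natr cCnu mulNr mulVf// subrr.
have diagC i (F : 'I_n -> R) : i \in ~: B ->
    \sum_(j in ~: B) (- nu^-1) *+ (i == j) * F j = - nu^-1 * F i.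
  move=> iC; rewrite (bigD1 i)//= eqxx mulr1n big1 ?addr0// => j /andP[_ ji].
  by rewrite eq_sym (negPf ji) mulr0n mul0r.
have FM : frob M = n%:R / nu.
  rewrite split_frob// M00 expr1n big1; last by move=> j /M0j ->; rewrite expr0n.
  rewrite (eq_bigr (fun=> nu^-1 ^+ 2)); last first.
    move=> i iC; rewrite (eq_bigr (fun j => (- nu^-1) *+ (i == j) * M i j)); last first.
      by move=> j jC; rewrite expr2 {1}MC.
    by rewrite diagC// MC// eqxx mulr1n; ring.
  by rewrite sumr_const -[_ *+ #|_|]mulr_natr cCnu; field.
have qM x : sphere x -> quad M x = n%:R / nu * sqn B x - nu^-1.
  move=> Sx; rewrite split_quad// M00 /linB big1; last by move=> j /M0j ->; rewrite mul0r.
  rewrite /quadB (eq_bigr (fun i => - nu^-1 * coor x i ^+ 2)); last first.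
    move=> i iC; rewrite (eq_bigr (fun j => (- nu^-1) *+ (i == j) * (coor x i * coor x j))).
      by rewrite diagC// expr2.
    by move=> j jC; rewrite MC.
  rewrite -mulr_sumr -/(sqn (~: B) x) sqn_sphereC// sqnB.
  by field.
(* the mean of the form *)
pose c := n%:R / nu * (b eta 1 / b eta 0) - nu^-1.
have b0n : b eta 0 != 0 by rewrite lt0r_neq0.
have [E1 E2] := axial_quadratic eta (n%:R / nu) (nu^-1 + c).
have := crit M c MT Mtr.
rewrite (@eq_wint _ _ _ _ (fun x => n%:R / nu * sqn B x - (nu^-1 + c))); last first.
  by move=> x Sx; rewrite qM//; ring.
rewrite E1 (_ : _ - _ = 0); last by rewrite /c; field; rewrite nun b0n.
move=> /(_ erefl).
rewrite (@eq_wint _ _ _ _ (fun x => (n%:R / nu * sqn B x - (nu^-1 + c)) ^+ 2)); last first.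
  by move=> x Sx; rewrite qM//; congr (_ ^+ 2); ring.
rewrite E2 FM sigma_k_bingham//.
set X := (X in X <= _).
rewrite (_ : X = b eta 0 * (n%:R / nu) *
    (n%:R * (b eta 0 * b eta 2 - b eta 1 ^+ 2) / (2 * b eta 0 * (b eta 1 - b eta 2)))); last first.
  by rewrite /X /c; field; rewrite nun b0n lt0r_neq0.
rewrite ger_pMr; last by rewrite mulr_gt0// divr_gt0// ltr0n.
rewrite ler_pdivrMr; last by rewrite !mulr_gt0.
apply/negP; rewrite -ltNge mul1r -subr_gt0 bingham_variance.
by rewrite !mulr_gt0.
Qed.

(** On the sphere m . M m is an affine function of s, plus 2 m_0 times a linear
    form in the other coordinates, plus a traceless form N in them; M and N
    differ on the block by a multiple of the identity, moved to the first part.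
    The three parts are orthogonal, and their variances are compared with their
    shares of |M|^2 one by one; for the second part this is an equality. *)
Lemma axial_stable eta Q : orthogonal_mx Q -> 0 <= eta ->
  bingham_cov n 1 eta <= 0 -> stable (sigma_k n 1 eta) (h_k 1 eta Q).
Proof.
move=> QQ e0 cov0; have a0 := @sigma_k_gt0 R n 1 isT n1 eta.
have b00 := @bingham_moment0_gt0 R n n0 1 eta.
have b12 := @bingham_moment12_gt0 R n 1 isT n1 eta.
have bW := sphere_bounded_bingham B eta.
have nun : nu != 0 by rewrite lt0r_neq0.
have b0n : b eta 0 != 0 by rewrite lt0r_neq0.
pose W := bingham B eta.
have Winv := @bingham_inv_tail R n 1 eta.
apply/(stable_bingham n0 _ _ a0 QQ) => M c MT Mtr.
pose a := M i0 i0.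
pose N := M + (a / nu)%:M.
have NT : N^T = N by rewrite /N linearD /= MT tr_scalar_mx.
have NtrC : \sum_(i in ~: B) N i i = 0.
  rewrite (eq_bigr (fun i => M i i + a / nu)); last first.
    by move=> i _; rewrite !mxE eqxx mulr1n.
  rewrite big_split /= sumr_const -[_ *+ #|_|]mulr_natr cCnu divfK//.
  by rewrite addrC -split_trace.
pose A := a * (n%:R / nu); pose D := a / nu + c.
pose P x := A * sqn B x - D.
pose v x := linB (~: B) (M i0) x.
pose q x := quadB (~: B) N x.
have bP : sphere_bounded P by rewrite /P; sphere_bnd.
have bv : sphere_bounded v by exact: sphere_bounded_linB.
have bq : sphere_bounded q by exact: sphere_bounded_quadB.
have bx0 : sphere_bounded (fun x => coor x i0) by exact: sphere_bounded_coor.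
have inv0 i j (d s : R) x : i \in ~: B -> j \in ~: B ->
    coor (refl i j d s x) i0 = coor x i0.
  by rewrite !i0C => ii0 ji0; rewrite coor_reflN// eq_sym.
have invP i j (d s : R) x : i \in ~: B -> j \in ~: B -> P (refl i j d s x) = P x.
  by move=> iC jC; rewrite /P !sqnB inv0.
have WG (G : euclid R n -> R) :
    (forall i j (d s : R) x, i \in ~: B -> j \in ~: B -> G (refl i j d s x) = G x) ->
    forall i j (d s : R) x, i \in ~: B -> j \in ~: B -> i != j ->
      d ^+ 2 + s ^+ 2 = 1 -> W (refl i j d s x) * G (refl i j d s x) = W x * G x.
  by move=> Ginv i j d s x iC jC ij ds; rewrite Ginv// /W Winv.
have bWG G : sphere_bounded G -> sphere_bounded (fun x => W x * G x).
  by move=> bG; exact: sphere_boundedM.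
have qE x : sphere x -> quad M x - c = P x + 2 * (coor x i0 * v x) + q x.
  move=> Sx; rewrite split_quad// -/a /q.
  have -> : quadB (~: B) N x = quadB (~: B) M x + a / nu * sqn (~: B) x.
    rewrite /quadB /sqn mulr_sumr -big_split; apply: eq_bigr => i iC /=.
    rewrite (bigD1 i)//= [in RHS](bigD1 i)//= !mxE eqxx mulr1n.
    rewrite (eq_bigr (fun j => M i j * (coor x i * coor x j))); first by ring.
    by move=> j /andP[_ ji]; rewrite !mxE eq_sym (negPf ji) mulr0n addr0.
  by rewrite sqn_sphereC// /P /A /D sqnB /v; field.
(* A function of the axial coordinate is absorbed into the weight, which keeps
   its symmetry; the cross terms then vanish as moments of the block. *)
have x0v : wint W (fun x => coor x i0 * v x) = 0.
  rewrite -wint_weight; apply: (block_lin_mean n0 C1); first exact: bWG.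
  exact: (WG (fun x => coor x i0)).
have Pv : wint W (fun x => P x * coor x i0 * v x) = 0.
  rewrite -wint_weight; apply: (block_lin_mean n0 C1); first exact/bWG/sphere_boundedM.
  by apply: (WG (fun x => P x * coor x i0)) => *; rewrite invP// inv0.
have Wq : wint W q = 0 by exact: (block_quad_mean n0 C1 bW Winv).
have Pq : wint W (fun x => P x * q x) = 0.
  rewrite -wint_weight; apply: (block_quad_mean n0 C1) => //; first exact: bWG.
  exact: WG.
have vq : wint W (fun x => coor x i0 * (v x * q x)) = 0.
  rewrite -wint_weight; apply: (block_lin_quad n0 C1); first exact: bWG.
  exact: (WG (fun x => coor x i0)).
have vv : wint W (fun x => coor x i0 ^+ 2 * v x ^+ 2) =
    (\sum_(j in ~: B) M i0 j ^+ 2) * ((b eta 1 - b eta 2) / nu).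
  rewrite -wint_weight (block_lin_sq n0 C1); last 2 first.
  - exact/bWG/sphere_boundedX.
  - by apply: (WG (fun x => coor x i0 ^+ 2)) => *; rewrite inv0.
  rewrite cCnu wint_weight; congr (_ * (_ / _)).
  rewrite (@eq_wint _ _ _ _ (fun x => sqn B x ^+ 1 - sqn B x ^+ 2)); last first.
    by move=> x Sx; rewrite sqn_sphereC// sqnB; ring.
  by rewrite wintB//; sphere_bnd.
have qq : wint W (fun x => q x ^+ 2) =
    2 * kurt (~: B) W * \sum_(i in ~: B) \sum_(j in ~: B) N i j ^+ 2.
  exact: (block_quad_sq n0 C1 bW Winv).
have [E1 E2] := axial_quadratic eta A D.
rewrite (@eq_wint _ _ _ _ (fun x => P x + 2 * (coor x i0 * v x) + q x))//.
rewrite wintD//; last by sphere_bnd.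
rewrite wintD//; last by sphere_bnd.
rewrite wintZ//; last by sphere_bnd.
rewrite [wint _ P]E1 x0v Wq mulr0 !addr0 => PE.
rewrite (@eq_wint _ _ _ _ (fun x => P x ^+ 2 + 4 * (coor x i0 ^+ 2 * v x ^+ 2) + q x ^+ 2
   + (4 * (P x * coor x i0 * v x) + 2 * (P x * q x) + 4 * (coor x i0 * (v x * q x))))); last first.
  by move=> x Sx; rewrite qE//; ring.
have b1 := sphere_boundedX 2 bP; have b2 := sphere_boundedX 2 bq.
have b3 : sphere_bounded (fun x => coor x i0 ^+ 2 * v x ^+ 2).
  by apply: sphere_boundedM; exact: sphere_boundedX.
have b4 : sphere_bounded (fun x => P x * coor x i0 * v x) by do 2 apply: sphere_boundedM => //.
have b5 : sphere_bounded (fun x => P x * q x) by exact: sphere_boundedM.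
have b6 : sphere_bounded (fun x => coor x i0 * (v x * q x)) by do 2 apply: sphere_boundedM => //.
rewrite wintD; [|by sphere_bnd..].
rewrite wintD; [|by sphere_bnd..].
rewrite wintD; [|by sphere_bnd..].
rewrite [X in _ + X](_ : _ = 0); last first.
  rewrite wintD; [|by sphere_bnd..].
  rewrite wintD; [|by sphere_bnd..].
  by rewrite !wintZ// Pv Pq vq !mulr0 !addr0.
rewrite addr0 wintZ// vv qq [wint _ _]E2.
rewrite split_frob// -/a.
set S1 := \sum_(j in ~: B) M i0 j ^+ 2.
set S2 := \sum_(i in ~: B) \sum_(j in ~: B) N i j ^+ 2.
have S2E : \sum_(i in ~: B) \sum_(j in ~: B) M i j ^+ 2 = S2 + a ^+ 2 / nu.
  have Mtr' : \sum_(i in ~: B) M i i = - a.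
    by apply/eqP; rewrite -addr_eq0 addrC -split_trace Mtr.
  have inner i : i \in ~: B -> \sum_(j in ~: B) N i j ^+ 2 =
      \sum_(j in ~: B) M i j ^+ 2 + (2 * (a / nu) * M i i + (a / nu) ^+ 2).
    move=> iC; rewrite (bigD1 i)//= [in RHS](bigD1 i)//= !mxE eqxx mulr1n.
    rewrite (eq_bigr (fun j => M i j ^+ 2)); first by ring.
    by move=> j /andP[_ ji]; rewrite !mxE eq_sym (negPf ji) mulr0n addr0.
  rewrite /S2 (eq_bigr _ inner) !big_split /= -mulr_sumr Mtr' sumr_const.
  by rewrite -[_ *+ #|_|]mulr_natr cCnu; field.
rewrite S2E.
have S20 : 0 <= S2 by apply: sumr_ge0 => i _; apply: sumr_ge0 => j _; exact: sqr_ge0.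
have h3 := ler_wpM2r S20 (@tail_kurt_stable R n 1 isT n1 eta e0).
have h2 : sigma_k n 1 eta * (4 * (S1 * ((b eta 1 - b eta 2) / nu))) = b eta 0 * (2 * S1).
  by rewrite sigma_k_bingham//; field; rewrite nun lt0r_neq0.
have h1 : sigma_k n 1 eta * (A ^+ 2 * b eta 2 - 2 * A * D * b eta 1 + D ^+ 2 * b eta 0) <=
    b eta 0 * (a ^+ 2 + a ^+ 2 / nu).
  have DE : D = A * b eta 1 / b eta 0.
    by apply: (mulIf b0n); rewrite divfK//; lra.
  rewrite DE /A sigma_k_bingham//.
  set X := (X in X <= _).
  rewrite (_ : X = (b eta 0 * (a ^+ 2 * (n%:R / nu))) *
    (n%:R * (b eta 0 * b eta 2 - b eta 1 ^+ 2) / (2 * b eta 0 * (b eta 1 - b eta 2)))); last first.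
    by rewrite /X; field; rewrite nun b0n lt0r_neq0.
  rewrite (_ : a ^+ 2 + a ^+ 2 / nu = a ^+ 2 * (n%:R / nu)); last by field.
  apply: ler_piMr.
    by rewrite mulr_ge0 ?(ltW b00)// mulr_ge0 ?sqr_ge0// divr_ge0// ltW.
  rewrite ler_pdivrMr; last by rewrite !mulr_gt0.
  rewrite mul1r -subr_le0 bingham_variance.
  by rewrite mulr_ge0_le0// mulr_ge0.
have h4 : sigma_k n 1 eta * (2 * kurt (~: B) W * S2) <= b eta 0 * S2.
  by apply: le_trans h3; rewrite le_eqVlt; apply/orP; left; apply/eqP; ring.
rewrite mulrDr [X in X + _]mulrDr h2.
apply: le_trans (lerD (lerD h1 (lexx _)) h4) _.
by rewrite le_eqVlt; apply/orP; left; apply/eqP; field.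
Qed.

End axial.

Theorem theorem1p1 (R : realType) (n : nat) (hn : (3 <= n)%N) :
  [/\ forall alpha : R, 0 < alpha ->
        (stable alpha (@h_iso R n) <-> alpha <= (n * (n + 2))%:R / 2),
      forall (k : nat) (Q : 'M[R]_n) (eta : R),
        (2 <= k)%N -> (k <= n %/ 2)%N -> orthogonal_mx Q -> eta != 0 ->
        ~ stable (sigma_k n k eta) (h_k k eta Q)
    & forall eta1 : R, (forall eta : R, sigma_k n 1 eta1 <= sigma_k n 1 eta) ->
        forall (Q : 'M[R]_n) (eta : R), orthogonal_mx Q -> eta != 0 ->
        (eta1 < eta -> stable (sigma_k n 1 eta) (h_k 1 eta Q)) /\
        (eta < eta1 -> ~ stable (sigma_k n 1 eta) (h_k 1 eta Q))].
Proof.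
have n1 : (1 < n)%N by exact: leq_trans hn.
split.
- by move=> alpha; exact: isotropic_stable.
- move=> k Q eta k2 kn2 QQ /eqP e0 st; apply: e0.
  have k0 : (0 < k)%N by exact: leq_trans k2.
  have k2n : (k * 2 <= n)%N by rewrite (leq_trans _ (leq_trunc_div n 2))// leq_mul2r kn2 orbT.
  have kn : (k < n)%N.
    by apply: leq_trans k2n; rewrite muln2 -addnn -addn1 leq_add2l.
  have nk : (1 < n - k)%N.
    rewrite ltn_subRL; apply: leq_trans k2n; rewrite muln2 -addnn -addnS.
    by rewrite leq_add2l.
  apply/eqP; rewrite eq_le (stable_head_le0 k0 kn k2 QQ st).
  exact: (stable_tail_ge0 k0 kn nk QQ st).
move=> eta1 min1 Q eta QQ e0.
have cov := minimizer_cov (isT : (0 < 1)%N) n1 min1.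
have eta10 : 0 <= eta1.
  rewrite leNgt; apply/negP => lt0.
  by have := bingham_cov0_gt0 R hn; have := (cov 0).1 lt0; lra.
split=> lt1.
  apply: axial_stable => //; first exact: ltW (le_lt_trans eta10 lt1).
  exact/ltW/(cov eta).1.
have [en|ep|/eqP] := ltgtP eta 0; last by rewrite (negPf e0).
  move=> st; have nk : (1 < n - 1)%N by rewrite ltn_subRL.
  by have := stable_tail_ge0 (isT : (0 < 1)%N) n1 nk QQ st; rewrite leNgt en.
by apply: axial_unstable => //; exact: (cov eta).2.
Qed.
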